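(* Let $X\subseteq[0,\infty)^k$ be an infinite discrete additive semigroup with $0\in X$, and let $\mathscr{A}=\mathbb{C}^X$ be its Dirichlet algebra. Let $V\subseteq\mathbb{C}^n$ and $Z\subseteq\mathbb{C}^m$ be open, let $F\colon V\times Z\to\mathbb{C}^m$, $(v,z)\mapsto F(v,z)$ be holomorphic, and let $(v_0,z_0)\in V\times Z$ be such that $F(v_0,z_0)=0$. Let $a_1,\ldots,a_n\in\mathscr{A}$ satisfy $(a_1(0),\ldots,a_n(0))=v_0$. Suppose that the differential $\partial_zF(v_0,z)$ at $z=z_0$ is in $\mathrm{GL}_m(\mathbb{C})$. Then there exists a unique $m$-tuple $(g_1,\ldots,g_m)\in\mathscr{A}^m$ such that $$\text{(1)}\ \ (g_1(0),\ldots,g_m(0))=z_0\qquad\text{and}\qquad \text{(2)}\ \ F[a_1,\ldots,a_n,g_1,\ldots,g_m]=0.$$ If, in addition, $a_1,\ldots,a_n\in\mathscr{A}_\infty$, then also $g_1,\ldots,g_m\in\mathscr{A}_\infty$, and for all sufficiently large $r$ both $$\text{(3)}\ \ (\widetilde{a}_1(s),\ldots,\widetilde{a}_n(s),\widetilde{g}_1(s),\ldots,\widetilde{g}_m(s))\in V\times Z$$ and $$\text{(4)}\ \ F(\widetilde{a}_1(s),\ldots,\widetilde{a}_n(s),\widetilde{g}_1(s),\ldots,\widetilde{g}_m(s))=0$$ hold for all $s\in\overline{H}_r^{\,k}$. In this case, (1), (3) and (4) also uniquely determine $(g_1,\ldots,g_m)$ in $\mathscr{A}_\infty^m$: if $(h_1,\ldots,h_m)\in\mathscr{A}_\infty^m$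 satisfies $(h_1(0),\ldots,h_m(0))=z_0$ and, for some $r$ such that all $\widetilde a_i$ and $\widetilde h_j$ converge absolutely on $\overline{H}_r^{\,k}$, (3) and (4) hold with $h_j$ in place of $g_j$ for all $s\in\overline{H}_r^{\,k}$, then $(h_1,\ldots,h_m)=(g_1,\ldots,g_m)$.
   Context: Here $k,n,m\in\mathbb{N}=\{1,2,\ldots\}$. $X$ is a subset of $[0,\infty)^k$ closed under addition; ''discrete'' means $X$ has no cluster point in $\mathbb{R}^k$ (so $X$ is countable). $\mathscr{A}=\mathbb{C}^X$ is the commutative complex algebra of all functions $g\colon X\to\mathbb{C}$ with convolution $(g*h)(x)=\sum_{x'+x''=x}g(x')h(x'')$ ($x',x''\in X$) and unit $u$, $u(0)=1$, $u(x)=0$ for $x\ne0$; it carries the product topology. For $x\in\mathbb{R}^k$ let $|x|=|x_1|+\cdots+|x_k|$. For $r\in\mathbb{R}$, $\mathscr{A}_r=\{g\in\mathscr{A}:\|g\|_r:=\sum_{x\in X}|g(x)|e^{-r|x|}<\infty\}$, and $\mathscr{A}_\infty=\bigcup_{r\in\mathbb{R}}\mathscr{A}_r$. Let $H_r=\{s\in\mathbb{C}:\operatorname{Re}s>r\}$, with closure $\overline{H}_r$. For $g\in\mathscr{A}_r$ the series $\widetilde g(s)=\sum_{x\in X}g(x)e^{-x\cdot s}$, where $x\cdot s=x_1s_1+\cdots+x_ks_k$, converges absolutely for $s\in\overline{H}_r^{\,k}$, and $\widetilde g(s)$ also denotes its sum. $F[a_1,\ldots,a_n,g_1,\ldots,g_m]\in\mathscr{A}^m$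 is defined componentwise by the multivariable holomorphic functional calculus in $\mathscr{A}$, a complete commutative continuous inverse algebra (a unital topological algebra with locally convex topology, open unit group and continuous inversion). The only unital algebra homomorphism $\mathscr{A}\to\mathbb{C}$ is $g\mapsto g(0)$, so the joint spectrum of $b_1,\ldots,b_N\in\mathscr{A}$ is the single point $p=(b_1(0),\ldots,b_N(0))$. For $f$ holomorphic on an open neighbourhood of $p$, the functional calculus is given concretely by $$f[b_1,\ldots,b_N]=\sum_{\alpha\in\mathbb{N}_0^N}\frac{\partial^\alpha f(p)}{\alpha!}\,(b_1-b_1(0)u)^{*\alpha_1}*\cdots*(b_N-b_N(0)u)^{*\alpha_N},$$ where at each $x\in X$ only finitely many terms are non-zero. Under condition (1), the relevant joint spectrum is $\{(v_0,z_0)\}\subseteq V\times Z$, so the left side of (2) is defined. *)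

(* Defs.v *)
From HB Require Import structures.
From mathcomp Require Import all_boot all_order all_algebra.
From mathcomp Require Import complex.
From mathcomp Require Import all_classical all_reals all_analysis.
From mathcomp Require summability.

Set Implicit Arguments.
Unset Strict Implicit.
Unset Printing Implicit Defensive.

Import Order.TTheory GRing.Theory Num.Theory.
Import numFieldNormedType.Exports.

Local Open Scope classical_set_scope.
Local Open Scope ring_scope.
Local Open Scope complex_scope.

(* R[i] seen as a numClosedFieldType, so that it (and 'rV[_]_n over it) carries
   the norm, topology and normed-module structures of MathComp-Analysis, and
   [differentiable], [derive], [jacobian] are the complex notions. *)
Definition cplx (R : realType) : numClosedFieldType := R[i].

Section ComplexFunctions.
Variable R : realType.
Local Notation C := (cplx R).

Definition cexp (z : C) : C :=
  (expR (complex.Re z) * cos (complex.Im z)) +i*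
  (expR (complex.Re z) * sin (complex.Im z)).

Definition cabs (z : C) : R := complex.Re `|z|.

Definition holomorphic_on (N p : nat) (U : set 'rV[C]_N)
    (f : 'rV[C]_N -> 'rV[C]_p) : Prop :=
  forall w, U w -> differentiable f w.

(* The mixed partial derivative D_0^(alpha 0) ... D_(N-1)^(alpha (N-1)) f. *)
Definition mpartial (N : nat) (alpha : {ffun 'I_N -> nat})
    (f : 'rV[C]_N -> C) : 'rV[C]_N -> C :=
  foldr (fun i h => iter (alpha i) (fun h' => 'D_(delta_mx 0 i) h') h)
    f (enum 'I_N).

Definition halfspace (r : R) : set C := [set s | r < complex.Re s].

Definition closed_halfspaces (k : nat) (r : R) : set 'rV[C]_k :=
  [set s | forall i, closure (halfspace r) (s 0 i)].

(* V * Z, under the identification of C^n * C^m with C^(n + m). *)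
Definition prod_dom (n m : nat) (V : set 'rV[C]_n) (Z : set 'rV[C]_m) :
    set 'rV[C]_(n + m) :=
  [set w | V (lsubmx w) /\ Z (rsubmx w)].

End ComplexFunctions.

Section DirichletAlgebra.
Variables (R : realType) (k : nat) (X : set 'rV[R]_k).
Local Notation C := (cplx R).
(* The Dirichlet algebra C^X is the function type X -> C, where X is coerced to
   the subtype of its elements. *)
Local Notation A := (X -> C).
Implicit Types (g h : A) (r : R) (s : 'rV[C]_k).

(* \sum_(_ \in _) is the sum over the support when that is finite.  If X is a
   discrete subset of [0, oo)^k, then only finitely many pairs contribute. *)
Definition dconv g h : A := fun x =>
  \sum_(p \in [set p : X * X | val p.1 + val p.2 = val x]) g p.1 * h p.2.

Definition dunit : A := fun x => if val x == 0 then 1 else 0.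

Definition dpow g (j : nat) : A := iter j (dconv g) dunit.

Definition l1norm (x : 'rV[R]_k) : R := \sum_(i < k) `|x 0 i|.

Definition dnorm r g : \bar R :=
  \esum_(x in [set: X]) (cabs (g x) * expR (- r * l1norm (val x)))%:E.

Definition in_A_r r g : Prop := (dnorm r g < +oo)%E.

Definition in_A_oo g : Prop := exists r, in_A_r r g.

Definition cdot (x : 'rV[R]_k) s : C := \sum_(i < k) (x 0 i)%:C * s 0 i.

Definition dterm g s (x : X) : C := g x * cexp (- cdot (val x) s).

Definition abs_cvg_at g s : Prop :=
  (\esum_(x in [set: X]) (cabs (dterm g s x))%:E < +oo)%E.

(* Unordered sum: limit of the partial sums along the finite subsets of X. *)
Definition dseries g s : C := summability.sum (dterm g s).

Definition dseries_tuple (N : nat) (b : 'rV[A]_N) s : 'rV[C]_N :=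
  map_mx (fun g => dseries g s) b.

Section WithZero.
Hypothesis X0 : X 0.

Definition origin : X := SigSub (mem_set X0).

Definition at_origin (N : nat) (b : 'rV[A]_N) : 'rV[C]_N :=
  map_mx (fun g => g origin) b.

Definition center_part g : A := fun x => g x - g origin * dunit x.

Definition dmonomial (N : nat) (b : 'rV[A]_N) (alpha : {ffun 'I_N -> nat}) : A :=
  \big[dconv/dunit]_(i < N) dpow (center_part (b 0 i)) (alpha i).

(* Holomorphic functional calculus f[b_1, ..., b_N].  If X is a discrete
   additive subsemigroup of [0, oo)^k, then at each x only finitely many alpha
   give a non-zero term. *)
Definition holo_calc (N : nat) (f : 'rV[C]_N -> C) (b : 'rV[A]_N) : A := fun x =>
  \sum_(alpha \in [set: {ffun 'I_N -> nat}])
    mpartial alpha f (at_origin b) / (\prod_(i < N) (alpha i)`!)%:R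
    * dmonomial b alpha x.

Definition holo_calc_tuple (N p : nat) (f : 'rV[C]_N -> 'rV[C]_p)
    (b : 'rV[A]_N) : 'rV[A]_p :=
  \row_j holo_calc (fun w => f w 0 j) b.

End WithZero.
End DirichletAlgebra.

(* Main.v *)
Require Import Defs.
From HB Require Import structures.
From mathcomp Require Import finmap.
From mathcomp Require Import all_boot all_order all_algebra.
From mathcomp Require Import complex.
From mathcomp Require summability.
From mathcomp Require Import all_classical all_reals all_analysis.
From mathcomp Require Import ring lra.

Set Implicit Arguments.
Unset Strict Implicit.
Unset Printing Implicit Defensive.

Import Order.TTheory GRing.Theory Num.Theory.
Import numFieldNormedType.Exports.

Local Open Scope classical_set_scope.
Local Open Scope ring_scope.

(** The theorem is an implicit function theorem in the algebra [A = C^X], in a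
    formal version and in a version for convergent Dirichlet series.

    _The formal solution._  Since [X] is discrete, its nonzero elements have
    length at least some [delta > 0] (min_weight).  So a product of [d] elements
    without constant term vanishes below length [d delta], and at each point the
    functional calculus is a finite sum, whose degree-one part is given by the
    Jacobian of [F] (Phi_split).  Changing [g] at lengths at least [s + delta]
    changes the part of degree at least 2 only at lengths at least
    [s + 2 delta] (Phi_local).  Hence the Newton step
    [g - (F[a, g]) J^-1], with the Jacobian [J] frozen at the base point,
    determines its result up to length [(N + 1) delta] from [g] up to length
    [N delta]; it has exactly one fixed point, and the fixed points are the
    solutions (newton_local, contraction_fixpoint, exists_unique_solution).

    _Convergence._  The Taylor coefficients of [F] at [(v0, z0)] satisfy Cauchy's
    inequalities.  The elements [a_i] minus their constant terms have norm
    [eps], which tends to 0 as [r] grows.  The equation, solved for its linear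
    part in [g], bounds the norm of [g] minus its constant term, truncated at
    some length, by a multiple of [eps] plus a term quadratic in the norms
    truncated at a smaller length.  A bound proportional to [eps] therefore
    propagates from each truncation length to the next (bootstrap); so [g] lies
    in [A_r] for large [r], with norms as small as desired.  Multiplicative
    functions [x |-> exp(- x s)] bounded by the weight of the norm commute with
    convolution, hence with polynomials, and by norm convergence with the
    functional calculus (eval_Phi); so the equation in the algebra becomes the
    equation between values.

    _Uniqueness by values._  For [h] as in the last part, the same evaluation
    shows that the Dirichlet series of [F[a, h]] vanishes for all [s] with large
    real parts.  A Dirichlet series with that property has zero coefficients
    (psum_injective): a suitable real direction makes a single term dominate.
    So [h] solves the equation and equals [g].

    _Taylor expansion._  The functional calculus is written with iterated
    partial derivatives, so holomorphy of [F] has to be converted into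
    convergence of its Taylor series.  Goursat's lemma on rectangles gives
    Cauchy's formula on squares, and with it the expansion of a function of one
    variable with Cauchy's inequalities (ccoef_expand, ccoef_bound).  The class
    of locally bounded, separately differentiable functions is closed under
    partial derivatives (sholo_D), so the expansion in several variables follows
    one coordinate at a time (taylor_bound, mpl_bound). *)

(** * The complex modulus and complex derivatives *)

Lemma le_of_eq (F : realFieldType) (x y : F) : x = y -> x <= y.
Proof. by move=> ->. Qed.

Section ComplexModulus.
Variable R : realType.
Local Notation C := (cplx R).
Implicit Types (z w : C) (x y r : R).

Definition rc (x : R) : C := (x +i* 0)%C.
Definition im : C := (0 +i* 1)%C.
Definition cRe (z : C) : R := complex.Re z.
Definition cIm (z : C) : R := complex.Im z.

Lemma rcD x y : rc (x + y) = rc x + rc y.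
Proof. by rewrite /rc; congr Complex; rewrite /= ?addr0. Qed.
Lemma rcN x : rc (- x) = - rc x.
Proof. by rewrite /rc; congr Complex; rewrite /= ?oppr0. Qed.
Lemma rcB x y : rc (x - y) = rc x - rc y.
Proof. by rewrite rcD rcN. Qed.
Lemma rcM x y : rc (x * y) = rc x * rc y.
Proof. by rewrite /rc; congr Complex; rewrite /= ?(mulr0,mul0r,subr0,addr0). Qed.
Lemma rc0 : rc 0 = 0. Proof. by []. Qed.
Lemma rc1 : rc 1 = 1. Proof. by []. Qed.
Lemma rc_inj : injective rc. Proof. by move=> x y []. Qed.
Lemma rcX x n : rc (x ^+ n) = rc x ^+ n.
Proof. by elim: n => [|n IH]; rewrite ?expr0 ?rc1// !exprS rcM IH. Qed.
Lemma rc_nat n : rc n%:R = n%:R.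
Proof. by elim: n => // n IH; rewrite -!natr1 rcD IH. Qed.
Lemma rcV x : rc x^-1 = (rc x)^-1.
Proof.
have [->|x0] := eqVneq x 0; first by rewrite rc0 !invr0.
apply: (@mulfI _ (rc x)); first by rewrite -rc0 (inj_eq rc_inj).
by rewrite -rcM !divff// -rc0 (inj_eq rc_inj).
Qed.

Lemma cReD z w : cRe (z + w) = cRe z + cRe w.
Proof. by case: z; case: w. Qed.
Lemma cImD z w : cIm (z + w) = cIm z + cIm w.
Proof. by case: z; case: w. Qed.
Lemma cReN z : cRe (- z) = - cRe z. Proof. by case: z. Qed.
Lemma cImN z : cIm (- z) = - cIm z. Proof. by case: z. Qed.
Lemma cReB z w : cRe (z - w) = cRe z - cRe w.
Proof. by rewrite cReD cReN. Qed.
Lemma cImB z w : cIm (z - w) = cIm z - cIm w.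
Proof. by rewrite cImD cImN. Qed.
Lemma cReM z w : cRe (z * w) =
  cRe z * cRe w - cIm z * cIm w.
Proof. by case: z; case: w. Qed.
Lemma cImM z w : cIm (z * w) =
  cRe z * cIm w + cIm z * cRe w.
Proof. by case: z; case: w. Qed.
Lemma cplxE z : z = rc (cRe z) + im * rc (cIm z).
Proof.
case: z => a b; rewrite /rc /im; congr Complex => /=.
  by rewrite !mul0r mulr0 subr0 addr0.
by rewrite mul0r mul1r !add0r.
Qed.
Lemma cplx_eq z w : cRe z = cRe w -> cIm z = cIm w ->
  z = w.
Proof. by case: z; case: w => /= a b c d -> ->. Qed.

Lemma norm_cabs z : `|z| = rc (cabs z).
Proof. by rewrite /cabs normc_def. Qed.
Lemma cabs_def z : cabs z = Num.sqrt (cRe z ^+ 2 + cIm z ^+ 2).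
Proof. by rewrite /cabs normc_def. Qed.
Lemma ler_rc x y : (rc x <= rc y) = (x <= y).
Proof. exact: lecR. Qed.
Lemma ltr_rc x y : (rc x < rc y) = (x < y).
Proof. exact: ltcR. Qed.
Lemma cabs_ge0 z : 0 <= cabs z.
Proof. by rewrite cabs_def sqrtr_ge0. Qed.
Lemma cabs0 : cabs (0 : C) = 0.
Proof. by apply: rc_inj; rewrite -norm_cabs normr0. Qed.
Lemma cabs1 : cabs (1 : C) = 1.
Proof. by apply: rc_inj; rewrite -norm_cabs normr1. Qed.
Lemma cabs_eq0 z : (cabs z == 0) = (z == 0).
Proof. by rewrite -(inj_eq rc_inj) -norm_cabs normr_eq0. Qed.
Lemma cabs_gt0 z : (0 < cabs z) = (z != 0).
Proof. by rewrite lt0r cabs_ge0 andbT cabs_eq0. Qed.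
Lemma cabsM z w : cabs (z * w) = cabs z * cabs w.
Proof. by apply: rc_inj; rewrite rcM -!norm_cabs normrM. Qed.
Lemma cabsN z : cabs (- z) = cabs z.
Proof. by apply: rc_inj; rewrite -!norm_cabs normrN. Qed.
Lemma cabsV z : cabs (z^-1) = (cabs z)^-1.
Proof. by apply: rc_inj; rewrite rcV -!norm_cabs normfV. Qed.
Lemma cabsX z n : cabs (z ^+ n) = cabs z ^+ n.
Proof. by apply: rc_inj; rewrite rcX -!norm_cabs normrX. Qed.
Lemma cabsD z w : cabs (z + w) <= cabs z + cabs w.
Proof. by rewrite -ler_rc rcD -!norm_cabs ler_normD. Qed.
Lemma cabsB z w : cabs (z - w) <= cabs z + cabs w.
Proof. by rewrite (le_trans (cabsD _ _))// cabsN. Qed.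
Lemma cabsC z w : cabs (z - w) = cabs (w - z).
Proof. by rewrite -cabsN opprB. Qed.
Lemma cabs_dist z w : cabs z - cabs w <= cabs (z - w).
Proof. by rewrite lerBlDr (le_trans _ (cabsD _ _))// subrK. Qed.
Lemma cabs_rc x : cabs (rc x) = `|x|.
Proof. by rewrite cabs_def /= expr0n addr0 sqrtr_sqr. Qed.
Lemma cabs_im : cabs im = 1.
Proof. by rewrite cabs_def /= expr0n add0r expr1n sqrtr1. Qed.
Lemma cabs_nat n : cabs (n%:R : C) = n%:R.
Proof. by rewrite -rc_nat cabs_rc normr_nat. Qed.
Lemma cabs_sum (I : Type) (s : seq I) (P : pred I) (F : I -> C) :
  cabs (\sum_(i <- s | P i) F i) <= \sum_(i <- s | P i) cabs (F i).
Proof.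
elim/big_ind2: _ => [|u a v b h1 h2|//]; first by rewrite cabs0.
by rewrite (le_trans (cabsD _ _))// lerD.
Qed.
Lemma Re_le z : `|cRe z| <= cabs z.
Proof.
by rewrite cabs_def -sqrtr_sqr ler_sqrt ?lerDl ?addr_ge0// ?sqr_ge0.
Qed.
Lemma Im_le z : `|cIm z| <= cabs z.
Proof.
by rewrite cabs_def -sqrtr_sqr ler_sqrt ?lerDr ?addr_ge0// ?sqr_ge0.
Qed.
Lemma cabs_le_ReIm z : cabs z <= `|cRe z| + `|cIm z|.
Proof.
rewrite {1}[z]cplxE (le_trans (cabsD _ _))//.
by rewrite cabsM cabs_im mul1r !cabs_rc.
Qed.
Lemma cabs_small z : (forall e, 0 < e -> cabs z <= e) -> z = 0.
Proof.
move=> h; apply/eqP; rewrite -cabs_eq0 eq_le cabs_ge0 andbT.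
by apply/ler_addgt0Pl => e e0; rewrite addr0 h.
Qed.

Lemma posC z : 0 < z -> exists2 r, 0 < r & z = rc r.
Proof.
move=> z0; exists (cabs z); first by rewrite cabs_gt0 gt_eqF.
by rewrite -norm_cabs gtr0_norm.
Qed.

Lemma nbhs_cabsP z (A : set C) :
  nbhs z A <-> exists2 d, 0 < d & forall w, cabs (w - z) < d -> A w.
Proof.
split=> [/nbhs_ballP[e /= e0 eA]|[d d0 dA]].
  have [e' e'0 ee'] := posC e0; exists e' => //.
  by move=> w we; apply: eA; rewrite /ball /= ee' norm_cabs ltr_rc cabsC.
apply/nbhs_ballP; exists (rc d) => /=; first by rewrite -rc0 ltr_rc.
by move=> w; rewrite /ball/= norm_cabs ltr_rc cabsC; exact: dA.
Qed.

(** The derivative as a first-order expansion with a real error bound: unlike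
    the limit of difference quotients, it is meaningful at [h = 0] and can be
    integrated and estimated. *)
Lemma is_derive_epsP (V : normedModType C) (f : V -> C) (a v : V) (d : C) :
  is_derive a v f d <-> forall e : R, 0 < e -> exists2 del : R, 0 < del &
    forall h : C, cabs h < del ->
      cabs (f (a + h *: v) - f a - h * d) <= e * cabs h.
Proof.
split=> [[df <-]|H].
  move=> e e0; have /cvgrPdist_lt/(_ (rc e)) := df.
  rewrite -[X in X < rc e]rc0 ltr_rc => /(_ e0).
  move/nbhs_cabsP => [del del0 Hd]; exists del => // h hd.
  have [->|h0] := eqVneq h 0.
    by rewrite scale0r addr0 subrr mul0r subrr cabs0 mulr0.
  have := Hd h; rewrite subr0 => /(_ hd h0); rewrite norm_cabs ltr_rc => /ltW.
  rewrite -/('D_v f a) => H1.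
  rewrite -(ler_pM2r (_ : 0 < cabs h^-1)); last by rewrite cabs_gt0 invr_eq0.
  rewrite -cabsM -mulrA -cabsM divff// cabs1 mulr1 (le_trans _ H1)//.
  rewrite cabsC; apply: le_of_eq; congr cabs.
  by rewrite mulrBl [h * _]mulrC mulfK// [a + _]addrC mulrC.
have Hc : h^-1 *: ((f \o shift a) (h *: v) - f a) @[h --> 0^'] --> d.
  apply/cvgrPdist_le => /= eps eps0.
  have [e e0 ->] := posC eps0; have [del del0 Hd] := H _ e0.
  apply/nbhs_cabsP; exists del => // h; rewrite subr0 => hd h0.
  have := Hd h hd; rewrite norm_cabs ler_rc => H1.
  rewrite -(ler_pM2r (_ : 0 < cabs h)); last by rewrite cabs_gt0.
  rewrite -cabsM; apply: le_trans H1; rewrite cabsC; apply: le_of_eq.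
  have scE (u : C) : h^-1 *: u = h^-1 * u by [].
  by rewrite /= scE mulrBl [d * _]mulrC mulrAC mulVf// mul1r [_ + a]addrC.
by split; [exact: cvgP Hc | exact: cvg_lim].
Qed.

End ComplexModulus.

(** * Integrals along segments *)

Section LineIntegral.
Variable R : realType.
Local Notation C := (cplx R).
Local Notation im := (@im R).
Implicit Types (f g P : C -> C) (p v z w : C) (a b c d x y t : R).

Definition ccont f z := forall e : R, 0 < e -> exists2 del : R, 0 < del &
  forall w, cabs (w - z) < del -> cabs (f w - f z) <= e.

Lemma ccontP f z : {for z, continuous f} <-> ccont f z.
Proof.
split=> [H e e0|H A].
  have /H/nbhs_cabsP[del del0 Hd] : nbhs (f z) [set w | cabs (w - f z) <= e].
    by apply/nbhs_cabsP; exists e => // w /ltW.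
  by exists del => // w /Hd.
move=> /nbhs_cabsP[e e0 eA]; have [del del0 Hd] := H (e / 2) (ltac:(by rewrite divr_gt0)).
apply/nbhs_cabsP; exists del => // w /Hd we; apply: eA.
by rewrite (le_lt_trans we)// ltr_pdivrMr// ltr_pMr// ltr1n.
Qed.

Definition segcont f p v a b :=
  forall t, a <= t <= b -> {for p + rc t * v, continuous f}.

(** The factor [v] is the [dz = v dt] of the parametrization [p + t v]. *)
Definition rpart f p v t := cRe (v * f (p + rc t * v)).
Definition ipart f p v t := cIm (v * f (p + rc t * v)).

Lemma seg_cont (q : C -> R) f p v t : (forall z w, q (z - w) = q z - q w) ->
  (forall z, `|q z| <= cabs z) -> {for p + rc t * v, continuous f} ->
  {for t, continuous (fun t => q (v * f (p + rc t * v)))}.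
Proof.
move=> qB qle /ccontP fc; apply/cvgrPdist_le => /= e e0.
have [del del0 Hd] := fc (e / (1 + cabs v)) (ltac:(rewrite divr_gt0// ltr_wpDr ?cabs_ge0//)).
near=> s; rewrite -qB (le_trans (qle _))//.
rewrite -mulrBr cabsM.
have : cabs (f (p + rc s * v) - f (p + rc t * v)) <= e / (1 + cabs v).
  apply: Hd; rewrite opprD addrACA subrr add0r -mulrBl -rcB cabsM cabs_rc.
  rewrite (@le_lt_trans _ _ (`|s - t| * (1 + cabs v)))//.
    by rewrite ler_wpM2l// lerDr.
  rewrite -ltr_pdivlMr ?ltr_wpDr ?cabs_ge0//.
  rewrite distrC; near: s; exists (del / (1 + cabs v)) => //=.
  by rewrite !divr_gt0// ltr_wpDr ?cabs_ge0.
rewrite cabsC => /(ler_wpM2l (cabs_ge0 v)) /le_trans; apply.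
rewrite mulrCA ger_pMr// ler_pdivrMr ?ltr_wpDr ?cabs_ge0//.
by rewrite mul1r lerDr.
Unshelve. all: by end_near. Qed.

Lemma rpart_cont f p v t : {for p + rc t * v, continuous f} ->
  {for t, continuous (rpart f p v)}.
Proof. by apply: seg_cont; [exact: cReB|exact: Re_le]. Qed.

Lemma ipart_cont f p v t : {for p + rc t * v, continuous f} ->
  {for t, continuous (ipart f p v)}.
Proof. by apply: seg_cont; [exact: cImB|exact: Im_le]. Qed.

Lemma within_cont (q : R -> R) a b :
  (forall t, a <= t <= b -> {for t, continuous q}) ->
  {within `[a, b], continuous q}.
Proof.
move=> H; apply: continuous_in_subspaceT => x; rewrite inE/= in_itv/=; exact: H.
Qed.

Definition rint (q : R -> R) a b : R := (\int[lebesgue_measure]_(t in `[a, b]) q t)%R.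

Definition rcont (q : R -> R) a b := {within `[a, b], continuous q}.

Lemma rcont_int (q : R -> R) a b : rcont q a b ->
  (@lebesgue_measure R).-integrable `[a, b] (EFin \o q).
Proof.
by move=> qc; apply: continuous_compact_integrable => //; exact: segment_compact.
Qed.

Lemma rint_ext (q r : R -> R) a b : (forall t, a <= t <= b -> q t = r t) ->
  rint q a b = rint r a b.
Proof.
by move=> qr; apply: eq_Rintegral => t; rewrite inE/= in_itv/=; exact: qr.
Qed.

Lemma rintD (q r : R -> R) a b : rcont q a b -> rcont r a b ->
  rint (fun t => q t + r t) a b = rint q a b + rint r a b.
Proof. by move=> /rcont_int qi /rcont_int ri; apply: RintegralD. Qed.

Lemma rintZ (q : R -> R) k a b : rcont q a b ->
  rint (fun t => k * q t) a b = k * rint q a b.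
Proof. by move=> /rcont_int qi; apply: RintegralZl. Qed.

Lemma rcontZ (q : R -> R) k a b : rcont q a b -> rcont (fun t => k * q t) a b.
Proof. by move=> qi x; apply: cvgM; [exact: cvg_cst|exact: qi]. Qed.

Lemma rint_cst k a b : a <= b -> rint (cst k) a b = k * (b - a).
Proof.
move=> ab; rewrite /rint /cst/= Rintegral_cst//= lebesgue_measure_itv/= lte_fin.
have [//|ba] := ltP a b.
have -> : b = a by apply/eqP; rewrite eq_le ab ba.
by rewrite subrr.
Qed.

Lemma rcont_cst k a b : rcont (cst k) a b.
Proof. by move=> x; exact: cvg_cst. Qed.

Lemma rint_le (q r : R -> R) a b : rcont q a b -> rcont r a b ->
  (forall t, a <= t <= b -> q t <= r t) -> rint q a b <= rint r a b.
Proof.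
move=> /rcont_int qi /rcont_int ri qr; apply: le_Rintegral => //= t.
Qed.

Lemma rint_bound (q : R -> R) M a b : a <= b -> rcont q a b ->
  (forall t, a <= t <= b -> `|q t| <= M) -> `|rint q a b| <= M * (b - a).
Proof.
move=> ab qc qM; rewrite ler_norml -mulNr -!rint_cst//.
by rewrite !rint_le//; try exact: rcont_cst;
  move=> t /qM; rewrite ler_norml => /andP[].
Qed.

Lemma rint_split (q : R -> R) a b c : a <= c -> c <= b -> rcont q a b ->
  rint q a b = rint q a c + rint q c b.
Proof.
move=> ac cb /rcont_int qi; apply/eqP; rewrite addrC -subr_eq; apply/eqP.
rewrite /rint Rintegral_itvB ?bnd_simp// Rintegral_itv_obnd_cbnd//.
by apply: integrableS qi => //; apply: subset_itvr; rewrite bnd_simp.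
Qed.

Lemma rint_FTC (q Q : R -> R) a b : a <= b ->
  (forall t, a <= t <= b -> {for t, continuous q}) ->
  (forall t, a <= t <= b -> is_derive t 1 Q (q t)) ->
  rint q a b = Q b - Q a.
Proof.
rewrite le_eqVlt => /predU1P[->|ab] qc dQ.
  by rewrite /rint set_itv1 Rintegral_set1 subrr.
have QC t : a <= t <= b -> {for t, continuous Q}.
  by move=> /dQ [dt _]; apply: differentiable_continuous; exact/derivable1_diffP.
rewrite /rint /Rintegral (@continuous_FTC2 _ q Q)//.
- exact: within_cont.
- split.
  + move=> t; rewrite in_itv/= => /andP[h1 h2].
    by have [] := dQ t (ltac:(by rewrite !ltW)).
  + by apply: cvg_at_right_filter; apply: QC; rewrite lexx ltW.
  + by apply: cvg_at_left_filter; apply: QC; rewrite lexx ltW.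
- move=> t; rewrite in_itv/= => /andP[h1 h2]; rewrite derive1E.
  by have [_ ->] := dQ t (ltac:(by rewrite !ltW)).
Qed.

(** The integral of [f] along the segment [p + t v], [a <= t <= b]. *)
Definition lint p v a b f : C :=
  rc (rint (rpart f p v) a b) + im * rc (rint (ipart f p v) a b).

Lemma segcont_r f p v a b : segcont f p v a b -> rcont (rpart f p v) a b.
Proof. by move=> H; apply: within_cont => t /H /rpart_cont. Qed.
Lemma segcont_i f p v a b : segcont f p v a b -> rcont (ipart f p v) a b.
Proof. by move=> H; apply: within_cont => t /H /ipart_cont. Qed.

Lemma lint_ext f g p v a b :
  (forall t, a <= t <= b -> f (p + rc t * v) = g (p + rc t * v)) ->
  lint p v a b f = lint p v a b g.
Proof.
by move=> H; rewrite /lint; congr (rc _ + im * rc _); apply: rint_ext => t /H;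
  rewrite /rpart /ipart => ->.
Qed.

Lemma Re_mk x y : cRe (rc x + im * rc y) = x.
Proof. by rewrite cReD cReM /= !mul0r mulr0 subrr addr0. Qed.
Lemma Im_mk x y : cIm (rc x + im * rc y) = y.
Proof. by rewrite cImD cImM /= mul0r mul1r !add0r. Qed.

Lemma Re_lint f p v a b : cRe (lint p v a b f) = rint (rpart f p v) a b.
Proof. exact: Re_mk. Qed.
Lemma Im_lint f p v a b : cIm (lint p v a b f) = rint (ipart f p v) a b.
Proof. exact: Im_mk. Qed.

Lemma lintD f g p v a b : segcont f p v a b -> segcont g p v a b ->
  lint p v a b (fun z => f z + g z) = lint p v a b f + lint p v a b g.
Proof.
move=> fc gc; apply: cplx_eq; [rewrite [RHS]cReD !Re_lint|rewrite [RHS]cImD !Im_lint].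
  rewrite -rintD; [|exact: segcont_r..].
  by apply: rint_ext => t _; rewrite /rpart mulrDr cReD.
rewrite -rintD; [|exact: segcont_i..].
by apply: rint_ext => t _; rewrite /ipart mulrDr cImD.
Qed.

Lemma lintZ k f p v a b : segcont f p v a b ->
  lint p v a b (fun z => k * f z) = k * lint p v a b f.
Proof.
move=> fc; have fr := segcont_r fc; have fi := segcont_i fc.
apply: cplx_eq; [rewrite [RHS]cReM Re_lint Im_lint Re_lint|
  rewrite [RHS]cImM Re_lint Im_lint Im_lint].
  rewrite -mulNr -!rintZ// -rintD; [|exact: rcontZ..].
  by apply: rint_ext => t _; rewrite mulNr /rpart /ipart [v * (k * _)]mulrCA [LHS]cReM.
rewrite -!rintZ// -rintD; [|exact: rcontZ..].
by apply: rint_ext => t _; rewrite /rpart /ipart [v * (k * _)]mulrCA [LHS]cImM.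
Qed.

Lemma lint_split f p v a b c : a <= c -> c <= b -> segcont f p v a b ->
  lint p v a b f = lint p v a c f + lint p v c b f.
Proof.
move=> ac cb fc; apply: cplx_eq; [rewrite [RHS]cReD !Re_lint|rewrite [RHS]cImD !Im_lint].
  exact: (rint_split ac cb (segcont_r fc)).
exact: (rint_split ac cb (segcont_i fc)).
Qed.

(** The real and the imaginary part are bounded separately; the resulting
    factor 2 is harmless, since only orders of magnitude matter later. *)
Lemma lint_bound f p v a b M : a <= b -> cabs v = 1 -> segcont f p v a b ->
  (forall t, a <= t <= b -> cabs (f (p + rc t * v)) <= M) ->
  cabs (lint p v a b f) <= 2 * M * (b - a).
Proof.
move=> ab v1 fc fM; rewrite (le_trans (cabs_le_ReIm _))// Re_lint Im_lint.
rewrite -mulrA mulr_natl mulr2n lerD//; apply: rint_bound => //.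
- exact: (segcont_r fc).
- by move=> t /fM; apply: le_trans; rewrite /rpart (le_trans (Re_le _))// cabsM v1 mul1r.
- exact: (segcont_i fc).
- by move=> t /fM; apply: le_trans; rewrite /ipart (le_trans (Im_le _))// cabsM v1 mul1r.
Qed.

Lemma is_derive_real (q : R -> R) t e0 :
  (forall e, 0 < e -> exists2 del, 0 < del & forall h, `|h| < del ->
     `|q (t + h) - q t - h * e0| <= e * `|h|) -> is_derive t 1 q e0.
Proof.
move=> H.
have Hc : h^-1 *: ((q \o shift t) (h *: 1) - q t) @[h --> 0^'] --> e0.
  apply/cvgrPdist_le => /= e egt0; have [del del0 Hd] := H e egt0.
  near=> h.
  have h0 : h != 0 by near: h; exact: nbhs_dnbhs_neq.
  have hd : `|h| < del by near: h; exact: dnbhs0_lt.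
  have := Hd h hd => H1; rewrite -(ler_pM2r (_ : 0 < `|h|)) ?normr_gt0//.
  rewrite -normrM -normrN; apply: le_trans H1.
  apply: le_of_eq; congr `|_|.
  rewrite /= -[h *: 1]/(h * 1) -[_ *: _]/(_ * _) mulr1 mulrBl mulrAC mulVf//.
  by rewrite mul1r [h + t]addrC [e0 * _]mulrC opprB.
by split; [exact: cvgP Hc | exact: cvg_lim].
Unshelve. all: by end_near. Qed.

Lemma lint_FTC f P p v a b : a <= b -> segcont f p v a b ->
  (forall t, a <= t <= b -> is_derive (p + rc t * v) 1 P (f (p + rc t * v))) ->
  lint p v a b f = P (p + rc b * v) - P (p + rc a * v).
Proof.
move=> ab fc dP.
(* A real-linear [q] with [|q z| <= |z|], namely the real or the imaginary part,
   turns the complex expansion of [P] along the segment into a real one. *)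
have key (q : C -> R) (t : R) : (forall z w, q (z - w) = q z - q w) ->
    (forall z (x : R), q (rc x * z) = x * q z) ->
    (forall z, `|q z| <= cabs z) -> a <= t <= b ->
    is_derive t 1 (fun t => q (P (p + rc t * v))) (q (v * f (p + rc t * v))).
  move=> qB qZ qle /dP /is_derive_epsP H; apply: is_derive_real => e e0.
  have v0 : 0 < 1 + cabs v by rewrite ltr_wpDr ?cabs_ge0.
  have [del del0 Hd] := H (e / (1 + cabs v)) (divr_gt0 e0 v0).
  exists (del / (1 + cabs v)); first by rewrite divr_gt0.
  move=> h hd; rewrite -qZ -!qB (le_trans (qle _))//.
  have := Hd (rc h * v); rewrite cabsM cabs_rc.
  have hv : `|h| * cabs v <= `|h| * (1 + cabs v) by rewrite ler_wpM2l// lerDr.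
  rewrite (le_lt_trans hv) -?ltr_pdivlMr// => /(_ isT).
  rewrite -[_ *: 1]/(_ * 1) mulr1 rcD mulrDl addrA [rc h * (v * _)]mulrA.
  move=> /le_trans; apply; rewrite -mulrA (ler_wpM2l (ltW e0))//.
  by rewrite ler_pdivrMl// [leLHS]mulrC ler_wpM2r// lerDr.
apply: cplx_eq; [rewrite [RHS]cReB !Re_lint|rewrite [RHS]cImB !Im_lint].
  apply: (@rint_FTC _ (fun t => cRe (P (p + rc t * v)))) => // t tab.
    exact/rpart_cont/fc.
  by apply: key => //; [exact: cReB|by move=> z x; rewrite cReM/= mul0r subr0|exact: Re_le].
apply: (@rint_FTC _ (fun t => cIm (P (p + rc t * v)))) => // t tab.
  exact/ipart_cont/fc.
by apply: key => //; [exact: cImB|by move=> z x; rewrite cImM/= mul0r addr0|exact: Im_le].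
Qed.
End LineIntegral.

(** * Bisection of rectangles *)

Section Bisection.
Variable R : realType.
Implicit Types (a b c d x y : R).

Lemma nested_intervals (u v : nat -> R) :
  (forall n, u n <= u n.+1) -> (forall n, v n.+1 <= v n) ->
  (forall n, u n <= v n) -> exists x, forall n, u n <= x <= v n.
Proof.
move=> uS vS uv.
have um : {homo u : m n / (m <= n)%N >-> m <= n}.
  by apply: homo_leq => // x y z; exact: le_trans.
have vm : {homo v : m n / (m <= n)%N >-> n <= m}.
  by apply: homo_leq => // x y z /[swap]; exact: le_trans.
have ub n : ubound (range u) (v n).
  move=> _ [m _ <-]; rewrite (le_trans (um _ _ (leq_maxl m n)))//.
  by rewrite (le_trans (uv _))// vm// leq_maxr.
exists (sup (range u)) => n; apply/andP; split.
  by apply: ub_le_sup; [exists (v 0%N)|exists n].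
by apply: ge_sup => //; exists (u 0%N), 0%N.
Qed.

(** Compactness of a rectangle in the form that Goursat's lemma needs: if the
    property failed, some quarter would fail again and again, and these quarters
    would shrink to a point near which the property holds. *)
Lemma rect_bisect (P : R -> R -> R -> R -> Prop) a b c d : a <= b -> c <= d ->
  (forall a' b' c' d' (m := (a' + b') / 2) (k := (c' + d') / 2),
     a <= a' -> a' <= b' -> b' <= b -> c <= c' -> c' <= d' -> d' <= d ->
     P a' m c' k -> P m b' c' k -> P a' m k d' -> P m b' k d' ->
     P a' b' c' d') ->
  (forall x y, a <= x <= b -> c <= y <= d -> exists2 e, 0 < e &
     forall a' b' c' d', a <= a' -> b' <= b -> c <= c' -> d' <= d ->
     a' <= x <= b' -> c' <= y <= d' -> b' - a' < e -> d' - c' < e ->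
     P a' b' c' d') ->
  P a b c d.
Proof.
move=> ab cd Psplit Ploc; apply: contrapT => nP.
pose ok (q : R * R * R * R) := [/\ [/\ a <= q.1.1.1, q.1.1.1 <= q.1.1.2 & q.1.1.2 <= b],
   [/\ c <= q.1.2, q.1.2 <= q.2 & q.2 <= d] & ~ P q.1.1.1 q.1.1.2 q.1.2 q.2].
pose half (q r : {q | ok q}) := let: q := sval q in let: r := sval r in
  [/\ q.1.1.1 <= r.1.1.1, r.1.1.2 <= q.1.1.2,
     r.1.1.2 - r.1.1.1 = (q.1.1.2 - q.1.1.1) / 2 &
     [/\ q.1.2 <= r.1.2, r.2 <= q.2 & r.2 - r.1.2 = (q.2 - q.1.2) / 2]].
have step q : {r | half q r}.
  apply: cid; case: q => -[[[a' b'] c'] d'] /= okq; have [/= [h1 h2 h3] [h4 h5 h6] nPq] := okq.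
  apply: contrapT => H; apply: nPq.
  have key a1 b1 c1 d1 : a' <= a1 -> b1 <= b' -> b1 - a1 = (b' - a') / 2 ->
      c' <= c1 -> d1 <= d' -> d1 - c1 = (d' - c') / 2 -> P a1 b1 c1 d1.
    move=> k1 k2 k3 k4 k5 k6; apply: contrapT => nP1; apply: H.
    have okr : ok (a1, b1, c1, d1) by split => //=; split; lra.
    by exists (exist _ _ okr).
  by apply: Psplit => //; apply: key; lra.
have ok0 : ok (a, b, c, d) by split.
have [f [f0 fS]] := dependent_choice step (exist _ _ ok0).
pose A n := (sval (f n)).1.1.1; pose B n := (sval (f n)).1.1.2.
pose Cc n := (sval (f n)).1.2; pose D n := (sval (f n)).2.
have okn n : ok (A n, B n, Cc n, D n).
  by rewrite /A /B /Cc /D; case: (f n) => -[[[]]].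
have [x xAB] : exists x, forall n, A n <= x <= B n.
  apply: nested_intervals => n; first by have [] := fS n.
    by have [] := fS n.
  by have [[]] := okn n.
have [y yCD] : exists x, forall n, Cc n <= x <= D n.
  apply: nested_intervals => n; first by have [_ _ _ []] := fS n.
    by have [_ _ _ []] := fS n.
  by have [_ []] := okn n.
have BA n : B n - A n = (b - a) / 2 ^+ n.
  elim: n => [|n IH]; first by rewrite /A /B f0 /= expr0 divr1.
  have [_ _ h _] := fS n; rewrite [LHS]h [X in X / 2]IH exprSr invfM mulrA; lra.
have DC n : D n - Cc n = (d - c) / 2 ^+ n.
  elim: n => [|n IH]; first by rewrite /Cc /D f0 /= expr0 divr1.
  have [_ _ _ [_ _ h]] := fS n; rewrite [LHS]h [X in X / 2]IH exprSr invfM mulrA; lra.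
have := xAB 0%N; have := yCD 0%N; rewrite /A /B /Cc /D f0 /= => ycd xab.
have [e e0 He] := Ploc x y xab ycd.
have [n nlt] : exists n, (b - a + (d - c)) / 2 ^+ n < e.
  have := @cvg_expr R 2^-1; rewrite ger0_norm ?invr_ge0// => /(_ (ltac:(lra))).
  pose K := 1 + (b - a + (d - c)).
  have K0 : 0 < K by rewrite /K; lra.
  move=> /cvgrPdist_lt /(_ (e / K)) []; first by rewrite divr_gt0.
  move=> n _ /(_ n (leqnn n)); rewrite sub0r normrN ger0_norm ?exprn_ge0 ?invr_ge0//.
  rewrite ltr_pdivlMr// => h; exists n; rewrite -exprVn; apply: le_lt_trans h.
  by rewrite mulrC ler_wpM2l ?exprn_ge0 ?invr_ge0// /K lerDr.
have [/= [h1 h2 h3] [h4 h5 h6] nPn] := okn n; apply: nPn; apply: He => //.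
  rewrite BA; apply: le_lt_trans nlt; rewrite ler_wpM2r ?invr_ge0 ?exprn_ge0//; lra.
rewrite DC; apply: le_lt_trans nlt; rewrite ler_wpM2r ?invr_ge0 ?exprn_ge0//; lra.
Qed.

End Bisection.

(** * Goursat's lemma *)

Lemma sum4D (A : comNzRingType) (x1 x2 x3 x4 y1 y2 y3 y4 : A) :
  x1 + y1 + (x2 + y2) - (x3 + y3) - (x4 + y4) =
  x1 + x2 - x3 - x4 + (y1 + y2 - y3 - y4).
Proof. ring. Qed.

Lemma sum4Z (A : comNzRingType) (k x1 x2 x3 x4 : A) :
  k * x1 + k * x2 - k * x3 - k * x4 = k * (x1 + x2 - x3 - x4).
Proof. ring. Qed.

Lemma sum4v (A : comNzRingType) (x y x1 x2 x3 x4 t : A) :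
  x1 + x2 + y - (x3 + x4) - x =
  x1 + t - x3 - x + (x2 + y - x4 - t).
Proof. ring. Qed.

Lemma sum4h (A : comNzRingType) (x y x1 x2 x3 x4 t : A) :
  x + (x1 + x2) - y - (x3 + x4) =
  x + x1 - t - x3 + (t + x2 - y - x4).
Proof. ring. Qed.

Lemma mid_le (F : realFieldType) (a b : F) : a <= b ->
  a <= (a + b) / 2 /\ (a + b) / 2 <= b.
Proof. by move=> ab; split; lra. Qed.

Lemma quarter_size (F : realFieldType) (a b c d : F) (m := (a + b) / 2) (k := (c + d) / 2) :
  [/\ m - a + (k - c) = (b - a + (d - c)) / 2,
      b - m + (k - c) = (b - a + (d - c)) / 2,
      m - a + (d - k) = (b - a + (d - c)) / 2 &
      b - m + (d - k) = (b - a + (d - c)) / 2].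
Proof. by rewrite /m /k; split; lra. Qed.

Lemma half_lt (F : realFieldType) (p q e : F) : p < e / 2 -> q < e / 2 -> p + q < e.
Proof. by move=> *; lra. Qed.

Lemma dist_in_itv (F : realFieldType) (a b x y : F) :
  a <= y <= b -> a <= x <= b -> `|y - x| <= b - a.
Proof. by move=> /andP[h1 h2] /andP[h3 h4]; rewrite ler_norml; apply/andP; split; lra. Qed.

Lemma sum_le4 (F : realFieldType) (n n12 n34 n1 n2 n3 n4 q : F) :
  n1 <= q -> n2 <= q -> n3 <= q -> n4 <= q ->
  n12 <= n1 + n2 -> n34 <= n3 + n4 -> n <= n12 + n34 -> n <= 4 * q.
Proof. by move=> *; lra. Qed.

Lemma sides_le (F : realFieldType) (n n123 n12 n1 n2 n3 n4 M p q : F) :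
  n1 <= 2 * M * p -> n2 <= 2 * M * q -> n3 <= 2 * M * p -> n4 <= 2 * M * q ->
  n12 <= n1 + n2 -> n123 <= n12 + n3 -> n <= n123 + n4 -> n <= 4 * M * (p + q).
Proof.
move=> h1 h2 h3 h4 h5 h6 h7; have -> : 4 * M * (p + q) = 2 * M * p + 2 * M * q + 2 * M * p + 2 * M * q by ring.
lra.
Qed.

Section Rectangle.
Variable R : realType.
Local Notation C := (cplx R).
Local Notation im := (@im R).
Implicit Types (f g P : C -> C) (p v z w : C) (a b c d x y t : R).

(** The counterclockwise integral of [f] along the boundary of the rectangle
    [a, b] x [c, d]. *)
Definition rectint a b c d f : C :=
  lint (im * rc c) 1 a b f + lint (rc b) im c d f
  - lint (im * rc d) 1 a b f - lint (rc a) im c d f.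

Definition inrect a b c d z := a <= cRe z <= b /\ c <= cIm z <= d.

Definition onrect a b c d z := inrect a b c d z /\
  [\/ cRe z = a, cRe z = b, cIm z = c | cIm z = d].

Lemma hpt c t : (cRe (im * rc c + rc t * 1) = t) * (cIm (im * rc c + rc t * 1) = c).
Proof.
rewrite mulr1 cReD cImD cReM cImM /cRe /cIm /=.
by rewrite !mul0r !mulr0 mul1r subr0 !add0r !addr0.
Qed.

Lemma vpt c t : (cRe (rc c + rc t * im) = c) * (cIm (rc c + rc t * im) = t).
Proof.
rewrite cReD cImD cReM cImM /cRe /cIm /=.
by rewrite !mul0r !mulr0 mulr1 subr0 !add0r !addr0.
Qed.

Lemma on_h1 a b c d t : c <= d -> a <= t <= b -> onrect a b c d (im * rc c + rc t * 1).
Proof. by move=> cd tab; split; [rewrite /inrect !hpt lexx cd|apply: Or43; rewrite hpt]. Qed.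
Lemma on_h2 a b c d t : c <= d -> a <= t <= b -> onrect a b c d (im * rc d + rc t * 1).
Proof. by move=> cd tab; split; [rewrite /inrect !hpt lexx cd|apply: Or44; rewrite hpt]. Qed.
Lemma on_v1 a b c d t : a <= b -> c <= t <= d -> onrect a b c d (rc a + rc t * im).
Proof. by move=> cd tab; split; [rewrite /inrect !vpt lexx cd|apply: Or41; rewrite vpt]. Qed.
Lemma on_v2 a b c d t : a <= b -> c <= t <= d -> onrect a b c d (rc b + rc t * im).
Proof. by move=> cd tab; split; [rewrite /inrect !vpt lexx cd|apply: Or42; rewrite vpt]. Qed.

Definition oncont a b c d f := forall z, onrect a b c d z -> {for z, continuous f}.
Definition incont a b c d f := forall z, inrect a b c d z -> {for z, continuous f}.

Lemma in_oncont a b c d f : incont a b c d f -> oncont a b c d f.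
Proof. by move=> H z [/H]. Qed.

Lemma oncont_seg a b c d f : a <= b -> c <= d -> oncont a b c d f ->
  [/\ segcont f (im * rc c) 1 a b, segcont f (rc b) im c d,
      segcont f (im * rc d) 1 a b & segcont f (rc a) im c d].
Proof.
move=> ab cd H; split=> t tab; apply: H;
  [exact: on_h1|exact: on_v2|exact: on_h2|exact: on_v1].
Qed.

Lemma rectint_ext a b c d f g : a <= b -> c <= d ->
  (forall z, onrect a b c d z -> f z = g z) -> rectint a b c d f = rectint a b c d g.
Proof.
move=> ab cd H; rewrite /rectint; congr (_ + _ - _ - _); apply: lint_ext => t tab;
  apply: H; [exact: on_h1|exact: on_v2|exact: on_h2|exact: on_v1].
Qed.

Lemma rectintD a b c d f g : a <= b -> c <= d -> oncont a b c d f -> oncont a b c d g ->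
  rectint a b c d (fun z => f z + g z) = rectint a b c d f + rectint a b c d g.
Proof.
move=> ab cd /(oncont_seg ab cd)[f1 f2 f3 f4] /(oncont_seg ab cd)[g1 g2 g3 g4].
by rewrite /rectint !lintD//; exact: sum4D.
Qed.

Lemma rectintZ a b c d k f : a <= b -> c <= d -> oncont a b c d f ->
  rectint a b c d (fun z => k * f z) = k * rectint a b c d f.
Proof.
move=> ab cd /(oncont_seg ab cd)[f1 f2 f3 f4]; by rewrite /rectint !lintZ//; exact: sum4Z.
Qed.

Lemma oncontD a b c d f g : oncont a b c d f -> oncont a b c d g ->
  oncont a b c d (fun z => f z + g z).
Proof. by move=> fc gc z zr; exact: continuousD (fc z zr) (gc z zr). Qed.

Lemma oncontM a b c d f g : oncont a b c d f -> oncont a b c d g ->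
  oncont a b c d (fun z => f z * g z).
Proof. by move=> fc gc z zr; exact: continuousM (fc z zr) (gc z zr). Qed.

Lemma oncont_cst a b c d k : oncont a b c d (cst k).
Proof. by move=> z zr; exact: cst_continuous. Qed.

Lemma oncontZ a b c d k f : oncont a b c d f -> oncont a b c d (fun z => k * f z).
Proof. by apply: oncontM; exact: oncont_cst. Qed.

Lemma rectint_bound a b c d f M : a <= b -> c <= d -> oncont a b c d f ->
  (forall z, onrect a b c d z -> cabs (f z) <= M) ->
  cabs (rectint a b c d f) <= 4 * M * (b - a + (d - c)).
Proof.
move=> ab cd /(oncont_seg ab cd)[f1 f2 f3 f4] fM.
have h1 := lint_bound ab (cabs1 R) f1 (fun t tab => fM _ (on_h1 cd tab)).
have h2 := lint_bound cd (cabs_im R) f2 (fun t tab => fM _ (on_v2 ab tab)).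
have h3 := lint_bound ab (cabs1 R) f3 (fun t tab => fM _ (on_h2 cd tab)).
have h4 := lint_bound cd (cabs_im R) f4 (fun t tab => fM _ (on_v1 ab tab)).
exact: sides_le h1 h2 h3 h4 (cabsD _ _) (cabsB _ _) (cabsB _ _).
Qed.

Lemma rectint_FTC a b c d f P : a <= b -> c <= d -> oncont a b c d f ->
  (forall z, onrect a b c d z -> is_derive z 1 P (f z)) ->
  rectint a b c d f = 0.
Proof.
move=> ab cd /(oncont_seg ab cd)[f1 f2 f3 f4] dP; rewrite /rectint.
rewrite (lint_FTC ab f1 (fun t tab => dP _ (on_h1 cd tab))).
rewrite (lint_FTC cd f2 (fun t tab => dP _ (on_v2 ab tab))).
rewrite (lint_FTC ab f3 (fun t tab => dP _ (on_h2 cd tab))).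
rewrite (lint_FTC cd f4 (fun t tab => dP _ (on_v1 ab tab))).
have E x y : im * rc y + rc x * 1 = rc x + rc y * im by rewrite mulr1 addrC mulrC.
rewrite !E; ring.
Qed.

Lemma rectint_vsplit a b c d f m : a <= m -> m <= b -> c <= d ->
  oncont a b c d f ->
  rectint a b c d f = rectint a m c d f + rectint m b c d f.
Proof.
move=> am mb cd fc; have ab := le_trans am mb.
have [f1 f2 f3 f4] := oncont_seg ab cd fc.
by rewrite /rectint (lint_split am mb f1) (lint_split am mb f3); exact: sum4v.
Qed.

Lemma rectint_hsplit a b c d f m : a <= b -> c <= m -> m <= d ->
  oncont a b c d f ->
  rectint a b c d f = rectint a b c m f + rectint a b m d f.
Proof.
move=> ab am mb fc; have cd := le_trans am mb.
have [f1 f2 f3 f4] := oncont_seg ab cd fc.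
by rewrite /rectint (lint_split am mb f2) (lint_split am mb f4); exact: sum4h.
Qed.

Lemma incont_sub a b c d a' b' c' d' f : a <= a' -> b' <= b -> c <= c' -> d' <= d ->
  incont a b c d f -> incont a' b' c' d' f.
Proof.
move=> h1 h2 h3 h4 H z [/andP[k1 k2] /andP[k3 k4]]; apply: H; split; apply/andP; split;
  by [exact: le_trans k1|exact: le_trans h2|exact: le_trans k3|exact: le_trans h4].
Qed.

Lemma derivable_cont f z : derivable f z 1 -> {for z, continuous f}.
Proof. by move=> /derivable1_diffP; exact: differentiable_continuous. Qed.

Lemma affine_cont (k l z0 z : C) : {for z, continuous (fun z => k + l * (z - z0))}.
Proof.
apply/ccontP => e e0; have l0 : 0 < 1 + cabs l by rewrite ltr_wpDr ?cabs_ge0.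
exists (e / (1 + cabs l)); first by rewrite divr_gt0.
move=> w; rewrite ltr_pdivlMr// => /ltW; apply: le_trans.
rewrite (_ : _ - _ = (w - z) * l); last by ring.
by rewrite cabsM ler_wpM2l ?cabs_ge0// lerDr.
Qed.

(** An affine function has a quadratic primitive. *)
Lemma rectint_affine a b c d (k l z0 : C) : a <= b -> c <= d ->
  rectint a b c d (fun z => k + l * (z - z0)) = 0.
Proof.
move=> ab cd; apply: (@rectint_FTC _ _ _ _ _ (fun z => k * z + l * ((z - z0) ^+ 2 / 2)) ab cd).
  by move=> z _; exact: affine_cont.
move=> z _; apply/is_derive_epsP => e e0.
have l0 : 0 < 1 + cabs l by rewrite ltr_wpDr ?cabs_ge0.
exists (e / (1 + cabs l)); first by rewrite divr_gt0.
move=> h; rewrite ltr_pdivlMr// => /ltW he.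
rewrite -[h *: 1]/(h * 1) (_ : _ - _ = (h * (l / 2)) * h); last by field.
rewrite cabsM ler_wpM2r ?cabs_ge0//; apply: le_trans he.
rewrite cabsM ler_wpM2l ?cabs_ge0// cabsM cabsV cabs_nat.
by have := cabs_ge0 l; lra.
Qed.

(** Goursat's lemma: the error of the first-order expansion at a point of a
    small subrectangle has an integral of second order in the size of that
    subrectangle, while the affine part has integral zero. *)
Lemma goursat a b c d f : a <= b -> c <= d ->
  (forall z, inrect a b c d z -> derivable f z 1) -> rectint a b c d f = 0.
Proof.
move=> ab cd df.
have fc : incont a b c d f by move=> z /df /derivable_cont.
apply: cabs_small => e' e'0.
pose s := b - a + (d - c) + 1.
have s0 : 0 < s by rewrite /s; lra.
pose e := e' / s ^+ 2.
have e0 : 0 < e by rewrite divr_gt0// exprn_gt0.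
(* A bound of second order in the size is inherited from the four quarters,
   because each of them has half the size. *)
suff : cabs (rectint a b c d f) <= e * (b - a + (d - c)) ^+ 2.
  move=> /le_trans; apply; rewrite /e mulrAC ler_pdivrMr ?exprn_gt0//.
  by rewrite ler_pM2l// lerXn2r ?nnegrE /s//; lra.
apply: (@rect_bisect R (fun a b c d => cabs (rectint a b c d f) <= e * (b - a + (d - c)) ^+ 2)) => //.
  move=> a' b' c' d' m k h1 h2 h3 h4 h5 h6 P1 P2 P3 P4.
  have fc' := incont_sub h1 h3 h4 h6 fc.
  have [m1 m2] : a' <= m /\ m <= b' by exact: mid_le.
  have [k1 k2] : c' <= k /\ k <= d' by exact: mid_le.
  rewrite (rectint_hsplit h2 k1 k2 (in_oncont fc')).
  rewrite (rectint_vsplit m1 m2 k1 (in_oncont (incont_sub _ _ _ k2 fc')))//.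
  rewrite (rectint_vsplit m1 m2 k2 (in_oncont (incont_sub _ _ k1 _ fc')))//.
  have [q1 q2 q3 q4] := quarter_size a' b' c' d'.
  have qE : e * (b' - a' + (d' - c')) ^+ 2 = 4 * (e * ((b' - a' + (d' - c')) / 2) ^+ 2).
    by rewrite expr_div_n; field.
  rewrite qE; move: P1 P2 P3 P4; rewrite q1 q2 q3 q4 => P1 P2 P3 P4.
  exact: sum_le4 P1 P2 P3 P4 (cabsD _ _) (cabsD _ _) (cabsD _ _).
move=> x y xab ycd; pose z := rc x + im * rc y.
have zin : inrect a b c d z by rewrite /inrect Re_mk Im_mk.
have [l /is_derive_epsP Hl] : exists l, is_derive z 1 f l.
  by exists ('D_1 f z); apply: derivableP; exact: df.
have [del del0 Hd] := Hl (e / 4) (divr_gt0 e0 (ltr0n _ 4)).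
exists (del / 2) => [|a' b' c' d' h1 h2 h3 h4 x12 y12 ba dc].
  by rewrite divr_gt0.
have /andP[x1 x2] := x12; have /andP[y1 y2] := y12.
have ab' := le_trans x1 x2; have cd' := le_trans y1 y2.
have fc' := in_oncont (incont_sub h1 h2 h3 h4 fc).
have gc : oncont a' b' c' d' (fun w => - f z + (- l) * (w - z)).
  by move=> w _; exact: affine_cont.
have <- : rectint a' b' c' d' (fun w => f w + (- f z + (- l) * (w - z))) =
  rectint a' b' c' d' f by rewrite rectintD// rectint_affine// addr0.
have bnd w : onrect a' b' c' d' w ->
    cabs (f w + (- f z + (- l) * (w - z))) <= e / 4 * (b' - a' + (d' - c')).
  move=> [[w12 w34] _].
  have wz : cabs (w - z) <= b' - a' + (d' - c').
    rewrite (le_trans (cabs_le_ReIm _))// cReB cImB Re_mk Im_mk.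
    by apply: lerD; apply: dist_in_itv.
  have := Hd (w - z) (le_lt_trans wz (half_lt ba dc)).
  rewrite -[_ *: 1]/(_ * 1) mulr1 subrKC => H.
  rewrite (_ : _ + _ = f w - f z - (w - z) * l); last by ring.
  by rewrite (le_trans H)// ler_wpM2l// divr_ge0// ltW.
have := rectint_bound ab' cd' (oncontD fc' gc) bnd.
rewrite (_ : 4 * _ * _ = e * (b' - a' + (d' - c')) ^+ 2); first by [].
by rewrite expr2; field.
Qed.

End Rectangle.

(** * Integrals along squares *)

Section Squares.
Variable R : realType.
Local Notation C := (cplx R).
Local Notation im := (@im R).
Implicit Types (f g P : C -> C) (p v z w : C) (a b c d x y t : R).

Definition sqint t f : C := rectint (- t) t (- t) t f.
Definition onsq t z := onrect (- t) t (- t) t z.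
Definition sqcont t f := oncont (- t) t (- t) t f.

Lemma sq_le t : 0 <= t -> - t <= t.
Proof. by move=> t0; rewrite (@le_trans _ _ 0)// oppr_le0. Qed.

Lemma insq_le t z : inrect (- t) t (- t) t z -> cabs z <= 2 * t.
Proof.
move=> [rz iz]; rewrite (le_trans (cabs_le_ReIm _))// mulr_natl mulr2n.
by rewrite lerD// ler_norml.
Qed.

Lemma onsq_ge t z : onsq t z -> t <= cabs z.
Proof.
have h1 x : x <= `|x| := ler_norm x.
have h2 x : - x <= `|x| by rewrite -normrN ler_norm.
move=> [_ [] E].
- by rewrite -[t]opprK -E (le_trans (h2 _))// Re_le.
- by rewrite -E (le_trans (h1 _))// Re_le.
- by rewrite -[t]opprK -E (le_trans (h2 _))// Im_le.
- by rewrite -E (le_trans (h1 _))// Im_le.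
Qed.

Lemma onsq_neq0 t z : 0 < t -> onsq t z -> z != 0.
Proof. by move=> t0 /onsq_ge tz; rewrite -cabs_gt0 (lt_le_trans t0). Qed.

Lemma onsq_neq t z w : onsq t z -> cabs w < t -> z - w != 0.
Proof.
move=> /onsq_ge tz wt; rewrite subr_eq0; apply/eqP => E.
by rewrite E leNgt wt in tz.
Qed.

Lemma onsq_in t z : onsq t z -> cabs z <= 2 * t.
Proof. by move=> [] /insq_le. Qed.

Lemma cont_ext f g z : f =1 g -> {for z, continuous f} -> {for z, continuous g}.
Proof. by move=> /funext ->. Qed.

Lemma derive_ext f g z l : f =1 g -> is_derive z 1 f l -> is_derive z 1 g l.
Proof. by move=> /funext ->. Qed.

Lemma cont_inv z w : z - w != 0 -> {for z, continuous (fun u => (u - w)^-1)}.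
Proof.
move=> zw; apply: (@continuousV C C (fun u => u - w)) => //.
apply: (cont_ext _ (@affine_cont R 0 1 w z)) => u.
by rewrite mul1r add0r.
Qed.

Lemma cont_inv0 z : z != 0 -> {for z, continuous (fun u : C => u^-1)}.
Proof.
move=> z0; apply: (cont_ext _ (@cont_inv z 0 _)); last by rewrite subr0.
by move=> u; rewrite subr0.
Qed.

Lemma cont_invX z n : z != 0 -> {for z, continuous (fun u : C => u ^- n)}.
Proof.
move=> z0; elim: n => [|n IH].
  apply: (@cont_ext (cst 1)); last exact: cst_continuous.
  by move=> u; rewrite expr0 invr1.
apply: cont_ext (continuousM (cont_inv0 z0) IH) => u.
by rewrite exprS invfM.
Qed.

Lemma derive_inv z : z != 0 -> is_derive z 1 (fun u : C => u^-1) (- z ^- 2).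
Proof.
move=> z0; have h := @derivable_id C C z 1.
split; first exact: (@derivableV C C id z 1 z0 h).
rewrite (@deriveV C C id z 1 z0 h) derive_id -[_ *: _]/(_ * _) mulr1.
by [].
Qed.

Lemma derive_mul f g z l m : is_derive z 1 f l -> is_derive z 1 g m ->
  is_derive z 1 (fun u => f u * g u) (f z * m + l * g z).
Proof.
move=> df dg; have [d1 d2] := is_deriveM df dg.
by split => //; rewrite [LHS]d2 -![_ *: _]/(_ * _) [g z * _]mulrC.
Qed.

Lemma derive_invX z n : z != 0 ->
  is_derive z 1 (fun u : C => u ^- n) (- n%:R * z ^- n.+1).
Proof.
move=> z0; elim: n => [|n IH].
  have h : is_derive z 1 (cst 1 : C -> C) 0.
    by split; [exact: derivable_cst|exact: derive_cst].
  rewrite mulr0n oppr0 mul0r; apply: derive_ext h => u.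
  by rewrite expr0 invr1.
apply: (@derive_ext (fun u => u^-1 * u ^- n)).
  by move=> u; rewrite exprS invfM.
have [d1 d2] := derive_mul (derive_inv z0) IH; split=> //; rewrite d2.
have zn : z ^+ n != 0 by rewrite expf_neq0.
by rewrite !exprS -natr1; field; rewrite z0 zn.
Qed.

Lemma derive_cont f z l : is_derive z 1 f l -> {for z, continuous f}.
Proof. by move=> [d _]; exact: derivable_cont. Qed.

End Squares.

(** * Squares around a singularity *)

Lemma inv_kernel_ge (F : realFieldType) (x t : F) : 0 < t -> - t <= x <= t ->
  1 / (2 * t) <= t / (x ^+ 2 + t ^+ 2).
Proof.
move=> t0 xt; have xt2 : x ^+ 2 <= t ^+ 2.
  by rewrite -real_normK ?num_real// lerXn2r ?nnegrE// ?ler_norml// ltW.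
have d0 : 0 < x ^+ 2 + t ^+ 2 by rewrite ltr_wpDl ?sqr_ge0// exprn_gt0.
rewrite ler_pdivlMr// mulrAC ler_pdivrMr ?mulr_gt0// mul1r.
by rewrite mulrCA mulr_natl mulr2n -expr2 lerD2r.
Qed.

Lemma between (F : realFieldType) (x e t c : F) : `|x| <= c -> e < t - c ->
  - t <= x - e /\ x + e <= t.
Proof. by rewrite ler_norml => /andP[h1 h2] h3; split; lra. Qed.

Lemma pm_le (F : realFieldType) (x e : F) : 0 < e -> x - e <= x + e.
Proof. by move=> e0; lra. Qed.

Lemma size4 (F : realFieldType) (x y e B : F) :
  4 * B * (x + e - (x - e) + (y + e - (y - e))) = 16 * B * e.
Proof. ring. Qed.

Lemma not_between (F : realFieldType) (x e : F) : 0 < e ->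
  (x <= x - e -> False) /\ (x + e <= x -> False).
Proof. by move=> e0; split=> h; lra. Qed.
Section PuncturedSquare.
Variable R : realType.
Local Notation C := (cplx R).
Local Notation im := (@im R).
Implicit Types (f g P : C -> C) (p v z w : C) (a b c d x y t : R).

Lemma cReV z : cRe z^-1 = cRe z / (cRe z ^+ 2 + cIm z ^+ 2).
Proof. by case: z. Qed.
Lemma cImV z : cIm z^-1 = - (cIm z / (cRe z ^+ 2 + cIm z ^+ 2)).
Proof. by case: z => x y. Qed.

Lemma im_mulI z : cIm (im * z) = cRe z.
Proof. by rewrite cImM /cRe /cIm /= mul0r mul1r add0r. Qed.

Lemma rint_ge1 (q : R -> R) t : 0 < t -> rcont q (- t) t ->
  (forall x, - t <= x <= t -> 1 / (2 * t) <= q x) -> 1 <= rint q (- t) t.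
Proof.
move=> t0 qc qt; have tt := sq_le (ltW t0).
rewrite (le_trans _ (rint_le (@rcont_cst _ (1 / (2 * t)) _ _) qc _))//.
rewrite rint_cst// opprK (_ : t + t = 2 * t); last by ring.
by rewrite divfK// mulf_neq0// gt_eqF.
Qed.

Lemma rint_leN1 (q : R -> R) t : 0 < t -> rcont q (- t) t ->
  (forall x, - t <= x <= t -> 1 / (2 * t) <= - q x) -> rint q (- t) t <= - 1.
Proof.
move=> t0 qc qt; rewrite -lerN2 opprK -mulN1r -rintZ//.
apply: rint_ge1 => //; first exact: rcontZ.
by move=> x /qt; rewrite mulN1r.
Qed.

(** On each of the four sides the imaginary part of [dz / z] is the kernel
    [t / (x^2 + t^2) dx], up to a sign that the orientation cancels.  The kernel
    is at least [1 / (2 t)] there, so each side contributes at least 1.  A nonzero lower bound is enough to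
    normalize by this integral. *)
Lemma sqint_inv_Im t : 0 < t -> 4 <= cIm (sqint t (fun z => z^-1)).
Proof.
move=> t0; have tt := sq_le (ltW t0).
have [f1 f2 f3 f4] := oncont_seg tt tt (fun z zt => cont_inv0 (onsq_neq0 t0 zt)).
rewrite /sqint /rectint cImB cImB cImD !Im_lint.
set i1 := rint _ _ _; set i2 := rint _ _ _; set i3 := rint _ _ _; set i4 := rint _ _ _.
suff [h1 h2 h3 h4] : [/\ 1 <= i1, 1 <= i2, i3 <= -1 & i4 <= -1] by clearbody i1 i2 i3 i4; lra.
split.
- apply: rint_ge1 => //; first exact: segcont_i f1.
  move=> x xt; rewrite /ipart; cbv beta; rewrite [X in cIm X]mul1r cImV !hpt mulNr opprK sqrrN.
  exact: inv_kernel_ge.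
- apply: rint_ge1 => //; first exact: segcont_i f2.
  move=> x xt; rewrite /ipart; cbv beta; rewrite im_mulI cReV !vpt.
  rewrite [t ^+ 2 + _]addrC; exact: inv_kernel_ge.
- apply: rint_leN1 => //; first exact: segcont_i f3.
  move=> x xt; rewrite /ipart; cbv beta; rewrite [X in cIm X]mul1r cImV !hpt opprK.
  exact: inv_kernel_ge.
- apply: rint_leN1 => //; first exact: segcont_i f4.
  move=> x xt; rewrite /ipart; cbv beta; rewrite im_mulI cReV !vpt sqrrN mulNr opprK.
  rewrite [t ^+ 2 + _]addrC; exact: inv_kernel_ge.
Qed.

Definition sqK t : C := sqint t (fun z => z^-1).

Lemma sqK_ge t : 0 < t -> 4 <= cabs (sqK t).
Proof.
by move=> t0; rewrite (le_trans (sqint_inv_Im t0))// (le_trans (ler_norm _))// Im_le.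
Qed.

(** A point near which [q] is merely bounded does not contribute: four cuts
    isolate it in a square on which the integral is as small as desired, and the
    remaining rectangles are covered by Goursat's lemma. *)
Lemma sqint_punctured t q z0 (B eta : R) : 0 < t -> cabs z0 < t -> 0 < eta ->
  (forall w, cabs w <= 2 * t -> w != z0 -> derivable q w 1) ->
  (forall w, cabs (w - z0) < eta -> w != z0 -> cabs (q w) <= B) ->
  sqint t q = 0.
Proof.
move=> t0 z0t eta0 dq qB; have tt := sq_le (ltW t0).
have reg a b c d : - t <= a -> b <= t -> - t <= c -> d <= t -> a <= b -> c <= d ->
    ~ inrect a b c d z0 -> rectint a b c d q = 0.
  move=> h1 h2 h3 h4 h5 h6 nz0; apply: goursat => // w wr; apply: dq.
    apply: insq_le; case: wr => /andP[k1 k2] /andP[k3 k4]; split; apply/andP; split;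
    by [exact: le_trans k1|exact: le_trans h2|exact: le_trans k3|exact: le_trans h4].
  by apply/eqP => E; rewrite E in wr.
have regc a b c d : - t <= a -> b <= t -> - t <= c -> d <= t -> a <= b -> c <= d ->
    ~ onrect a b c d z0 -> oncont a b c d q.
  move=> h1 h2 h3 h4 h5 h6 nz0 w won; apply: derivable_cont; apply: dq.
    apply: insq_le; case: won => -[/andP[k1 k2] /andP[k3 k4]] _; split; apply/andP; split;
    by [exact: le_trans k1|exact: le_trans h2|exact: le_trans k3|exact: le_trans h4].
  by apply/eqP => E; rewrite E in won.
apply: cabs_small => e e0.
have B0 : 0 < 16 * (1 + `|B|) by rewrite mulr_gt0// ltr_wpDr.
have mk0 : 0 < Num.min (eta / 2) (Num.min (t - cabs z0) (e / (16 * (1 + `|B|)))).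
  by rewrite !lt_min subr_gt0 z0t !divr_gt0.
pose h := Num.min (eta / 2) (Num.min (t - cabs z0) (e / (16 * (1 + `|B|)))) / 2.
have h0 : 0 < h by rewrite divr_gt0.
have : h < Num.min (eta / 2) (Num.min (t - cabs z0) (e / (16 * (1 + `|B|)))).
  by rewrite /h ltr_pdivrMr// ltr_pMr// ltr1n.
rewrite !lt_min => /and3P[h1 h2]; rewrite ltr_pdivlMr// => h3.
clearbody h; clear mk0.
have [x1 x2] := between (Re_le z0) h2; have [y1 y2] := between (Im_le z0) h2.
set x := cRe z0 in x1 x2; set y := cIm z0 in y1 y2.
have xx := pm_le x h0; have yy := pm_le y h0.
have [nx1 nx2] := not_between x h0; have [ny1 ny2] := not_between y h0.
have x1' := le_trans xx x2; have x2' := le_trans x1 xx.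
have y1' := le_trans yy y2; have y2' := le_trans y1 yy.
have nsq : ~ onrect (- t) t (- t) t z0.
  by move=> /onsq_ge; rewrite leNgt z0t.
have eqx1 : x = x - h -> False by move=> E; apply: nx1; rewrite -E.
have eqx2 : x = x + h -> False by move=> E; apply: nx2; rewrite -E.
have eqy1 : y = y - h -> False by move=> E; apply: ny1; rewrite -E.
have eqy2 : y = y + h -> False by move=> E; apply: ny2; rewrite -E.
have xl : x = - t -> False by move=> E; apply: nx1; rewrite [leLHS]E.
have xr : x = t -> False by move=> E; apply: nx2; rewrite [leRHS]E.
have yl : y = - t -> False by move=> E; apply: ny1; rewrite [leLHS]E.
have yr : y = t -> False by move=> E; apply: ny2; rewrite [leRHS]E.
have hm : x - h <= t by apply: le_trans xx x2.
have hk : y - h <= t by apply: le_trans yy y2.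
have n1 : ~ inrect (- t) (x - h) (- t) t z0 by move=> [/andP[_ /nx1]].
have n2 : ~ inrect (x + h) t (- t) t z0 by move=> [/andP[/nx2]].
have n3 : ~ inrect (x - h) (x + h) (- t) (y - h) z0 by move=> [_ /andP[_ /ny1]].
have n4 : ~ inrect (x - h) (x + h) (y + h) t z0 by move=> [_ /andP[/ny2]].
have m1 : ~ onrect (x - h) t (- t) t z0 by move=> [_ [/eqx1|/xr|/yl|/yr]].
have m2 : ~ onrect (x - h) (x + h) (- t) t z0 by move=> [_ [/eqx1|/eqx2|/yl|/yr]].
have m3 : ~ onrect (x - h) (x + h) (y - h) t z0 by move=> [_ [/eqx1|/eqx2|/eqy1|/yr]].
have m4 : ~ onrect (x - h) (x + h) (y - h) (y + h) z0.
  by move=> [_ [/eqx1|/eqx2|/eqy1|/eqy2]].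
rewrite /sqint (rectint_vsplit x1 hm tt (regc _ _ _ _ _ _ _ _ _ _ nsq))//.
rewrite (reg _ _ _ _ _ _ _ _ _ _ n1)// add0r.
rewrite (rectint_vsplit xx x2 tt (regc _ _ _ _ _ _ _ _ _ _ m1))//.
rewrite (reg _ _ _ _ _ _ _ _ _ _ n2)// addr0.
rewrite (rectint_hsplit xx y1 hk (regc _ _ _ _ _ _ _ _ _ _ m2))//.
rewrite (reg _ _ _ _ _ _ _ _ _ _ n3)// add0r.
rewrite (rectint_hsplit xx yy y2 (regc _ _ _ _ _ _ _ _ _ _ m3))//.
rewrite (reg _ _ _ _ _ _ _ _ _ _ n4)// addr0.
have bnd w : onrect (x - h) (x + h) (y - h) (y + h) w -> cabs (q w) <= 1 + `|B|.
  move=> [[w1 w2] won]; apply: le_trans (_ : B <= _); last first.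
    by rewrite (le_trans (ler_norm _))// lerDr.
  apply: qB; last by apply/eqP => E; apply: m4; rewrite -E.
  rewrite (le_lt_trans (cabs_le_ReIm _))// cReB cImB -/x -/y.
  have k1 : `|cRe w - x| <= h by rewrite ler_distl.
  have k2 : `|cIm w - y| <= h by rewrite ler_distl.
  by rewrite (le_lt_trans (lerD k1 k2))// half_lt.
have := rectint_bound xx yy (regc _ _ _ _ x1 x2 y1 y2 xx yy m4) bnd.
by rewrite size4 => /le_trans; apply; rewrite mulrC ltW.
Qed.

End PuncturedSquare.

(** * Cauchy's formula and Taylor coefficients *)

Lemma kernel_step (F : fieldType) (f w z wn : F) : w != 0 -> w - z != 0 -> wn != 0 ->
  f * wn^-1 * (w - z)^-1 =
  f * (w * wn)^-1 + z * (f * (w * wn)^-1 * (w - z)^-1).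
Proof. by move=> w0 wz wn0; field; rewrite w0 wz wn0. Qed.

Lemma bound_arith (F : realFieldType) (M tN t : F) : t != 0 -> tN != 0 ->
  4 * (M * tN^-1 * (t / 2)^-1) * (t - - t + (t - - t)) = 32 * M / tN.
Proof. by move=> h1 h2; field; rewrite h1 h2. Qed.

Lemma bound_arith2 (F : realFieldType) (M tN t : F) : t != 0 -> tN != 0 ->
  4 * (M * (t * tN)^-1) * (t - - t + (t - - t)) = 4 * (4 * M / tN).
Proof. by move=> h1 h2; field; rewrite h1 h2. Qed.

Lemma factor_out (A : comNzRingType) (f K zN G E : A) :
  f * K - (f * (K + zN * G) - zN * E) = zN * (E - f * G).
Proof. ring. Qed.
Opaque rectint.

Section CauchyExpansion.
Variable R : realType.
Local Notation C := (cplx R).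
Implicit Types (f g P : C -> C) (z w : C) (t M : R).

(** Cauchy's formula: the difference quotient [(f w - f z) / (w - z)] is bounded
    near its only singularity [z], so its integral vanishes. *)
Lemma sqint_cauchy t f z : 0 < t -> cabs z < t ->
  (forall w, cabs w <= 2 * t -> derivable f w 1) ->
  sqint t (fun w => f w * (w - z)^-1) = f z * sqint t (fun w => (w - z)^-1).
Proof.
move=> t0 zt df; have tt := sq_le (ltW t0).
pose q w := (f w - f z) * (w - z)^-1.
have kc : sqcont t (fun w => (w - z)^-1).
  by move=> w wt; apply: cont_inv; exact: onsq_neq zt.
have fc : sqcont t f.
  by move=> w wt; apply: derivable_cont; apply: df; exact: onsq_in.
have qc : sqcont t q.
  apply: oncontM kc => w wt.
  by apply: continuousB (fc w wt) _; exact: cst_continuous.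
have q0 : sqint t q = 0.
  have [d dd] : exists d, is_derive z 1 f d.
    exists ('D_1 f z); apply: derivableP; apply: df.
    by rewrite mulr_natl mulr2n (le_trans (ltW zt))// lerDl ltW.
  have [eta eta0 He] := (is_derive_epsP _ _ _ _).1 dd 1 ltr01.
  apply: (@sqint_punctured _ t q z (1 + cabs d) eta) => //.
    move=> w wt wz; apply: derivableM.
      by apply: (derivableB (df w wt)); exact: derivable_cst.
    apply: derivableV; first by rewrite subr_eq0.
    by apply: derivableB; [exact: derivable_id|exact: derivable_cst].
  move=> w wz wnz; have := He (w - z) wz.
  rewrite -[_ *: 1]/(_ * 1) mulr1 subrKC mul1r => H.
  rewrite /q cabsM cabsV ler_pdivrMr; last by rewrite cabs_gt0 subr_eq0.
  rewrite -[f w - f z](subrK ((w - z) * d)) (le_trans (cabsD _ _))//.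
  by rewrite [leRHS]mulrDl mul1r lerD// cabsM mulrC.
transitivity (sqint t (fun w => q w + f z * (w - z)^-1)).
  by apply: (rectint_ext tt tt) => w _; rewrite /q mulrBl subrK.
transitivity (sqint t q + sqint t (fun w => f z * (w - z)^-1)).
  exact: (rectintD tt tt qc (oncontZ kc)).
by rewrite [X in X + _]q0 add0r; exact: (rectintZ (f z) tt tt kc).
Qed.

Section Expand.
Variables (t : R) (f : C -> C).
Hypotheses (t0 : 0 < t) (fc : sqcont t f).

Lemma monomial_cont n : sqcont t (fun w => f w * w ^- n).
Proof.
apply: (oncontM fc) => w wt; apply: cont_invX; exact: onsq_neq0 wt.
Qed.

Lemma kernel_cont n z : cabs z < t -> sqcont t (fun w => f w * w ^- n * (w - z)^-1).
Proof.
move=> zt; have kc : sqcont t (fun w => (w - z)^-1).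
  by move=> w wt; apply: cont_inv; exact: onsq_neq zt.
exact: (oncontM (@monomial_cont n) kc).
Qed.

(** The geometric expansion of [(w - z)^-1] in powers of [z / w], with its exact
    remainder. *)
Lemma kernel_expand z n : cabs z < t ->
  sqint t (fun w => f w * (w - z)^-1) =
  \sum_(i < n) z ^+ i * sqint t (fun w => f w * w ^- i.+1)
  + z ^+ n * sqint t (fun w => f w * w ^- n * (w - z)^-1).
Proof.
move=> zt; have tt := sq_le (ltW t0); elim: n => [|n ->].
  rewrite big_ord0 add0r expr0 mul1r; apply: (rectint_ext tt tt) => w _.
  by rewrite expr0 invr1 mulr1.
rewrite big_ord_recr /= -addrA; congr (_ + _); rewrite exprSr -mulrA -mulrDr.
congr (_ * _); have kc := @kernel_cont n.+1 _ zt; have mc := @monomial_cont n.+1.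
have <- : sqint t (fun w => z * (f w * w ^- n.+1 * (w - z)^-1)) =
  z * sqint t (fun w => f w * w ^- n.+1 * (w - z)^-1) by exact: (rectintZ z tt tt kc).
transitivity (sqint t (fun w => f w * w ^- n.+1 +
    z * (f w * w ^- n.+1 * (w - z)^-1))); last exact: (rectintD tt tt mc (oncontZ kc)).
apply: (rectint_ext tt tt) => w wt.
have w0 := onsq_neq0 t0 wt.
by rewrite exprS; apply: kernel_step => //; rewrite ?expf_neq0//; exact: onsq_neq zt.
Qed.

(** The square has length [8 t] and distance at least [t / 2] from [z]. *)
Lemma kernel_bound z n M : cabs z <= t / 2 ->
  (forall w, onsq t w -> cabs (f w) <= M) ->
  cabs (sqint t (fun w => f w * w ^- n * (w - z)^-1)) <= 32 * M / t ^+ n.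
Proof.
move=> zt fM; have tt := sq_le (ltW t0).
have zt' : cabs z < t by rewrite (le_lt_trans zt)// ltr_pdivrMr// ltr_pMr// ltr1n.
have tn0 : t != 0 by rewrite gt_eqF.
have := @rectint_bound _ _ _ _ _ _ (M * (t ^+ n)^-1 * (t / 2)^-1) tt tt (@kernel_cont n _ zt').
rewrite (bound_arith M tn0 (expf_neq0 n tn0)); apply=> w wt.
have wz := onsq_ge wt.
have M0 : 0 <= M by rewrite (le_trans (cabs_ge0 _) (fM w wt)).
rewrite !cabsM !cabsV cabsX ler_pM// ?mulr_ge0 ?invr_ge0 ?exprn_ge0 ?cabs_ge0//.
  rewrite ler_pM// ?invr_ge0 ?exprn_ge0 ?cabs_ge0 ?fM//.
  by rewrite lef_pV2 ?posrE ?exprn_gt0 ?(lt_le_trans t0)// lerXn2r ?nnegrE ?(ltW t0)// ?cabs_ge0.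
rewrite lef_pV2 ?posrE ?divr_gt0//; last first.
  by rewrite cabs_gt0; exact: onsq_neq zt'.
rewrite (le_trans _ (cabs_dist _ _))// (le_trans _ (lerB wz zt))//.
by rewrite lerBrDr -splitr.
Qed.

End Expand.

Lemma sqint_invXX t n : 0 < t -> sqint t (fun w => w ^- n.+2) = 0.
Proof.
move=> t0; have tt := sq_le (ltW t0).
pose k : C := - (n.+1)%:R^-1.
apply: (@rectint_FTC _ _ _ _ _ _ (fun w => k * w ^- n.+1) tt tt).
  by move=> w wt; apply: cont_invX; exact: onsq_neq0 wt.
move=> w wt; have w0 := onsq_neq0 t0 wt.
have h : is_derive w 1 (cst k : C -> C) 0 by split; [exact: derivable_cst|exact: derive_cst].
have [d1 d2] := derive_mul h (derive_invX n.+1 w0); split=> //.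
rewrite d2 mul0r addr0 mulrA /k mulrNN mulVf ?mul1r//.
Qed.

(** The Taylor coefficients of [f] at 0, by Cauchy's formula with the integral of
    [z^-1] in place of its value [2 pi i]. *)
Definition ccoef t f n : C := sqint t (fun w => f w * w ^- n.+1) / sqK t.

Lemma sqK_neq0 t : 0 < t -> sqK t != 0.
Proof. by move=> t0; rewrite -cabs_gt0 (lt_le_trans _ (sqK_ge t0)). Qed.

Lemma ccoef_bound t f n M : 0 < t -> sqcont t f ->
  (forall w, onsq t w -> cabs (f w) <= M) ->
  cabs (ccoef t f n) <= 4 * M / t ^+ n.
Proof.
move=> t0 fc fM; have tt := sq_le (ltW t0).
rewrite /ccoef cabsM cabsV ler_pdivrMr; last by rewrite cabs_gt0 sqK_neq0.
have tn0 : t != 0 by rewrite gt_eqF.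
have := @rectint_bound _ _ _ _ _ _ (M * (t * t ^+ n)^-1) tt tt (monomial_cont t0 fc (n:=n.+1)).
rewrite (bound_arith2 M tn0 (expf_neq0 n tn0)) => H.
have M0 : 0 <= M.
  have h : onsq t (rc (- t) + rc (- t) * im R).
    by apply: on_v1 => //; rewrite lexx tt.
  by rewrite (le_trans (cabs_ge0 _) (fM _ h)).
apply: le_trans (H _) _ => [w wt|]; last first.
  rewrite mulrC ler_wpM2l ?sqK_ge// !mulr_ge0// invr_ge0 exprn_ge0// ltW//.
rewrite cabsM cabsV cabsX -exprS ler_pM// ?invr_ge0 ?exprn_ge0 ?cabs_ge0 ?fM//.
have wz := onsq_ge wt.
by rewrite lef_pV2 ?posrE ?exprn_gt0 ?(lt_le_trans t0)// lerXn2r ?nnegrE ?(ltW t0)// ?cabs_ge0.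
Qed.

(** Cauchy's formula compares the integrals of [f w / (w - z)] and of
    [1 / (w - z)]; expanding both in powers of [z] gives the Taylor polynomial of
    [f] and two remainders.  The second integral has to be expanded as well,
    because its value is only known at [z = 0]. *)
Lemma ccoef_expand t f N z M : 0 < t -> cabs z <= t / 2 ->
  (forall w, cabs w <= 2 * t -> derivable f w 1) ->
  (forall w, cabs w <= 2 * t -> cabs (f w) <= M) ->
  cabs (f z - \sum_(i < N.+1) ccoef t f i * z ^+ i) <= 16 * M * (cabs z / t) ^+ N.+1.
Proof.
move=> t0 zt df fM; have tt := sq_le (ltW t0).
have zt' : cabs z < t by rewrite (le_lt_trans zt)// ltr_pdivrMr// ltr_pMr// ltr1n.
have fc : sqcont t f.
  by move=> w wt; apply: derivable_cont; apply: df; exact: onsq_in.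
have fM' w : onsq t w -> cabs (f w) <= M by move=> /onsq_in /fM.
have c1 : sqcont t (cst 1) by move=> w _; exact: cst_continuous.
have E1 := kernel_expand t0 fc N.+1 zt'.
have E2 := kernel_expand t0 c1 N.+1 zt'.
set G := sqint t (fun w => cst 1 w * w ^- N.+1 * (w - z)^-1) in E2.
set E := sqint t (fun w => f w * w ^- N.+1 * (w - z)^-1) in E1.
have K0 := sqK_neq0 t0.
have E2' : sqint t (fun w => (w - z)^-1) = sqK t + z ^+ N.+1 * G.
  transitivity (sqint t (fun w => cst 1 w * (w - z)^-1)).
    by apply: (rectint_ext tt tt) => w _; rewrite mul1r.
  rewrite E2 big_ord_recl /= big1 ?addr0 => [|i _].
    rewrite mul1r; apply: (congr1 (+%R^~ _)).
    by apply: (rectint_ext tt tt) => w _; rewrite mul1r expr1.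
  rewrite -(mulr0 (z ^+ (bump 0 i))) -(sqint_invXX i t0); congr (_ * _).
  by apply: (rectint_ext tt tt) => w _; rewrite mul1r.
have key : f z - \sum_(i < N.+1) ccoef t f i * z ^+ i =
    z ^+ N.+1 * (E - f z * G) / sqK t.
  apply: (mulIf K0); rewrite divfK// mulrBl mulr_suml.
  rewrite (eq_bigr (fun i : 'I_N.+1 => z ^+ i * sqint t (fun w => f w * w ^- i.+1))).
    have := sqint_cauchy t0 zt' df; rewrite E1 E2' => H.
    move: H; set S := \sum_(i < N.+1) _; clearbody E G S => H.
    by rewrite (_ : S = f z * (sqK t + z ^+ N.+1 * G) - z ^+ N.+1 * E);
      [exact: factor_out|rewrite -H addrK].
  by move=> i _; rewrite /ccoef mulrAC divfK// mulrC.
have zt2 : cabs z <= 2 * t.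
  by rewrite (le_trans (ltW zt'))// mulr_natl mulr2n lerDl ltW.
have M0 : 0 <= M by rewrite (le_trans (cabs_ge0 _) (fM z zt2)).
rewrite key cabsM cabsV ler_pdivrMr; last by rewrite cabs_gt0.
rewrite cabsM cabsX expr_div_n.
have hE := kernel_bound t0 fc N.+1 zt fM'.
have f1 w : onsq t w -> cabs (cst 1 w : C) <= 1 by rewrite cabs1.
have hG := kernel_bound t0 c1 N.+1 zt f1.
have : cabs (E - f z * G) <= 64 * M / t ^+ N.+1.
  rewrite (le_trans (cabsB _ _))// cabsM.
  have := lerD hE (ler_pM (cabs_ge0 _) (cabs_ge0 _) (fM z zt2) hG).
  move=> /le_trans; apply; apply: le_of_eq.
  by rewrite mulr1; ring.
move=> /(ler_wpM2l (exprn_ge0 N.+1 (cabs_ge0 z))) /le_trans; apply.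
have -> : 16 * M * (cabs z ^+ N.+1 / t ^+ N.+1) * cabs (sqK t) =
   cabs z ^+ N.+1 * (16 * M / t ^+ N.+1 * cabs (sqK t)) by ring.
rewrite ler_wpM2l ?exprn_ge0 ?cabs_ge0//.
have -> : 64 * M / t ^+ N.+1 = 16 * M / t ^+ N.+1 * 4 by ring.
by rewrite ler_wpM2l ?sqK_ge// !mulr_ge0// invr_ge0 exprn_ge0// ltW.
Qed.

Lemma ccoef0 t f : 0 < t ->
  (forall w, cabs w <= 2 * t -> derivable f w 1) -> ccoef t f 0 = f 0.
Proof.
move=> t0 df; have tt := sq_le (ltW t0); have := sqint_cauchy t0 (ltac:(by rewrite cabs0) : cabs (0 : C) < t) df.
have -> : sqint t (fun w => (w - 0)^-1) = sqK t.
  by apply: (rectint_ext tt tt) => w _; rewrite subr0.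
have -> : sqint t (fun w => f w * (w - 0)^-1) = sqint t (fun w => f w * w ^- 1).
  by apply: (rectint_ext tt tt) => w _; rewrite subr0 expr1.
by rewrite /ccoef => ->; rewrite mulfK// sqK_neq0.
Qed.

(** The difference of the two integrands is the derivative of
    [f w / w^(n+1)]. *)
Lemma ccoef_derive t f f' n : 0 < t -> sqcont t f' ->
  (forall w, onsq t w -> is_derive w 1 f (f' w)) ->
  ccoef t f' n = n.+1%:R * ccoef t f n.+1.
Proof.
move=> t0 f'c df; have tt := sq_le (ltW t0).
have fc : sqcont t f by move=> w /df /derive_cont.
rewrite /ccoef mulrA; congr (_ / _); apply/eqP; rewrite -subr_eq0; apply/eqP.
have m1 := monomial_cont t0 f'c (n:=n.+1); have m2 := monomial_cont t0 fc (n:=n.+2).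
rewrite -mulNr.
have <- : sqint t (fun w => - n.+1%:R * (f w * w ^- n.+2)) =
  - n.+1%:R * sqint t (fun w => f w * w ^- n.+2) by exact: (rectintZ _ tt tt m2).
transitivity (sqint t (fun w => f' w * w ^- n.+1 + - n.+1%:R * (f w * w ^- n.+2))).
  by apply/esym; exact: (rectintD tt tt m1 (oncontZ m2)).
apply: (@rectint_FTC _ _ _ _ _ _ (fun w => f w * w ^- n.+1) tt tt).
  exact: (oncontD m1 (oncontZ m2)).
move=> w wt; have [d1 d2] := derive_mul (df w wt) (derive_invX n.+1 (onsq_neq0 t0 wt)).
by split=> //; rewrite d2 addrC mulrCA.
Qed.

End CauchyExpansion.

(** * Uniform limits of holomorphic functions *)

Lemma quad_small (F : realFieldType) (K t e x : F) : 0 < t -> 0 <= K -> 0 <= x ->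
  x <= e * t ^+ 2 / (1 + K) -> K * (x / t) ^+ 2 <= e * x.
Proof.
move=> t0 K0 x0; rewrite ler_pdivlMr; last by rewrite ltr_wpDr.
move=> h; rewrite expr_div_n mulrA ler_pdivrMr ?exprn_gt0//.
apply: (@le_trans _ _ (x * (1 + K) * x)); last by rewrite [leRHS]mulrAC ler_wpM2r.
by rewrite expr2 mulrA ler_wpM2r// mulrC ler_wpM2l// lerDr.
Qed.

Lemma regroup3 (A : comNzRingType) (f f0 g g0 h L c : A) :
  f - f0 - h * L = (g - (g0 + c * h)) + (f - g) - (f0 - g0) + h * (c - L).
Proof. ring. Qed.

Lemma err_arith (F : realFieldType) (e t x K : F) : 0 < t ->
  K + e + e + x * (4 * e / t) = K + e * (2 + 4 * x / t).
Proof. by move=> t0; field; rewrite gt_eqF. Qed.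
Section Weierstrass.
Variable R : realType.
Local Notation C := (cplx R).
Implicit Types (f g P : C -> C) (z w : C) (t M : R).

(** A quadratic error bound with a fixed constant is a closed condition on [f],
    which differentiability is not; this is how it survives uniform limits. *)
Lemma quad_derive f (L : C) t K : 0 < t -> 0 <= K ->
  (forall h, cabs h <= t / 2 -> cabs (f h - f 0 - h * L) <= K * (cabs h / t) ^+ 2) ->
  is_derive (0 : C) 1 f L.
Proof.
move=> t0 K0 H; apply/is_derive_epsP => e e0.
have d0 : 0 < Num.min (t / 2) (e * t ^+ 2 / (1 + K)).
  rewrite lt_min; apply/andP; split; first by rewrite divr_gt0.
  by apply: divr_gt0; [rewrite mulr_gt0// exprn_gt0|rewrite ltr_wpDr].
exists (Num.min (t / 2) (e * t ^+ 2 / (1 + K))) => // h.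
rewrite lt_min => /andP[h1 h2]; rewrite add0r -[h *: 1]/(h * 1) mulr1.
by rewrite (le_trans (H h (ltW h1)))// quad_small ?cabs_ge0// ltW.
Qed.

Lemma ccoef1_quad f t M : 0 < t ->
  (forall w, cabs w <= 2 * t -> derivable f w 1) ->
  (forall w, cabs w <= 2 * t -> cabs (f w) <= M) ->
  forall h, cabs h <= t / 2 ->
    cabs (f h - f 0 - h * ccoef t f 1) <= 16 * M * (cabs h / t) ^+ 2.
Proof.
move=> t0 df fM h ht; have := ccoef_expand 1 t0 ht df fM.
rewrite big_ord_recl big_ord1 /= expr0 mulr1 expr1 (ccoef0 t0 df).
by rewrite opprD addrA [ccoef _ _ _ * h]mulrC.
Qed.

Lemma bound_ge0 f t M : 0 < t -> (forall w, cabs w <= 2 * t -> cabs (f w) <= M) -> 0 <= M.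
Proof.
move=> t0 fM; apply: le_trans (cabs_ge0 (f 0)) (fM 0 _).
by rewrite cabs0 mulr_ge0// ltW.
Qed.

Lemma ccoef1_derive f t M : 0 < t ->
  (forall w, cabs w <= 2 * t -> derivable f w 1) ->
  (forall w, cabs w <= 2 * t -> cabs (f w) <= M) ->
  is_derive (0 : C) 1 f (ccoef t f 1).
Proof.
move=> t0 df fM; apply: (@quad_derive _ _ t (16 * M) t0); last exact: ccoef1_quad.
by rewrite mulr_ge0// (bound_ge0 t0 fM).
Qed.

Lemma ccoefB t f g n : 0 < t -> sqcont t f -> sqcont t g ->
  ccoef t f n - ccoef t g n = ccoef t (fun w => f w + (-1) * g w) n.
Proof.
move=> t0 fc gc; have tt := sq_le (ltW t0); rewrite /ccoef -mulrBl; congr (_ / _).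
have mf := monomial_cont t0 fc (n:=n.+1); have mg := monomial_cont t0 gc (n:=n.+1).
rewrite -mulN1r.
have <- : sqint t (fun w => -1 * (g w * w ^- n.+1)) =
  -1 * sqint t (fun w => g w * w ^- n.+1) by exact: (rectintZ _ tt tt mg).
transitivity (sqint t (fun w => f w * w ^- n.+1 + -1 * (g w * w ^- n.+1))).
  by apply/esym; exact: (rectintD tt tt mf (oncontZ mg)).
by apply: (rectint_ext tt tt) => w _; rewrite mulrDl mulrA.
Qed.

Lemma uniform_cont f (r : R) z :
  (forall e, 0 < e -> exists2 g, (forall w, cabs w < r -> {for w, continuous g}) &
     forall w, cabs w < r -> cabs (g w - f w) <= e) ->
  cabs z < r -> {for z, continuous f}.
Proof.
move=> H zr; apply/ccontP => e e0.
have e3 : 0 < e / 3 by rewrite divr_gt0.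
have [g gc gf] := H _ e3; have /ccontP/(_ _ e3)[del del0 Hd] := gc z zr.
exists (Num.min del (r - cabs z)); first by rewrite lt_min del0 subr_gt0.
move=> w; rewrite lt_min => /andP[w1 w2].
have wr : cabs w < r.
  rewrite -[w](subrK z) (le_lt_trans (cabsD _ _))//; move: w2; by rewrite ltrBrDr.
rewrite (_ : f w - f z = (g w - g z) - (g w - f w) + (g z - f z)); last by ring.
have -> : e = e / 3 + e / 3 + e / 3 by field.
rewrite (le_trans (cabsD _ _))// lerD ?gf// (le_trans (cabsB _ _))// lerD ?gf//.
exact: Hd.
Qed.

(** Weierstrass's theorem: the coefficients and the constant in the quadratic error
    bound are an integral and a maximum of the function, so the bound passes to
    the uniform limit. *)
Lemma weierstrass t M f : 0 < t ->
  (forall e, 0 < e -> exists2 g, (forall w, cabs w <= 4 * t -> derivable g w 1) &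
     forall w, cabs w <= 4 * t -> cabs (g w - f w) <= e) ->
  (forall w, cabs w <= 4 * t -> cabs (f w) <= M) -> derivable f 0 1.
Proof.
move=> t0 H fM.
have t24 w : cabs w <= 2 * t -> cabs w <= 4 * t.
  by move=> /le_trans; apply; rewrite ler_wpM2r ?ler_nat// ltW.
have fM2 w : cabs w <= 2 * t -> cabs (f w) <= M by move=> /t24 /fM.
have M0 := bound_ge0 t0 fM2.
have fc : sqcont t f.
  move=> z /onsq_in zt; apply: (@uniform_cont f (4 * t)).
    move=> e /H [g dg gf]; exists g; first by move=> w /ltW /dg /derivable_cont.
    by move=> w /ltW /gf.
  by rewrite (le_lt_trans zt)// ltr_pM2r// ltr_nat.
suff [d _] : is_derive (0 : C) 1 f (ccoef t f 1) by [].
have K0 : 0 <= 16 * (M + 1) by rewrite mulr_ge0// addr_ge0.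
apply: (@quad_derive _ _ t (16 * (M + 1)) t0 K0) => h ht.
have ht2 : cabs h <= 2 * t.
  rewrite (le_trans ht)// (@le_trans _ _ t)//; first by rewrite ler_pdivrMr// ler_peMr ?ler1n// ltW.
  by rewrite mulr_natl mulr2n lerDl ltW.
apply/ler_addgt0Pr => e e0.
have den : 0 < 2 + 4 * cabs h / t.
  by rewrite ltr_wpDr// !mulr_ge0 ?cabs_ge0// invr_ge0 ltW.
pose e1 := Num.min 1 (e / (2 + 4 * cabs h / t)).
have e10 : 0 < e1 by rewrite lt_min ltr01 divr_gt0.
have [g dg gf] := H e1 e10.
have e11 : e1 <= 1 by rewrite ge_min lexx.
have e1e : e1 * (2 + 4 * cabs h / t) <= e.
  by rewrite -ler_pdivlMr// ge_min lexx orbT.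
have dg2 w : cabs w <= 2 * t -> derivable g w 1 by move=> /t24 /dg.
have gM w : cabs w <= 2 * t -> cabs (g w) <= M + 1.
  move=> wt; rewrite -[g w](subrK (f w)) addrC (le_trans (cabsD _ _))// lerD ?fM2//.
  by rewrite (le_trans (gf _ (t24 _ wt))).
have gc : sqcont t g by move=> w /onsq_in /dg2 /derivable_cont.
have q1 := ccoef1_quad t0 dg2 gM ht.
have q2 : cabs (ccoef t g 1 - ccoef t f 1) <= 4 * e1 / t.
  have hc : sqcont t (fun w => g w + -1 * f w) := oncontD gc (oncontZ fc).
  have hb w : onsq t w -> cabs (g w + -1 * f w) <= e1.
    by move=> /onsq_in/t24 /gf; rewrite mulN1r.
  rewrite (ccoefB 1 t0 gc fc).
  by have := ccoef_bound 1 t0 hc hb; rewrite expr1.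
have q3 := gf _ (t24 _ ht2).
have q4 : cabs (g 0 - f 0) <= e1 by apply: gf; rewrite cabs0 mulr_ge0// ltW.
rewrite (regroup3 (f h) (f 0) (g h) (g 0) h (ccoef t f 1) (ccoef t g 1)).
have -> : g h - (g 0 + ccoef t g 1 * h) = g h - g 0 - h * ccoef t g 1.
  by rewrite opprD addrA [h * _]mulrC.
apply: le_trans (cabsD _ _) _; rewrite cabsM.
apply: le_trans (lerD (cabsB _ _) (ler_wpM2l (cabs_ge0 h) q2)) _.
rewrite cabsC in q3; rewrite cabsC in q4.
apply: le_trans (lerD (lerD (le_trans (cabsD _ _) (lerD q1 q3)) q4) (lexx _)) _.
by rewrite err_arith// lerD2l.
Qed.

End Weierstrass.

(** * Separately holomorphic functions *)

Opaque sqint ccoef.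

Lemma eighth_le (F : realFieldType) (r : F) : 0 <= r -> r / 4 / 2 <= r / 2.
Proof. by move=> r0; lra. Qed.

Section SeparatelyHolomorphic.
Variables (R : realType) (N : nat).
Local Notation C := (cplx R).
Local Notation V := 'rV[C]_N.
Implicit Types (f g : V -> C) (w p : V) (z h : C) (r t M : R) (U : set V).

Definition ev (i : 'I_N) : V := delta_mx 0 i.

(** [w'] lies in the closed polydisc of radius [r] about [w]. *)
Definition pclose r w w' := forall i, cabs (w' 0 i - w 0 i) <= r.

Definition coord_open U := forall w, U w ->
  exists2 r : R, 0 < r & forall w', pclose r w w' -> U w'.

(** Differentiability in each coordinate separately, together with local
    boundedness; unlike joint differentiability this is visibly inherited by the
    partial derivatives. *)
Definition sholo U f := forall w, U w ->
  (forall i, derivable f w (ev i)) /\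
  exists r M, 0 < r /\ forall w', pclose r w w' -> cabs (f w') <= M.

Lemma pclose_refl r w : 0 <= r -> pclose r w w.
Proof. by move=> r0 i; rewrite subrr cabs0. Qed.

Lemma pclose_trans r s w w1 w2 : pclose r w w1 -> pclose s w1 w2 -> pclose (r + s) w w2.
Proof.
move=> h1 h2 i; rewrite -(subrK (w1 0 i) (w2 0 i)) -addrA.
by rewrite (le_trans (cabsD _ _))// [leLHS]addrC; exact: (lerD (h1 i) (h2 i)).
Qed.

Lemma pclose_le r s w w1 : r <= s -> pclose r w w1 -> pclose s w w1.
Proof. by move=> rs h i; rewrite (le_trans (h i)). Qed.

Lemma pclose_line r w z i : cabs z <= r -> 0 <= r -> pclose r w (w + z *: ev i).
Proof.
move=> zr r0 j; rewrite !mxE eqxx /= [w 0 j + _]addrC addrK.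
by case: (j == i); rewrite ?mulr1 ?mulr0 ?cabs0.
Qed.

Lemma is_derive_line f w v z (d : C) :
  is_derive (w + z *: v) v f d <-> is_derive z 1 (fun u : C => f (w + u *: v)) d.
Proof.
have E (h : C) : w + z *: v + h *: v = w + (z + h *: 1) *: v.
  by rewrite -[h *: 1]/(h * 1) mulr1 scalerDl addrA.
by split=> /is_derive_epsP H; apply/is_derive_epsP => e /H [del del0 Hd];
  exists del => // h /Hd; rewrite E.
Qed.

Lemma derivable_line f w v z :
  derivable f (w + z *: v) v <-> derivable (fun u : C => f (w + u *: v)) z 1.
Proof.
split=> /derivableP D.
  by have [] := (is_derive_line _ _ _ _ _).1 D.
by have [] := (is_derive_line _ _ _ _ _).2 D.
Qed.

Lemma derivable_line0 f w v :
  derivable f w v <-> derivable (fun u : C => f (w + u *: v)) 0 1.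
Proof. by have := derivable_line f w v 0; rewrite scale0r addr0. Qed.

Lemma derive_line0 f w v d :
  is_derive (0 : C) 1 (fun u : C => f (w + u *: v)) d -> 'D_v f w = d.
Proof.
by move=> /(is_derive_line f w v 0 d).2; rewrite scale0r addr0 => -[].
Qed.

Lemma sholo_local U f w : coord_open U -> sholo U f -> U w ->
  exists r M, 0 < r /\ forall w', pclose r w w' -> U w' /\ cabs (f w') <= M.
Proof.
move=> Uo fU Uw; have [r r0 rU] := Uo w Uw.
have [_ [s [M [s0 sM]]]] := fU w Uw.
exists (Num.min r s), M; split; first by rewrite lt_min r0.
move=> w' h; split; first by apply: rU; apply: pclose_le h; rewrite ge_min lexx.
by apply: sM; apply: pclose_le h; rewrite ge_min lexx orbT.
Qed.

(** Cauchy's estimates on the complex line through [w'] in the [j]-th coordinate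
    direction, uniformly for [w'] in a smaller polydisc. *)
Lemma sholo_quotient U f w w' (r M : R) j : sholo U f -> 0 < r ->
  (forall w', pclose r w w' -> U w' /\ cabs (f w') <= M) ->
  pclose (r / 2) w w' ->
  let t := r / 4 in
  [/\ cabs ('D_(ev j) f w') <= 4 * M / t,
      derivable f w' (ev j) &
      forall h, cabs h <= t / 2 ->
        cabs (f (w' + h *: ev j) - f w' - h * 'D_(ev j) f w')
          <= 16 * M * (cabs h / t) ^+ 2].
Proof.
move=> fU r0 rM ww' t; have t0 : 0 < t by rewrite divr_gt0.
have rt : r / 2 + 2 * t = r by rewrite /t; field.
pose phi (z : C) := f (w' + z *: ev j).
have zin z : cabs z <= 2 * t -> pclose r w (w' + z *: ev j).
  move=> zt; rewrite -rt; apply: pclose_trans ww' _; apply: pclose_line => //.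
  by rewrite mulr_ge0// ltW.
have dphi z : cabs z <= 2 * t -> derivable phi z 1.
  by move=> /zin /rM [Uz _]; apply/derivable_line; exact: (fU _ Uz).1.
have phiM z : cabs z <= 2 * t -> cabs (phi z) <= M by move=> /zin /rM [].
have d0 := ccoef1_derive t0 dphi phiM.
have c0 : 'D_(ev j) f w' = ccoef t phi 1 by exact: derive_line0.
have phi0 : phi 0 = f w' by rewrite /phi scale0r addr0.
split.
- rewrite c0; have := @ccoef_bound R t phi 1 M t0; rewrite expr1; apply.
    by move=> z /onsq_in /dphi /derivable_cont.
  by move=> z /onsq_in /phiM.
- by apply/derivable_line0; apply: dphi; rewrite cabs0 mulr_ge0// ltW.
- by move=> h ht; rewrite c0 -phi0; exact: ccoef1_quad.
Qed.

Lemma quot_bound (A B h d : C) (e : R) : h != 0 ->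
  cabs (A - B - h * d) <= e * cabs h -> cabs ((A - B) / h - d) <= e.
Proof.
move=> h0 H; rewrite -(@ler_pM2r _ (cabs h)) ?cabs_gt0// -cabsM.
suff -> : ((A - B) / h - d) * h = A - B - h * d by [].
by field.
Qed.

(** Locally, the [j]-th partial derivative is the uniform limit of difference
    quotients with a constant increment [x] in direction [j]; these are
    differentiable in every direction [i], so Weierstrass applies on the line in
    direction [i]. *)
Lemma sholo_D U f j : coord_open U -> sholo U f -> sholo U ('D_(ev j) f).
Proof.
move=> Uo fU w Uw; have [r [M [r0 rM]]] := sholo_local Uo fU Uw.
pose t := r / 4; have t0 : 0 < t by rewrite divr_gt0.
have Dq w' := sholo_quotient (w' := w') j fU r0 rM.
have M0 : 0 <= M.
  by have [_] := rM w (pclose_refl w (ltW r0)); apply: le_trans; exact: cabs_ge0.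
split; last first.
  exists (r / 2), (4 * M / t); split; first by rewrite divr_gt0.
  by move=> w' /Dq [].
move=> i; apply/derivable_line0.
have zin z : cabs z <= r / 2 -> pclose (r / 2) w (w + z *: ev i).
  by move=> zr; apply: pclose_line => //; rewrite divr_ge0// ltW.
have r8 : 4 * (r / 8) = r / 2 by field.
apply: (@weierstrass R (r / 8) (4 * M / t)); rewrite ?divr_gt0// r8; last first.
  by move=> z /zin /Dq [].
move=> e e0.
pose K := 16 * M / t ^+ 2.
have K0 : 0 <= K by rewrite divr_ge0 ?sqr_ge0// mulr_ge0.
have K1 : 0 < 1 + K by rewrite ltr_wpDr.
pose x := Num.min (t / 2) (e / (1 + K)).
have x0 : 0 < x by rewrite lt_min !divr_gt0.
have h0 : rc x != 0 by rewrite -cabs_gt0 cabs_rc gtr0_norm.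
have hx : cabs (rc x) = x by rewrite cabs_rc gtr0_norm.
have xt : x <= t / 2 by rewrite ge_min lexx.
have xe : x * (1 + K) <= e by rewrite -ler_pdivlMr// ge_min lexx orbT.
exists (fun z : C => (f (w + z *: ev i + rc x *: ev j) - f (w + z *: ev i)) / rc x).
  move=> z /zin zr; apply: derivableM; last exact: derivable_cst.
  apply: derivableB; last first.
    have r2 : r / 2 <= r by rewrite ler_pdivrMr// ler_peMr ?ler1n// ltW.
    by apply/derivable_line; have [/fU[d _] _] := rM _ (pclose_le r2 zr).
  have E : (fun z : C => f (w + z *: ev i + rc x *: ev j)) =
      (fun z : C => f (w + rc x *: ev j + z *: ev i)).
    by apply/funext => u; rewrite addrAC.
  rewrite E; apply/derivable_line; rewrite addrAC.
  have [|Uz _] := rM (w + z *: ev i + rc x *: ev j); last exact: (fU _ Uz).1.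
  rewrite (splitr r); apply: pclose_trans zr _; apply: pclose_line; last by rewrite divr_ge0// ltW.
  by rewrite hx (le_trans xt)// /t; exact: eighth_le (ltW r0).
move=> z /zin zr; have [_ _] := Dq _ zr.
move=> /(_ (rc x)); rewrite hx => /(_ xt) H.
apply: quot_bound => //; rewrite hx (le_trans H)//.
have -> : 16 * M * (x / t) ^+ 2 = K * x * x by rewrite /K expr_div_n; ring.
by rewrite ler_pM2r// mulrC (le_trans _ xe)// ler_wpM2l ?(ltW x0)// lerDr.
Qed.

End SeparatelyHolomorphic.

(** * Taylor expansion in several variables *)

Lemma half_le2 (F : realFieldType) (t : F) : 0 <= t -> t / 2 <= 2 * t.
Proof. by move=> t0; lra. Qed.

Lemma coef_diff (F : fieldType) (a b x y : F) :
  a / y * x - x / y * b = (a - b) * (x / y).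
Proof. by rewrite mulrBl [b * _]mulrC -mulrA [y^-1 * x]mulrC. Qed.

Lemma term_arith (F : fieldType) (A nf M T B X : F) : nf != 0 -> T != 0 ->
  A * (nf * (4 * M / T)) * B * (X / nf) = X / T * (4 * (A * M * B)).
Proof. by move=> h1 h2; field; rewrite h1 h2. Qed.

Lemma two_four (F : comNzRingType) (x : F) : 2 * (4 * x) = 8 * x.
Proof. ring. Qed.

Lemma geo_half (F : realFieldType) n (x : F) : 0 <= x -> x <= 1 / 2 ->
  \sum_(i < n) x ^+ i <= 2.
Proof.
move=> x0 x2; rewrite (@le_trans _ _ (\sum_(i < n) (1 / 2) ^+ i))//.
  by apply: ler_sum => i _; rewrite lerXn2r// nnegrE.
suff -> : \sum_(i < n) (1 / 2 : F) ^+ i = 2 - 2 * (1 / 2) ^+ n.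
  by rewrite gerBl mulr_ge0// exprn_ge0// divr_ge0.
elim: n => [|n IH]; first by rewrite big_ord0 expr0 mulr1 subrr.
by rewrite big_ord_recr /= IH exprS; field.
Qed.
Section Taylor.
Variables (R : realType) (N : nat).
Local Notation C := (cplx R).
Local Notation V := 'rV[C]_N.
Local Notation ev := (@ev R N).
Implicit Types (f g : V -> C) (w p : V) (z h : C) (r t M : R) (U : set V).

Definition Dj (j : 'I_N) (f : V -> C) : V -> C := 'D_(ev j) f.

Lemma sholo_iter U f j n : coord_open U -> sholo U f -> sholo U (iter n (Dj j) f).
Proof. by move=> Uo fU; elim: n => //= n IH; exact: sholo_D. Qed.

Section Line.
Variables (U : set V) (f : V -> C) (w : V) (j : 'I_N) (t M : R).
Hypotheses (Uo : coord_open U) (fU : sholo U f) (t0 : 0 < t).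
Hypothesis lineU : forall z, cabs z <= 2 * t -> U (w + z *: ev j).
Hypothesis lineM : forall z, cabs z <= 2 * t -> cabs (f (w + z *: ev j)) <= M.

Let phi n (z : C) : C := iter n (Dj j) f (w + z *: ev j).

Let dphi n z : cabs z <= 2 * t -> is_derive z 1 (phi n) (phi n.+1 z).
Proof.
move=> /lineU Uz; apply/is_derive_line; apply: derivableP.
by have [] := sholo_iter j n Uo fU Uz.
Qed.

(** The coefficients of the [n]-th derivative are those of the function itself,
    shifted by [n] and multiplied by a quotient of factorials. *)
Let phi_ccoef n m :
  m`!%:R * ccoef t (phi n) m = (m + n)`!%:R * ccoef t (phi 0) (m + n).
Proof.
elim: n m => [|n IH] m; first by rewrite addn0.
have hc : sqcont t (phi n.+1) by move=> z /onsq_in /(dphi n.+1) /derive_cont.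
have hd z : onsq t z -> is_derive z 1 (phi n) (phi n.+1 z) by move=> /onsq_in /(dphi n).
by rewrite (@ccoef_derive R t (phi n) (phi n.+1) m t0 hc hd) mulrA -natrM mulnC -factS IH addSnnS.
Qed.

Lemma iter_DjE n : iter n (Dj j) f w = n`!%:R * ccoef t (phi 0) n.
Proof.
have := phi_ccoef n 0; rewrite fact0 mul1r add0n => <-.
rewrite ccoef0//; first by rewrite /phi scale0r addr0.
by move=> z /(dphi n) [].
Qed.

Let dphi0 z : cabs z <= 2 * t -> derivable (phi 0) z 1.
Proof. by move=> /(dphi 0) []. Qed.

Lemma iter_Dj_bound n : cabs (iter n (Dj j) f w) <= n`!%:R * (4 * M / t ^+ n).
Proof.
rewrite iter_DjE cabsM cabs_nat ler_wpM2l//; apply: ccoef_bound => //.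
  by move=> z /onsq_in /dphi0 /derivable_cont.
by move=> z /onsq_in /lineM.
Qed.

Lemma line_taylor z n : cabs z <= t / 2 ->
  cabs (f (w + z *: ev j) - \sum_(i < n.+1) iter i (Dj j) f w / i`!%:R * z ^+ i)
    <= 16 * M * (cabs z / t) ^+ n.+1.
Proof.
move=> zt; have := ccoef_expand n t0 zt dphi0 lineM.
rewrite (eq_bigr (fun i : 'I_n.+1 => iter i (Dj j) f w / i`!%:R * z ^+ i))// => i _.
by rewrite iter_DjE [_%:R * _]mulrC mulfK// pnatr_eq0 -lt0n fact_gt0.
Qed.

End Line.

(** Iterated partial derivatives, the coordinates in the list [l] only. *)
Definition mpl (l : seq 'I_N) (al : 'I_N -> nat) f : V -> C :=
  foldr (fun i (g : V -> C) => iter (al i) (Dj i) g) f l.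

Lemma mpl_rcons l j al f : mpl (rcons l j) al f = mpl l al (iter (al j) (Dj j) f).
Proof. exact: foldr_rcons. Qed.

Lemma eq_mpl l al be f : {in l, al =1 be} -> mpl l al f = mpl l be f.
Proof.
elim: l => //= i l IH H; rewrite H ?mem_head// IH// => k kl.
by apply: H; rewrite inE kl orbT.
Qed.

Variable D : nat.
Local Notation box := {ffun 'I_N -> 'I_D.+1}.

Definition supp (l : seq 'I_N) (al : box) := [forall i, (i \notin l) ==> (al i == ord0)].

(** The Taylor polynomial at [p] in the coordinates in [l], of degree at most [D]
    in each of them. *)
Definition taylor l f p w : C := \sum_(al : box | supp l al)
  mpl l (fun i => al i) f p *
  \prod_(i <- l) ((w 0 i - p 0 i) ^+ al i / (al i)`!%:R).

Definition updbox (al : box) j (n : 'I_D.+1) : box :=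
  [ffun i => if i == j then n else al i].

Lemma taylor_rcons l j f p w : uniq (rcons l j) ->
  taylor (rcons l j) f p w = \sum_(n < D.+1)
    (w 0 j - p 0 j) ^+ n / n`!%:R * taylor l (iter n (Dj j) f) p w.
Proof.
rewrite rcons_uniq => /andP[jl _]; rewrite /taylor (partition_big (fun al : box => al j) xpredT)//=.
apply: eq_bigr => n _.
rewrite (reindex_onto (fun be => updbox be j n) (fun al => updbox al j ord0)) /=; last first.
  move=> al /andP[_ /eqP <-]; apply/ffunP => i; rewrite !ffunE.
  by case: eqP => [->|].
rewrite mulr_sumr; apply: eq_big => be.
  rewrite !ffunE !eqxx andbT.
  apply/andP/forallP => [[/forallP H /eqP E] i|H].
    apply/implyP => il; have := H i; rewrite mem_rcons inE !ffunE.
    have [-> _|ij] := eqVneq i j; last by rewrite (negPf il).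
    by rewrite -E !ffunE eqxx.
  split.
    apply/forallP => i; rewrite mem_rcons inE negb_or !ffunE.
    by apply/implyP => /andP[/negPf -> il]; exact: (implyP (H i)).
  apply/eqP/ffunP => i; rewrite !ffunE; case: eqVneq => // ->.
  by apply/esym/eqP; exact: (implyP (H j)).
move=> _; rewrite mpl_rcons big_rcons /= !ffunE eqxx [RHS]mulrCA.
have E i : i \in l -> updbox be j n i = be i.
  by move=> il; rewrite ffunE; case: eqP => // ij; rewrite -ij il in jl.
rewrite (@eq_mpl l _ (fun i => be i)); last by move=> i /E ->.
congr (_ * _); rewrite mulrC; congr (_ * _); rewrite big_seq [RHS]big_seq.
by apply: eq_bigr => i /E ->.
Qed.

(** The polydisc of radius [2 t] about [p] in the coordinates in [l] only. *)
Definition slice (l : seq 'I_N) p t w := pclose (2 * t) p w /\ forall i, i \notin l -> w 0 i = p 0 i.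

Lemma slice_line (l : seq 'I_N) j p t v z : slice l p t v -> j \notin l -> cabs z <= 2 * t ->
  slice (rcons l j) p t (v + z *: ev j).
Proof.
move=> [vp vl] jl zt; split=> i.
  rewrite !mxE eqxx /=; have [->|ij] := eqVneq i j.
    by rewrite mulr1 vl// [p 0 j + _]addrC addrK.
  by rewrite mulr0 addr0.
rewrite mem_rcons inE negb_or => /andP[ij il].
by rewrite !mxE eqxx (negPf ij) mulr0 addr0 vl.
Qed.

Lemma slice_iter_bound U f l j p t M n v : coord_open U -> sholo U f -> 0 < t ->
  (forall w, pclose (2 * t) p w -> U w) ->
  (forall w, slice (rcons l j) p t w -> cabs (f w) <= M) -> j \notin l ->
  slice l p t v -> cabs (iter n (Dj j) f v) <= n`!%:R * (4 * M / t ^+ n).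
Proof.
move=> Uo fU t0 pU fM jl vl; apply: (@iter_Dj_bound U) => // z zt.
  by apply: pU; have [] := slice_line vl jl zt.
by apply: fM; exact: slice_line.
Qed.

(** Cauchy's inequalities, one coordinate at a time; each of them costs a
    factor 4. *)
Lemma mpl_bound U f l p t M al : coord_open U -> sholo U f -> 0 < t ->
  (forall w, pclose (2 * t) p w -> U w) -> uniq l ->
  (forall w, slice l p t w -> cabs (f w) <= M) ->
  cabs (mpl l al f p) <= M * \prod_(i <- l) ((al i)`!%:R * 4 / t ^+ al i).
Proof.
move=> Uo fU t0 pU; elim/last_ind: l f M fU => [|l j IH] f M fU ul fM.
  rewrite big_nil mulr1; apply: fM; split=> //.
  by apply: pclose_refl; rewrite mulr_ge0// ltW.
move: (ul); rewrite rcons_uniq => /andP[jl ul'].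
rewrite mpl_rcons big_rcons /=.
have := IH _ _ (sholo_iter j (al j) Uo fU) ul'
  (fun v vl => @slice_iter_bound U f l j p t M (al j) v Uo fU t0 pU fM jl vl).
move=> /le_trans; apply.
by apply: le_of_eq; ring.
Qed.

(** Induction on the list of coordinates.  The last coordinate of [w] is first
    reset to that of [p], which gives [v]; the one-variable expansion at [v] in
    direction [j] has derivatives of [f] at [v] as coefficients, and these are
    expanded in the remaining coordinates.  Both errors are at most half of the
    claimed bound, because [|w_j - p_j| <= t / 2]. *)
Lemma taylor_bound U f l p w t M : coord_open U -> sholo U f -> 0 < t ->
  (forall w, pclose (2 * t) p w -> U w) -> uniq l ->
  (forall w, slice l p t w -> cabs (f w) <= M) ->
  pclose (t / 2) p w -> (forall i, i \notin l -> w 0 i = p 0 i) ->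
  cabs (f w - taylor l f p w) <= 16 ^+ size l * M * (1 / 2) ^+ D.
Proof.
move=> Uo fU t0 pU; have t0' := ltW t0.
elim/last_ind: l f M w fU => [|l j IH] f M w fU ul fM wp wl.
  have -> : w = p by apply/rowP => i; exact: wl.
  have pp : slice [::] p t p by split=> //; apply: pclose_refl; rewrite mulr_ge0.
  have M0 : 0 <= M by apply: le_trans (cabs_ge0 _) (fM p pp).
  rewrite /taylor (bigD1 [ffun=> ord0]) /=; last by apply/forallP => i; rewrite ffunE eqxx.
  rewrite big_nil mulr1 big1 => [|al /andP[/forallP H /eqP ne]]; last first.
    by exfalso; apply: ne; apply/ffunP => i; rewrite ffunE; apply/eqP; exact: H.
  by rewrite addr0 subrr cabs0 mulr_ge0 ?mulr_ge0 ?exprn_ge0// divr_ge0.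
move: (ul); rewrite rcons_uniq => /andP[jl ul'].
pose x := w 0 j - p 0 j; pose v := w - x *: ev j.
have wE : w = v + x *: ev j by rewrite subrK.
have xt : cabs x <= t / 2 by exact: wp.
have vj : v 0 j = p 0 j by rewrite !mxE !eqxx mulr1 opprB addrC subrK.
have vi i : i != j -> v 0 i = w 0 i.
  by move=> ij; rewrite !mxE eqxx (negPf ij) mulr0 subr0.
have vl i : i \notin l -> v 0 i = p 0 i.
  move=> il; have [->//|ij] := eqVneq i j; rewrite vi// wl// mem_rcons inE.
  by rewrite negb_or ij.
have vp : pclose (t / 2) p v.
  move=> i; have [->|ij] := eqVneq i j; last by rewrite vi// wp.
  by rewrite vj subrr cabs0 divr_ge0.
have vs : slice l p t v.
  split=> //; by apply: pclose_le vp; exact: half_le2.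
have M0 : 0 <= M.
  have := slice_line vs jl (_ : cabs 0 <= 2 * t); rewrite cabs0 mulr_ge0// => /(_ isT)/fM.
  by apply: le_trans; exact: cabs_ge0.
have gM n u : slice l p t u -> cabs (iter n (Dj j) f u) <= n`!%:R * (4 * M / t ^+ n).
  exact: (@slice_iter_bound U f l j p t M n u Uo fU t0 pU fM jl).
have lt := @line_taylor U f v j t M Uo fU t0.
have {}lt := lt (fun z zt => pU _ (slice_line vs jl zt).1) (fun z zt => fM _ (slice_line vs jl zt)) x D xt.
rewrite -wE in lt.
have tE : taylor (rcons l j) f p w =
    \sum_(n < D.+1) x ^+ n / n`!%:R * taylor l (iter n (Dj j) f) p v.
  rewrite (taylor_rcons f p w ul); apply: eq_bigr => n _; congr (_ * _).
  apply: eq_bigr => al _; congr (_ * _); rewrite big_seq [RHS]big_seq.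
  by apply: eq_bigr => i il; rewrite vi//; apply: contraNneq jl => <-.
set S := \sum_(i < D.+1) _ in lt.
rewrite tE -(subrK S (f w)) -addrA.
apply: le_trans (cabsD _ _) _.
set xt2 := cabs x / t in lt.
have x2 : xt2 <= 1 / 2 by rewrite ler_pdivrMr// mulrC mul1r.
have x20 : 0 <= xt2 by rewrite divr_ge0 ?cabs_ge0.
have h1 : cabs (f w - S) <= 8 * M * (1 / 2) ^+ D.
  apply: le_trans lt _.
  have -> : 8 * M * (1 / 2) ^+ D = 16 * M * (1 / 2) ^+ D.+1 by rewrite exprS; field.
  by rewrite ler_wpM2l ?mulr_ge0// lerXn2r// nnegrE.
have h2 : cabs (S - \sum_(n < D.+1) x ^+ n / n`!%:R * taylor l (iter n (Dj j) f) p v)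
    <= 8 * (16 ^+ size l * M * (1 / 2) ^+ D).
  rewrite /S -sumrB; apply: le_trans (cabs_sum _ _ _) _.
  apply: (@le_trans _ _ (\sum_(n < D.+1) xt2 ^+ n * (4 * (16 ^+ size l * M * (1 / 2) ^+ D)))).
    apply: ler_sum => n _.
    have H := IH _ _ v (sholo_iter j n Uo fU) ul' (gM n) vp vl.
    rewrite coef_diff cabsM.
    apply: le_trans (ler_wpM2r (cabs_ge0 (x ^+ n / n`!%:R)) H) _.
    rewrite cabsM cabsV cabsX cabs_nat /xt2 (expr_div_n (cabs x)); apply: le_of_eq.
    have nf : n`!%:R != 0 :> R by rewrite pnatr_eq0 -lt0n fact_gt0.
    by apply: term_arith => //; rewrite expf_neq0// gt_eqF.
  rewrite -mulr_suml; have := geo_half D.+1 x20 x2.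
  have K0 : 0 <= 4 * (16 ^+ size l * M * (1 / 2) ^+ D).
    by rewrite !mulr_ge0 ?exprn_ge0// divr_ge0.
  move=> /ler_wpM2r => /(_ _ K0) /le_trans; apply.
  by apply: le_of_eq; exact: two_four.
apply: le_trans (lerD h1 h2) _; rewrite size_rcons exprS.
have e1 : 1 <= 16 ^+ size l :> R by rewrite exprn_ege1// ler1n.
have -> : 16 * 16 ^+ size l * M * (1 / 2) ^+ D =
  8 * (16 ^+ size l * M * (1 / 2) ^+ D) + 8 * (16 ^+ size l * M * (1 / 2) ^+ D) by ring.
rewrite lerD2r -mulrA ler_wpM2l// ler_wpM2r ?exprn_ge0 ?divr_ge0//.
by rewrite ler_peMl.
Qed.

End Taylor.

(** * Multi-indices *)

Section Boxes.
Variable N : nat.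
Local Notation index := {ffun 'I_N -> nat}.
Implicit Types (al : index) (D : nat).

Definition deg al := (\sum_i al i)%N.

Definition ofbox D (be : {ffun 'I_N -> 'I_D.+1}) : index := [ffun i => be i : nat].

(** The entries are bounded rather than the degree, because sums over a box
    factor into products. *)
Definition box D : seq index := [seq ofbox be | be <- enum {: {ffun 'I_N -> 'I_D.+1}}].

Lemma ofbox_inj D : injective (@ofbox D).
Proof.
move=> be be' /ffunP E; apply/ffunP => i; apply: val_inj.
by have := E i; rewrite !ffunE.
Qed.

Lemma box_uniq D : uniq (box D).
Proof. by rewrite map_inj_uniq ?enum_uniq//; exact: ofbox_inj. Qed.

Lemma mem_box D al : (al \in box D) = [forall i, (al i <= D)%N].
Proof.
apply/mapP/forallP => [[be _ ->] i|H]; first by rewrite ffunE -ltnS.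
exists [ffun i => Ordinal (H i : (al i < D.+1)%N)]; first by rewrite mem_enum.
by apply/ffunP => i; rewrite !ffunE.
Qed.

Lemma mem_boxP D al : reflect (forall i, al i <= D)%N (al \in box D).
Proof. by rewrite mem_box; exact: forallP. Qed.

Lemma leq_deg al i : (al i <= deg al)%N.
Proof. by rewrite /deg (bigD1 i)//= leq_addr. Qed.

Lemma deg_box D al : (deg al <= D)%N -> al \in box D.
Proof. by move=> aD; apply/mem_boxP => i; exact: leq_trans (leq_deg al i) aD. Qed.

Lemma box_le (V : nmodType) D D' (G : index -> V) : (D <= D')%N ->
  \sum_(al <- box D) G al = \sum_(al <- box D' | al \in box D) G al.
Proof.
move=> DD'; rewrite -[RHS]big_filter; apply: perm_big.
apply: uniq_perm; rewrite ?filter_uniq ?box_uniq// => al.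
rewrite mem_filter; case: (boolP (al \in box D)) => //= /mem_boxP aD.
by apply/esym/mem_boxP => i; exact: leq_trans (aD i) DD'.
Qed.

Definition e1 (i : 'I_N) : index := [ffun j => (j == i) : nat].

Lemma deg_e1 i : deg (e1 i) = 1%N.
Proof.
rewrite /deg (bigD1 i)//= ffunE eqxx big1 ?addn0// => j ji.
by rewrite ffunE (negPf ji).
Qed.

Lemma deg0 al : (deg al == 0)%N = (al == [ffun=> 0%N]).
Proof.
apply/eqP/eqP => [d0|->]; last by rewrite /deg big1// => i _; rewrite ffunE.
apply/ffunP => i; rewrite ffunE; apply/eqP; rewrite -leqn0 -d0; exact: leq_deg.
Qed.

Lemma deg1P al : deg al = 1%N -> exists i, al = e1 i.
Proof.
move=> d1; have [i ai|H] := pickP (fun i => al i != 0%N); last first.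
  suff : deg al = 0%N by rewrite d1.
  by rewrite /deg big1// => i _; apply/eqP; rewrite -[_ == _]negbK H.
exists i; apply/ffunP => j; rewrite ffunE; move: d1; rewrite /deg (bigD1 i)//=.
case: eqVneq => [->|ji].
  by case: (al i) ai => // [[|n]] _ //; rewrite addSn => -[].
rewrite (bigD1 j)//=; case: (al i) ai => // n _; rewrite addSn => -[] /eqP.
by rewrite !addn_eq0 => /and3P[_ /eqP].
Qed.

Lemma box_deg1 (V : nmodType) D (G : index -> V) : (0 < D)%N ->
  \sum_(al <- box D | deg al == 1%N) G al = \sum_i G (e1 i).
Proof.
move=> D0; rewrite -big_filter.
rewrite (perm_big [seq e1 i | i <- index_enum 'I_N]) ?big_map//=.
apply: uniq_perm; rewrite ?filter_uniq ?box_uniq//.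
  rewrite map_inj_uniq ?index_enum_uniq// => i j /ffunP /(_ i).
  by rewrite !ffunE eqxx; case: eqVneq.
move=> al; rewrite mem_filter; apply/andP/mapP => [[/eqP/deg1P[i ->] _]|[i _ ->]].
  by exists i => //; rewrite mem_index_enum.
by split; [rewrite deg_e1|apply: deg_box; rewrite deg_e1].
Qed.

Lemma box_prod (F : comNzRingType) D (f : 'I_N -> nat -> F) :
  \sum_(al <- box D) \prod_i f i (al i) = \prod_i \sum_(n < D.+1) f i n.
Proof.
rewrite bigA_distr_bigA /= big_map big_enum /=; apply: eq_bigr => be _.
by apply: eq_bigr => i _; rewrite ffunE.
Qed.

(** For [u <= 1/4], writing [u = (4 u) (1/4)] extracts the factor [(4 u)^k] and
    leaves a product of [N] geometric series of sum at most 2. *)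
Lemma box_geo (F : realFieldType) D k (u : F) : 0 <= u -> u <= 1 / 4 ->
  \sum_(al <- box D | (k <= deg al)%N) u ^+ deg al <= (4 * u) ^+ k * 2 ^+ N.
Proof.
move=> u0 u4; have u40 : 0 <= 4 * u by rewrite mulr_ge0.
have u41 : 4 * u <= 1 by lra.
apply: (@le_trans _ _ (\sum_(al <- box D) (4 * u) ^+ k * (1 / 4) ^+ deg al)).
  rewrite big_mkcond; apply: ler_sum => al _; case: ifP => [kd|_]; last first.
    by rewrite mulr_ge0 ?exprn_ge0// divr_ge0.
  have -> : u = (4 * u) * (1 / 4) by field.
  rewrite exprMn ler_wpM2r ?exprn_ge0 ?divr_ge0//.
  have -> : 4 * ((4 * u) * (1 / 4)) = 4 * u by field.
  exact: ler_wiXn2l.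
rewrite -mulr_sumr ler_wpM2l ?exprn_ge0//.
under eq_bigr do rewrite /deg -prodrXr.
rewrite (@box_prod _ D (fun _ n => (1 / 4 : F) ^+ n)).
apply: (@le_trans _ _ (\prod_(i < N) 2)); last by rewrite prodr_const card_ord.
apply: ler_prod => i _; rewrite sumr_ge0 => [/=|n _]; last by rewrite exprn_ge0 ?divr_ge0.
by apply: geo_half; rewrite ?divr_ge0// ler_pM2l// lef_pV2 ?posrE// ler_nat.
Qed.

End Boxes.

(** * The convolution as a finite sum *)

Lemma lt_of_suml (F : realFieldType) (a b s d e : F) :
  a + b < s + (d + e) -> e <= b -> a < s + d.
Proof. by move=> h1 h2; lra. Qed.

Lemma lt_of_sumr (F : realFieldType) (a b s d e : F) :
  a + b < s + (d + e) -> d <= a -> b < s + e.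
Proof. by move=> h1 h2; lra. Qed.

Lemma two_step (F : realFieldType) (d e : F) : 2 * d <= e -> d <= - d + e.
Proof. by move=> h; lra. Qed.

Lemma gap_le (F : realFieldType) (p q S e : F) : p <= S -> S - e / 2 <= q -> p - q <= e / 2.
Proof. by move=> h1 h2; lra. Qed.

Lemma diff_close (F : realFieldType) (p q S S' e : F) :
  p <= S -> S - e <= p -> q <= S' -> S' - e <= q -> `|p - q - (S - S')| <= e.
Proof. by move=> h1 h2 h3 h4; rewrite ler_norml; apply/andP; split; lra. Qed.

Lemma eighth_quarter (F : realFieldType) (t : F) : 0 <= t -> t / 8 <= t / 4.
Proof. by move=> h; lra. Qed.

Lemma four_eighth (F : realFieldType) (q t : F) : q <= t / 8 -> 4 * q <= 1 / 2 * t.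
Proof. by move=> h; lra. Qed.

Lemma third_sum (F : realFieldType) (p q e : F) : 0 < e ->
  p + q <= e / 3 -> q + e / 3 + p <= e.
Proof. by move=> e0 h; lra. Qed.

Lemma half_pow_small (F : archiRealFieldType) (K e : F) : 0 < e ->
  exists D, K * (1 / 2) ^+ D <= e.
Proof.
move=> e0; have := archi_boundP (divr_ge0 (normr_ge0 K) (ltW e0)).
set D := Num.bound _ => h; exists D.
rewrite expr_div_n expr1n mul1r ler_pdivrMr ?exprn_gt0//.
rewrite (le_trans (ler_norm _))// mulrC -ler_pdivrMr// (le_trans (ltW h))//.
by rewrite -natrX ler_nat ltnW// ltn_expl.
Qed.

Section Semigroup.
Variables (R : realType) (k : nat) (X : set 'rV[R]_k).
Hypothesis X_ge0 : forall x, X x -> forall i, 0 <= x 0 i.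
Hypothesis X_add : forall x y, X x -> X y -> X (x + y).
Hypothesis X0 : X 0.
Hypothesis X_discrete : limit_point X = set0.
Implicit Types (x y z : X) (T : R).

(** The additive length [|x|]; it grades the algebra, and everything below is
    done by truncation with respect to it. *)
Definition wt x : R := l1norm (val x).

Lemma val_ge0 x i : 0 <= val x 0 i.
Proof. by apply: X_ge0; exact: set_mem (valP x). Qed.

Lemma wtE x : wt x = \sum_(i < k) val x 0 i.
Proof. by apply: eq_bigr => i _; rewrite ger0_norm// val_ge0. Qed.

Lemma wt_ge0 x : 0 <= wt x.
Proof. by rewrite wtE sumr_ge0// => i _; exact: val_ge0. Qed.

Lemma coord_le_wt x i : val x 0 i <= wt x.
Proof.
rewrite wtE (bigD1 i)//= lerDl sumr_ge0// => j _; exact: val_ge0.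
Qed.

Definition xadd x y : X :=
  SigSub (mem_set (X_add (set_mem (valP x)) (set_mem (valP y)))).

Lemma val_xadd x y : val (xadd x y) = val x + val y. Proof. by []. Qed.

Lemma wt_xadd x y : wt (xadd x y) = wt x + wt y.
Proof.
by rewrite !wtE -big_split; apply: eq_bigr => i _; rewrite val_xadd mxE.
Qed.

Local Notation origin := (@origin R k X X0).

Lemma wt_origin : wt origin = 0.
Proof. by rewrite wtE big1// => i _; rewrite mxE. Qed.

Lemma wt_eq0 x : wt x = 0 -> x = origin.
Proof.
move=> w0; apply: val_inj; apply/rowP => i; rewrite mxE; apply/eqP.
by rewrite eq_le val_ge0 andbT -w0 coord_le_wt.
Qed.

Lemma xadd0 x : xadd x origin = x.
Proof. by apply: val_inj; rewrite val_xadd addr0. Qed.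

Lemma xadd_eq x y z : (xadd y z == x) = (val y + val z == val x).
Proof. by rewrite -(inj_eq val_inj). Qed.

(** The origin is isolated, so the other elements have length at least some
    [d > 0].  This replaces the gradation by natural numbers of ordinary power
    series: a product of [n] factors without constant term vanishes below
    length [n d]. *)
Lemma min_weight : exists2 d : R, 0 < d & forall x, x != origin -> d <= wt x.
Proof.
have : ~ limit_point X (0 : 'rV[R]_k) by rewrite X_discrete.
move=> /existsNP[U /not_implyP[/nbhs_ballP[e /= e0 eU] H]].
exists e => // x xo; rewrite leNgt; apply/negP => xe; apply: H.
exists (val x); split; [|exact: set_mem (valP x)|].
  by apply: contra_neq xo => v0; exact: val_inj.
apply: eU; split=> // i j; rewrite ord1 mxE /ball /= sub0r normrN ger0_norm ?val_ge0//.
by rewrite (le_lt_trans _ xe)// coord_le_wt.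
Qed.

(** [X] has no cluster point, and a bounded closed subset of [R^k] is compact. *)
Lemma finite_ball T : finite_set [set x : X | wt x <= T].
Proof.
pose K := [set v : 'rV[R]_k | forall i, `[0, T]%classic (v ord0 i)].
have Kc : compact K by apply: (@rV_compact R k (fun=> `[0, T]%classic)) => _; exact: segment_compact.
have Kf : finite_set (K `&` X).
  have iso (p : 'rV[R]_k) : exists U, [/\ open U, U p & forall y : 'rV[R]_k, X y -> U y -> y = p].
    have : ~ limit_point X p by rewrite X_discrete.
    move=> /existsNP[U /not_implyP[Up H]]; exists (U°); split.
    - exact: open_interior.
    - exact: Up.
    - move=> y Xy Uy; apply: contrapT => yp; apply: H; exists y; split=> //.
        by apply/eqP.
      exact: interior_subset Uy.
  have [f fP] := choice iso.
  have : cover_compact K by rewrite -compact_cover.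
  move=> /(_ _ setT f) [].
  - by move=> p _; have [] := fP p.
  - by move=> p _; exists p => //; have [] := fP p.
  move=> D _ KD; have DF := finite_fset D; apply: sub_finite_set DF.
  by move=> y [/KD[p pD fy] Xy]; have [_ _ /(_ y Xy fy) ->] := fP p.
have -> : [set x : X | wt x <= T] = val @^-1` [set v | l1norm v <= T /\ X v].
  by apply/seteqP; split=> x /=; [split=> //; exact: set_mem (valP x)|case].
apply: finite_preimage; first by move=> x y _ _; exact: val_inj.
apply: sub_finite_set Kf => v [vT Xv]; split=> // i.
rewrite /= in_itv /= X_ge0//= (le_trans _ vT)//.
by rewrite -[v]/(val (SigSub (mem_set Xv) : X)) coord_le_wt.
Qed.

Definition FB T : {fset X} := fset_set [set x : X | wt x <= T].

Lemma in_FB T x : (x \in FB T) = (wt x <= T).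
Proof.
rewrite in_fset_set; last exact: finite_ball.
by apply/idP/idP => [/set_mem|wT] //; exact: mem_set.
Qed.

Local Notation C := (cplx R).
Local Notation A := (X -> C).

Lemma FB_uniq T : uniq (FB T).
Proof. exact: fset_uniq. Qed.

Lemma wt_summand x y z : xadd y z = x -> wt y <= wt x /\ wt z <= wt x.
Proof. by move=> <-; rewrite wt_xadd lerDl lerDr !wt_ge0. Qed.

(** Both summands of [x] have length at most [wt x], so any ball that contains [x]
    contains all contributing pairs. *)
Lemma dconvE T (g h : A) x : wt x <= T ->
  dconv g h x = \sum_(y <- FB T) \sum_(z <- FB T | xadd y z == x) g y * h z.
Proof.
move=> xT; rewrite /dconv.
pose r := [seq p <- [seq (y, z) | y <- FB T, z <- FB T] | xadd p.1 p.2 == x].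
rewrite (fsbigE r); first last.
- move=> [y z] /= yz; rewrite mem_filter /= xadd_eq yz eqxx /= => /negP[].
  have /eqP/wt_summand[yx zx] : xadd y z == x by rewrite xadd_eq yz.
  by apply/allpairsP; exists (y, z); rewrite !in_FB !(le_trans _ xT).
- by move=> [y z]; rewrite /= mem_filter /= xadd_eq => /andP[/eqP].
- rewrite filter_uniq// allpairs_uniq ?FB_uniq//.
  by move=> [y z] [y' z'] _ _ /= [-> ->].
rewrite big_filter_cond big_mkcond big_allpairs_dep; apply: eq_bigr => y _.
rewrite [RHS]big_mkcond; apply: eq_bigr => z _ /=.
case: ifP => [/andP[-> //]|]; case: ifP => // yz /negP[].
by apply: mem_set; move: yz; rewrite xadd_eq => /eqP.
Qed.

(** Fubini's theorem for the addition map; it turns truncated sums of a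
    convolution into truncated double sums. *)
Lemma sum_fibres (S : pzSemiRingType) T (phi : X -> S) (G : X -> X -> S) :
  \sum_(x <- FB T) phi x * (\sum_(y <- FB T) \sum_(z <- FB T | xadd y z == x) G y z)
  = \sum_(y <- FB T) \sum_(z <- FB T | wt (xadd y z) <= T) phi (xadd y z) * G y z.
Proof.
under eq_bigr do rewrite mulr_sumr.
rewrite exchange_big; apply: eq_bigr => y _.
under eq_bigr do rewrite mulr_sumr.
rewrite (exchange_big_dep xpredT)//= [RHS]big_mkcond; apply: eq_bigr => z _.
case: ifP => yz; last first.
  rewrite big_seq_cond big1// => x /andP[]; rewrite in_FB => xT /eqP E.
  by rewrite E xT in yz.
rewrite big_mkcond (bigD1_seq (xadd y z)) ?in_FB ?FB_uniq//= eqxx big1 ?addr0//.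
by move=> x; rewrite eq_sym => /negPf ->.
Qed.

Local Notation dunit := (@dunit R k X).
Local Notation center := (center_part X0).

Lemma dunit_origin : dunit origin = 1.
Proof. by rewrite /Defs.dunit /= eqxx. Qed.

Lemma dunit_neq x : x != origin -> dunit x = 0.
Proof.
move=> xo; rewrite /Defs.dunit; case: eqP => // v0.
by move: xo; rewrite -(inj_eq val_inj) /= v0 eqxx.
Qed.

Lemma center_origin (g : A) : center g origin = 0.
Proof. by rewrite /center_part dunit_origin mulr1 subrr. Qed.

Lemma center_neq (g : A) x : x != origin -> center g x = g x.
Proof. by move=> xo; rewrite /center_part dunit_neq// mulr0 subr0. Qed.

Lemma dconv_unitr (g : A) : dconv g dunit = g.
Proof.
apply/funext => x; rewrite (@dconvE (wt x))//.
rewrite (bigD1_seq x) ?FB_uniq ?in_FB//= big_mkcond (bigD1_seq origin) ?FB_uniq ?in_FB ?wt_origin ?wt_ge0//=.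
rewrite xadd0 eqxx dunit_origin mulr1 big1 ?addr0; last first.
  by move=> z zo; case: ifP => // _; rewrite dunit_neq// mulr0.
rewrite big1 ?addr0// => y yx; rewrite big1// => z /eqP E.
rewrite dunit_neq ?mulr0//; apply: contra_neq yx => zo.
by rewrite zo xadd0 in E.
Qed.

Lemma xaddC y z : xadd y z = xadd z y.
Proof. by apply: val_inj; rewrite !val_xadd addrC. Qed.

Lemma dconvC (g h : A) : dconv g h = dconv h g.
Proof.
apply/funext => x; rewrite !(@dconvE (wt x))//.
under eq_bigr do rewrite big_mkcond; rewrite exchange_big.
apply: eq_bigr => y _; rewrite [RHS]big_mkcond; apply: eq_bigr => z _.
by rewrite xaddC mulrC.
Qed.

Lemma dconv_unitl (g : A) : dconv dunit g = g.
Proof. by rewrite dconvC dconv_unitr. Qed.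

Lemma monomial_uniform (I : eqType) (l : seq I) (f : I -> A) (al : I -> nat) :
  (forall i, i \in l -> al i = 0%N) ->
  \big[@dconv R k X/dunit]_(i <- l) dpow (f i) (al i) = dunit.
Proof.
elim: l => [|i l IH] H; first by rewrite big_nil.
rewrite big_cons H ?mem_head//= dconv_unitl IH// => j jl.
by apply: H; rewrite inE jl orbT.
Qed.

Lemma monomial_single (I : eqType) (l : seq I) (f : I -> A) (al : I -> nat) i :
  uniq l -> i \in l -> al i = 1%N -> (forall j, j != i -> al j = 0%N) ->
  \big[@dconv R k X/dunit]_(j <- l) dpow (f j) (al j) = f i.
Proof.
move=> + + ai aj; elim: l => //= j l IH /andP[jl ul]; rewrite inE big_cons.
have [E _|ij /= il] := eqVneq i j.
  rewrite -E in jl *; rewrite ai /dpow /= dconv_unitr monomial_uniform ?dconv_unitr//.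
  by move=> m ml; apply: aj; apply: contraNneq jl => <-.
by rewrite aj ?dconv_unitl ?IH// eq_sym.
Qed.

(** * Locality of monomials in the convolution algebra *)

Section Orders.
Variables (delta : R).
Hypothesis delta_le : forall x, x != origin -> delta <= wt x.

(** [g] and [g'] both vanish below length [d delta], and they agree below
    length [s + d delta].  The shift by [d delta] is what makes this relation
    multiplicative: a product of [d] factors without constant term only
    involves values at lengths smaller by [(d - 1) delta]. *)
Definition agree (d : nat) (s : R) (g g' : A) := forall x,
  (wt x < d%:R * delta -> g x = 0 /\ g' x = 0) /\
  (wt x < s + d%:R * delta -> g x = g' x).

Lemma agree_unit s : agree 0 s dunit dunit.
Proof. by move=> x; split=> //; rewrite mul0r ltNge wt_ge0. Qed.

Lemma agree_conv d e s g g' h h' : agree d s g g' -> agree e s h h' ->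
  agree (d + e) s (dconv g h) (dconv g' h').
Proof.
move=> gg' hh' x; rewrite !(@dconvE (wt x))// natrD mulrDl; split=> xd.
  have small y z : xadd y z == x -> wt y < d%:R * delta \/ wt z < e%:R * delta.
    move=> /eqP E; have [|yd] := ltP (wt y) (d%:R * delta); first by left.
    by right; rewrite -(ltrD2l (wt y)) -wt_xadd E (lt_le_trans xd)// lerD2r.
  by split; rewrite big1// => y _; rewrite big1// => z /small[yd|ze];
    by [have [[//|-> ->] _] := gg' y; rewrite mul0r
       |have [[//|-> ->] _] := hh' z; rewrite mulr0].
apply: eq_bigr => y _; apply: eq_bigr => z /eqP E.
have [gy1 gy2] := gg' y; have [hz1 hz2] := hh' z.
have [/gy1[-> ->]|yd] := ltP (wt y) (d%:R * delta); first by rewrite !mul0r.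
have [/hz1[-> ->]|ze] := ltP (wt z) (e%:R * delta); first by rewrite !mulr0.
have W : wt y + wt z = wt x by rewrite -wt_xadd E.
rewrite -W in xd; rewrite gy2 ?hz2//; first exact: lt_of_sumr xd yd.
exact: lt_of_suml xd ze.
Qed.

Lemma agree_pow d s g g' n : agree d s g g' -> agree (d * n) s (dpow g n) (dpow g' n).
Proof.
move=> gg'; elim: n => [|n IH]; first by rewrite muln0; exact: agree_unit.
by rewrite mulnS; exact: agree_conv.
Qed.

Lemma agree_center s (g g' : A) : g origin = g' origin ->
  (forall x, wt x < s + delta -> g x = g' x) -> agree 1 s (center g) (center g').
Proof.
move=> g0 gg' x; rewrite mul1r; split=> xs; last by rewrite /center_part g0 gg'.
have [->|xo] := eqVneq x origin; first by rewrite !center_origin.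
by rewrite ltNge delta_le in xs.
Qed.

Lemma agree_monomial (I : Type) (l : seq I) s (f f' : I -> A) (al : I -> nat) :
  (forall i, agree 1 s (f i) (f' i)) ->
  agree (\sum_(i <- l) al i)%N s
    (\big[@dconv R k X/dunit]_(i <- l) dpow (f i) (al i))
    (\big[@dconv R k X/dunit]_(i <- l) dpow (f' i) (al i)).
Proof.
move=> H; elim: l => [|i l IH]; first by rewrite !big_nil; exact: agree_unit.
rewrite !big_cons; apply: agree_conv IH; rewrite -[X in agree X]mul1n.
exact: agree_pow.
Qed.

End Orders.

Lemma FB_le (V : nmodType) T T' (f : X -> V) : T <= T' ->
  \sum_(x <- FB T') (if wt x <= T then f x else 0) = \sum_(x <- FB T) f x.
Proof.
move=> TT'; rewrite -big_mkcond -big_filter; apply: perm_big.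
apply: uniq_perm; rewrite ?filter_uniq ?FB_uniq// => x.
rewrite mem_filter !in_FB; have [xT|//] := leP (wt x) T.
by rewrite (le_trans xT TT').
Qed.

Lemma FB_sum_le T T' (f : X -> R) : (forall x, 0 <= f x) -> T <= T' ->
  \sum_(x <- FB T) f x <= \sum_(x <- FB T') f x.
Proof.
move=> f0 TT'; rewrite -(FB_le f TT'); apply: ler_sum => x _.
by case: ifP.
Qed.

(** * Truncated weighted norms *)

Section Norm.
Variable w : X -> R.
Hypothesis w_ge0 : forall x, 0 <= w x.
Hypothesis w_xadd : forall y z, w (xadd y z) = w y * w z.
Hypothesis w_origin : w origin = 1.

(** A norm truncated to elements of length at most [T].  It is a finite sum, so
    it is defined and submultiplicative on the whole algebra, and membership in
    a weighted [l^1] space is a bound that is uniform in [T]. *)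
Definition nm T (g : A) : R := \sum_(x <- FB T) cabs (g x) * w x.

Lemma nm_ge0 T g : 0 <= nm T g.
Proof. by apply: sumr_ge0 => x _; rewrite mulr_ge0// cabs_ge0. Qed.

Lemma nm_le T T' g : T <= T' -> nm T g <= nm T' g.
Proof. by apply: FB_sum_le => x; rewrite mulr_ge0// cabs_ge0. Qed.

Lemma eq_nm T (g h : A) : (forall x, wt x <= T -> g x = h x) -> nm T g = nm T h.
Proof.
by move=> gh; rewrite /nm big_seq [RHS]big_seq; apply: eq_bigr => x;
  rewrite in_FB => /gh ->.
Qed.

Lemma nm_conv T (g h : A) : nm T (dconv g h) <= nm T g * nm T h.
Proof.
pose G y z := cabs (g y) * cabs (h z).
apply: (@le_trans _ _ (\sum_(x <- FB T) w x *
    (\sum_(y <- FB T) \sum_(z <- FB T | xadd y z == x) G y z))).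
  rewrite /nm big_seq [leRHS]big_seq; apply: ler_sum => x; rewrite in_FB => xT.
  rewrite (dconvE _ _ xT) mulrC ler_wpM2l//.
  apply: le_trans (cabs_sum _ _ _) _; apply: ler_sum => y _.
  by apply: le_trans (cabs_sum _ _ _) _; apply: ler_sum => z _; rewrite cabsM.
rewrite sum_fibres /nm mulr_suml; apply: ler_sum => y _.
rewrite mulr_sumr big_mkcond; apply: ler_sum => z _.
case: ifP => _; first by rewrite w_xadd /G mulrC mulrACA.
by rewrite !mulr_ge0// cabs_ge0.
Qed.

Lemma nm_unit T : nm T dunit <= 1.
Proof.
have [T0|T0] := leP 0 T.
  rewrite /nm (bigD1_seq origin) ?in_FB ?FB_uniq ?wt_origin//= dunit_origin cabs1 w_origin.
  by rewrite mulr1 big1 ?addr0// => x xo; rewrite dunit_neq// cabs0 mul0r.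
rewrite /nm big_seq big1// => x; rewrite in_FB => xT.
by have := lt_le_trans T0 (le_trans (wt_ge0 x) xT); rewrite ltxx.
Qed.

Lemma nm_pow T g n : nm T (dpow g n) <= nm T g ^+ n.
Proof.
elim: n => [|n IH]; first by rewrite expr0 nm_unit.
rewrite exprS; apply: le_trans (nm_conv _ _ _) _.
by rewrite ler_wpM2l// nm_ge0.
Qed.

Lemma nm_monomial (I : Type) (l : seq I) T (f : I -> A) (al : I -> nat) :
  nm T (\big[@dconv R k X/dunit]_(i <- l) dpow (f i) (al i))
  <= \prod_(i <- l) nm T (f i) ^+ al i.
Proof.
elim: l => [|i l IH]; first by rewrite !big_nil nm_unit.
rewrite !big_cons; apply: le_trans (nm_conv _ _ _) _.
by rewrite ler_pM ?nm_ge0// nm_pow.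
Qed.

Lemma nmD T g h : nm T (fun x => g x + h x) <= nm T g + nm T h.
Proof.
rewrite /nm -big_split; apply: ler_sum => x _.
by rewrite /= -mulrDl ler_wpM2r// cabsD.
Qed.

Lemma nm_sum (I : Type) (l : seq I) (P : pred I) T (f : I -> A) :
  nm T (fun x => \sum_(i <- l | P i) f i x) <= \sum_(i <- l | P i) nm T (f i).
Proof.
elim: l => [|i l IH].
  rewrite big_nil /nm big1// => x _; by rewrite big_nil cabs0 mul0r.
rewrite big_cons; case: ifP => Pi; last first.
  by apply: le_trans IH; apply: le_of_eq; apply: eq_nm => x _; rewrite big_cons Pi.
rewrite (@eq_nm _ _ (fun x => f i x + \sum_(j <- l | P j) f j x)); last first.
  by move=> x _; rewrite big_cons Pi.
by apply: le_trans (nmD _ _ _) _; rewrite lerD2l.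
Qed.

Lemma nmZ T (c : C) g : nm T (fun x => c * g x) = cabs c * nm T g.
Proof. by rewrite /nm mulr_sumr; apply: eq_bigr => x _; rewrite cabsM mulrA. Qed.

Variable chi : X -> C.
Hypothesis chi_xadd : forall y z, chi (xadd y z) = chi y * chi z.
Hypothesis chi_le : forall x, cabs (chi x) <= w x.

(** The value at the multiplicative function [chi], truncated at length [T]; for
    [chi x = exp(- x s)] these are the partial sums of the Dirichlet series. *)
Definition psum T (g : A) : C := \sum_(x <- FB T) g x * chi x.

Lemma psum_le T g : cabs (psum T g) <= nm T g.
Proof.
apply: le_trans (cabs_sum _ _ _) _; apply: ler_sum => x _.
by rewrite cabsM ler_wpM2l ?cabs_ge0.
Qed.

(** Only pairs [(y, z)] of total length more than [T] contribute to the
    difference, and then [y] or [z] has length more than [T / 2]; so the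
    difference is bounded by the increase of a bounded monotone function of [T]
    between [T / 2] and [T]. *)
Lemma psum_conv T g h : 0 <= T ->
  cabs (psum T g * psum T h - psum T (dconv g h))
    <= nm T g * nm T h - nm (T / 2) g * nm (T / 2) h.
Proof.
move=> T0; have T2 : T / 2 <= T by rewrite ler_pdivrMr// ler_peMr// ler1n.
have -> : psum T (dconv g h) = \sum_(y <- FB T) \sum_(z <- FB T)
    (if wt (xadd y z) <= T then chi (xadd y z) * (g y * h z) else 0).
  rewrite /psum big_seq.
  rewrite (eq_bigr (fun x => chi x * (\sum_(y <- FB T) \sum_(z <- FB T | xadd y z == x) g y * h z))).
    rewrite -big_seq sum_fibres; apply: eq_bigr => y _.
    by rewrite big_mkcond.
  by move=> x; rewrite in_FB => xT; rewrite (dconvE _ _ xT) mulrC.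
rewrite {1 2}/psum mulr_suml -sumrB.
rewrite /nm -!(FB_le _ T2) !mulr_suml -sumrB.
apply: le_trans (cabs_sum _ _ _) _; apply: ler_sum => y _.
rewrite !mulr_sumr -!sumrB.
apply: le_trans (cabs_sum _ _ _) _; apply: ler_sum => z _.
rewrite wt_xadd chi_xadd.
have P0 : 0 <= cabs (g y) * w y * (cabs (h z) * w z) by rewrite !mulr_ge0// cabs_ge0.
case: ifP => yzT.
  rewrite (_ : _ - _ = 0) ?cabs0; last by rewrite mulrACA [chi y * _ * _]mulrC subrr.
  rewrite subr_ge0; case: ifP => _; last by rewrite mul0r.
  by case: ifP => _//; rewrite mulr0.
have -> : (if wt y <= T / 2 then cabs (g y) * w y else 0) *
    (if wt z <= T / 2 then cabs (h z) * w z else 0) = 0.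
  case: ifP => y2; last by rewrite mul0r.
  case: ifP => z2; last by rewrite mulr0.
  by rewrite (splitr T) (lerD y2 z2) in yzT.
rewrite !subr0 mulrACA [leRHS]mulrACA cabsM cabsM ler_wpM2l ?mulr_ge0 ?cabs_ge0//.
by rewrite cabsM ler_pM ?cabs_ge0.
Qed.

End Norm.

(** * Power series in elements of the algebra *)

Section Functional.
Variables (N : nat) (delta : R).
Hypothesis delta_gt0 : 0 < delta.
Hypothesis delta_le : forall x, x != origin -> delta <= wt x.
Local Notation index := {ffun 'I_N -> nat}.
Implicit Types (b : 'rV[A]_N) (al : index) (c : index -> C).

Lemma mon_agree s b b' al : (forall i, b 0 i origin = b' 0 i origin) ->
  (forall i x, wt x < s + delta -> b 0 i x = b' 0 i x) ->
  agree delta (deg al) s (dmonomial X0 b al) (dmonomial X0 b' al).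
Proof.
move=> b0 bb'; rewrite /dmonomial /deg; apply: agree_monomial => i.
by apply: agree_center => //; exact: bb'.
Qed.

Lemma mon_small b al x : wt x < (deg al)%:R * delta -> dmonomial X0 b al x = 0.
Proof.
by move=> xs; have [/(_ xs)[]] := @mon_agree 0 b b al (fun=> erefl) (fun _ _ _ => erefl) x.
Qed.

Lemma mon_deg0 b : dmonomial X0 b [ffun=> 0%N] = dunit.
Proof. by apply: monomial_uniform => i _; rewrite ffunE. Qed.

Lemma mon_e1 b i : dmonomial X0 b (e1 i) = center (b 0 i).
Proof.
apply: (monomial_single (fun i => center (b 0 i))).
- exact: index_enum_uniq.
- exact: mem_index_enum.
- by rewrite ffunE eqxx.
- by move=> j ji; rewrite ffunE (negPf ji).
Qed.

Lemma mon_origin b al : (0 < deg al)%N -> dmonomial X0 b al origin = 0.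
Proof. by move=> d0; apply: mon_small; rewrite wt_origin mulr_gt0// ltr0n. Qed.

(** The functional calculus with arbitrary coefficients [c] in place of Taylor
    coefficients: the algebraic part of the argument needs only these. *)
Definition Phi c b : A := fun x =>
  \sum_(al \in [set: index]) c al * dmonomial X0 b al x.

Lemma PhiE c b D x : wt x < D.+1%:R * delta ->
  Phi c b x = \sum_(al <- box N D) c al * dmonomial X0 b al x.
Proof.
move=> xD; rewrite /Phi (fsbigE (box N D)) ?box_uniq//.
  by apply: eq_bigl => al; rewrite in_setT.
move=> al _ /mem_boxP aD; rewrite mon_small ?mulr0//.
apply: lt_le_trans xD _; rewrite ler_wpM2r ?(ltW delta_gt0)// ler_nat.
by rewrite ltnNge; apply/negP => da; apply: aD => i; exact: leq_trans (leq_deg al i) da.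
Qed.

Lemma big_degs D (G : index -> C) : (0 < D)%N ->
  \sum_(al <- box N D) G al = G [ffun=> 0%N] + \sum_i G (e1 i) +
    \sum_(al <- box N D | (2 <= deg al)%N) G al.
Proof.
move=> D0; rewrite (bigID (fun al => deg al <= 1)%N)/=; congr (_ + _); last first.
  by apply: eq_bigl => al; rewrite -ltnNge.
rewrite (bigID (fun al => deg al == 0)%N)/=; congr (_ + _).
  rewrite (eq_bigl (fun al => al == [ffun=> 0%N])); last first.
    by move=> al; rewrite -deg0; case: (deg al) => [|[]].
  rewrite big_mkcond (bigD1_seq [ffun=> 0%N]) ?box_uniq//=; last first.
    by apply: deg_box; have := @deg0 N [ffun=> 0%N]; rewrite eqxx => /eqP ->.
  by rewrite eqxx big1 ?addr0// => al /negPf ->.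
rewrite -(box_deg1 G D0); apply: eq_bigl => al.
by case: (deg al) => [|[]].
Qed.

(** Away from the origin the linear part involves the values of [b] themselves,
    since the constant terms are only removed at the origin. *)
Lemma Phi_split c b D x : (0 < D)%N -> x != origin -> wt x < D.+1%:R * delta ->
  Phi c b x = \sum_i c (e1 i) * b 0 i x +
    \sum_(al <- box N D | (2 <= deg al)%N) c al * dmonomial X0 b al x.
Proof.
move=> D0 xo xD; rewrite (PhiE _ _ xD) big_degs// mon_deg0 dunit_neq// mulr0 add0r.
by congr (_ + _); apply: eq_bigr => i _; rewrite mon_e1 center_neq.
Qed.

Lemma Phi_origin c b : Phi c b origin = c [ffun=> 0%N].
Proof.
rewrite (@PhiE _ _ 1); last by rewrite wt_origin mulr_gt0.
rewrite big_degs// mon_deg0 dunit_origin mulr1 !big1 ?addr0// => [al d2|i _].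
  by rewrite mon_origin ?mulr0//; exact: ltnW.
by rewrite mon_e1 center_origin mulr0.
Qed.

Lemma exists_box T : exists2 D, (0 < D)%N & forall x, wt x <= T -> wt x < D.+1%:R * delta.
Proof.
exists (Num.bound (`|T| / delta)).+1 => // x xT.
have h := archi_boundP (divr_ge0 (normr_ge0 T) (ltW delta_gt0)).
rewrite (le_lt_trans (le_trans xT (ler_norm _)))//.
rewrite -ltr_pdivrMr// (lt_le_trans h)// ler_nat. exact: (leqW (leqnSn _)).
Qed.

(** Changing [b] at lengths at least [s + delta] changes the monomials of degree
    at least 2 only at lengths at least [s + 2 delta], where another factor of
    length at least [delta] comes in; below that only the linear part sees the
    change. *)
Lemma Phi_local c b b' s x : x != origin ->
  (forall i, b 0 i origin = b' 0 i origin) ->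
  (forall i x, wt x < s + delta -> b 0 i x = b' 0 i x) ->
  wt x < s + 2 * delta ->
  Phi c b x - Phi c b' x = \sum_i c (e1 i) * (b 0 i x - b' 0 i x).
Proof.
move=> xo b0 bb' xs; have [D D0 /(_ x (lexx _)) xD] := exists_box (wt x).
rewrite !(Phi_split _ _ D0 xo xD).
have -> : \sum_(al <- box N D | (2 <= deg al)%N) c al * dmonomial X0 b al x =
    \sum_(al <- box N D | (2 <= deg al)%N) c al * dmonomial X0 b' al x.
  apply: eq_bigr => al d2; congr (_ * _).
  have [_] := mon_agree al b0 bb' x; apply; apply: lt_le_trans xs _.
  by rewrite lerD2l ler_wpM2r ?(ltW delta_gt0)// ler_nat.
rewrite opprD addrACA subrr addr0 -sumrB; apply: eq_bigr => i _.
by rewrite mulrBr.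
Qed.

(** Banach's fixed point theorem for the ultrametric of agreement up to a given
    length: every application of [F] gains a length [delta]. *)
Lemma contraction_fixpoint (E : Type) (e0 : E) (F : (X -> E) -> X -> E) :
  (forall (n : nat) g g', (forall x, wt x < n%:R * delta -> g x = g' x) ->
     forall x, wt x < n.+1%:R * delta -> F g x = F g' x) ->
  (exists g, F g = g) /\ (forall g g', F g = g -> F g' = g' -> g = g').
Proof.
move=> Fc.
have reach x : exists n : nat, wt x < n%:R * delta.
  by have [D _ /(_ x (lexx _)) xD] := exists_box (wt x); exists D.+1.
split; last first.
  move=> g g' Fg Fg'; apply/funext => x; have [n xn] := reach x.
  elim: n x xn => [|n IH] x; first by rewrite mul0r ltNge wt_ge0.
  by move=> xn; rewrite -Fg -Fg'; apply: Fc xn.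
pose it n := iter n F (fun=> e0).
have itS n x : wt x < n%:R * delta -> it n.+1 x = it n x.
  elim: n x => [|n IH] x; first by rewrite mul0r ltNge wt_ge0.
  exact: (Fc n (it n.+1) (it n)).
have itD n p x : wt x < n%:R * delta -> it (p + n)%N x = it n x.
  move=> xn; elim: p => // p IH; rewrite addSn itS// (lt_le_trans xn)//.
  by rewrite ler_wpM2r ?(ltW delta_gt0)// ler_nat leq_addl.
have [h hP] := choice reach.
pose g x := it (h x) x.
have gE n x : wt x < n%:R * delta -> g x = it n x.
  move=> xn; have [hn|nh] := leqP (h x) n.
    by rewrite -(subnK hn) itD// hP.
  by rewrite /g -(subnK (ltnW nh)) itD.
exists g; apply/funext => x; have xh := hP x.
rewrite (Fc (h x) g (it (h x)))//; first exact: itS xh.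
  by move=> y; exact: gE.
by rewrite (lt_le_trans xh)// ler_wpM2r ?(ltW delta_gt0)// ler_nat.
Qed.

End Functional.

(** * Limits of truncated sums *)

Definition tends (u : R -> C) (L : C) := forall e : R, 0 < e ->
  exists T0, forall T, T0 <= T -> cabs (u T - L) <= e.

Lemma tends_ext (u v : R -> C) L : (exists T0, forall T, T0 <= T -> u T = v T) ->
  tends u L -> tends v L.
Proof.
move=> [T1 uv] uL e /uL[T0 H]; exists (Num.max T0 T1) => T.
by rewrite ge_max => /andP[h1 h2]; rewrite -uv ?H.
Qed.

Lemma tends_cst L : tends (fun=> L) L.
Proof. by move=> e e0; exists 0 => T _; rewrite subrr cabs0 ltW. Qed.

Lemma tendsD u v L L' : tends u L -> tends v L' ->
  tends (fun T => u T + v T) (L + L').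
Proof.
move=> uL vL e e0; have e2 : 0 < e / 2 by rewrite divr_gt0.
have [T0 h0] := uL _ e2; have [T1 h1] := vL _ e2.
exists (Num.max T0 T1) => T; rewrite ge_max => /andP[TT0 TT1].
by rewrite opprD addrACA (le_trans (cabsD _ _))// (splitr e) lerD ?h0 ?h1.
Qed.

Lemma tendsZ (k0 : C) u L : tends u L -> tends (fun T => k0 * u T) (k0 * L).
Proof.
move=> uL e e0; have k1 : 0 < 1 + cabs k0 by rewrite ltr_wpDr ?cabs_ge0.
have [T0 h] := uL _ (divr_gt0 e0 k1); exists T0 => T /h H.
rewrite -mulrBr cabsM; apply: le_trans (ler_wpM2l (cabs_ge0 k0) H) _.
by rewrite mulrCA ler_piMr ?(ltW e0)// ler_pdivrMr// mul1r lerDr.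
Qed.

Lemma tends_sum (I : Type) (l : seq I) (u : I -> R -> C) (L : I -> C) :
  (forall i, tends (u i) (L i)) ->
  tends (fun T => \sum_(i <- l) u i T) (\sum_(i <- l) L i).
Proof.
move=> uL; elim: l => [|i l IH].
  rewrite big_nil; apply: tends_ext (tends_cst 0); exists 0 => T _.
  by rewrite big_nil.
rewrite big_cons; apply: tends_ext (tendsD (uL i) IH); exists 0 => T _.
by rewrite big_cons.
Qed.

Lemma tends_unique u L L' : tends u L -> tends u L' -> L = L'.
Proof.
move=> uL uL'; apply/eqP; rewrite -subr_eq0; apply/eqP; apply: cabs_small => e e0.
have e2 : 0 < e / 2 by rewrite divr_gt0.
have [T0 h0] := uL _ e2; have [T1 h1] := uL' _ e2.
have := h0 (Num.max T0 T1) (ltac:(by rewrite le_max lexx)).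
have := h1 (Num.max T0 T1) (ltac:(by rewrite le_max lexx orbT)).
set v := u _ => a1 a0; have -> : L - L' = (v - L') - (v - L) by ring.
by rewrite (le_trans (cabsB _ _))// (splitr e) lerD.
Qed.

Lemma tendsM u v L L' B : (forall T, cabs (u T) <= B) -> tends u L -> tends v L' ->
  tends (fun T => u T * v T) (L * L').
Proof.
move=> uB uL vL e e0.
have B0 : 0 <= B by apply: le_trans (cabs_ge0 _) (uB 0).
have B1 : 0 < 1 + B by rewrite ltr_wpDr.
have L1 : 0 < 1 + cabs L' by rewrite ltr_wpDr ?cabs_ge0.
have e2 : 0 < e / 2 by rewrite divr_gt0.
have [T0 h0] := uL _ (divr_gt0 e2 L1); have [T1 h1] := vL _ (divr_gt0 e2 B1).
exists (Num.max T0 T1) => T; rewrite ge_max => /andP[/h0 H0 /h1 H1].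
rewrite (_ : _ - _ = u T * (v T - L') + L' * (u T - L)); last by ring.
rewrite (le_trans (cabsD _ _))// (splitr e) !cabsM lerD//.
  apply: le_trans (ler_pM (cabs_ge0 _) (cabs_ge0 _) (uB T) H1) _.
  by rewrite mulrCA ler_piMr ?(ltW e2)// ler_pdivrMr// mul1r lerDr.
apply: le_trans (ler_wpM2l (cabs_ge0 _) H0) _.
by rewrite mulrCA ler_piMr ?(ltW e2)// ler_pdivrMr// mul1r lerDr.
Qed.

Lemma mono_gap (f : R -> R) B : (forall T T', T <= T' -> f T <= f T') ->
  (forall T, f T <= B) -> exists2 S, (forall T, f T <= S) &
  forall e, 0 < e -> exists T0, forall T, T0 <= T -> S - e <= f T.
Proof.
move=> fm fB; have hs : has_sup (range f).
  by split; [exists (f 0), 0|exists B => _ [T _ <-]].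
exists (sup (range f)) => [T|e e0].
  by apply: sup_upper_bound => //; exists T.
have [_ [T0 _ <-] h] := sup_adherent e0 hs.
by exists T0 => T /fm; apply: le_trans; exact: ltW.
Qed.

Section Limits.
Variables (w : X -> R) (chi : X -> C).
Hypothesis w_ge0 : forall x, 0 <= w x.
Hypothesis w_xadd : forall y z, w (xadd y z) = w y * w z.
Hypothesis w_origin : w origin = 1.
Hypothesis chi_xadd : forall y z, chi (xadd y z) = chi y * chi z.
Hypothesis chi_le : forall x, cabs (chi x) <= w x.
Hypothesis chi_origin : chi origin = 1.

(** Finiteness of the weighted [l^1] norm. *)
Definition bnd (g : A) := exists B, forall T, nm w T g <= B.

Lemma bnd_conv g h : bnd g -> bnd h -> bnd (dconv g h).
Proof.
move=> [B gB] [B' hB]; exists (B * B') => T.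
by apply: (le_trans (nm_conv w_ge0 w_xadd _ _ _)); rewrite ler_pM ?nm_ge0.
Qed.

Lemma bnd_unit : bnd dunit.
Proof. by exists 1 => T; exact: nm_unit. Qed.

Lemma bndD g h : bnd g -> bnd h -> bnd (fun x => g x + h x).
Proof.
move=> [B gB] [B' hB]; exists (B + B') => T.
by apply: (le_trans (nmD w_ge0 _ _ _)); rewrite lerD.
Qed.

Lemma bndZ (k0 : C) g : bnd g -> bnd (fun x => k0 * g x).
Proof.
by move=> [B gB]; exists (cabs k0 * B) => T; rewrite nmZ ler_wpM2l ?cabs_ge0.
Qed.

Lemma bnd_center g : bnd g -> bnd (center g).
Proof.
move=> gb; have := bndD gb (bndZ (- g origin) bnd_unit).
move=> [B H]; exists B => T; rewrite (eq_nm w (h := fun x => g x + - g origin * dunit x))//.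
by move=> x _; rewrite /center_part mulNr.
Qed.

Lemma tends_conv g h L L' : bnd g -> bnd h -> tends (psum chi ^~ g) L ->
  tends (psum chi ^~ h) L' -> tends (psum chi ^~ (dconv g h)) (L * L').
Proof.
move=> [B gB] [B' hB] gL hL.
have uB T : cabs (psum chi T g) <= B.
  by apply: (le_trans (psum_le chi_le _ _)).
have P := tendsM uB gL hL => e e0; have e2 : 0 < e / 2 by rewrite divr_gt0.
have [T0 H0] := P _ e2.
have fm T T' : T <= T' -> nm w T g * nm w T h <= nm w T' g * nm w T' h.
  by move=> TT'; rewrite ler_pM ?nm_ge0 ?nm_le.
have fB T : nm w T g * nm w T h <= B * B' by rewrite ler_pM ?nm_ge0.
have [S S1 S2] := mono_gap fm fB; have [T1 H1] := S2 _ e2.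
exists (Num.max T0 (Num.max (2 * T1) 0)) => T; rewrite !ge_max => /and3P[h0 h1 h2].
have TT1 : T1 <= T / 2 by rewrite ler_pdivlMr// mulrC.
rewrite -[_ - _](subrKA (psum chi T g * psum chi T h)) addrC (splitr e).
rewrite (le_trans (cabsD _ _))// lerD ?H0// cabsC.
apply: (le_trans (psum_conv w_ge0 chi_xadd chi_le _ _ h2)).
have := H1 _ TT1; have := S1 T; set p := _ * _; set q := _ * _ => a1 a2.
exact: gap_le a1 a2.
Qed.

Lemma tends_unit : tends (psum chi ^~ dunit) 1.
Proof.
apply: tends_ext (tends_cst 1); exists 0 => T T0.
rewrite /psum (bigD1_seq origin) ?in_FB ?FB_uniq ?wt_origin//= dunit_origin chi_origin.
by rewrite mulr1 big1 ?addr0// => x xo; rewrite dunit_neq// mul0r.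
Qed.

Lemma tends_pow g L n : bnd g -> tends (psum chi ^~ g) L ->
  bnd (dpow g n) /\ tends (psum chi ^~ (dpow g n)) (L ^+ n).
Proof.
move=> gb gL; elim: n => [|n [IH1 IH2]].
  by rewrite expr0; split; [exact: bnd_unit|exact: tends_unit].
by rewrite exprS; split; [exact: bnd_conv|exact: tends_conv].
Qed.

Lemma tends_monomial (I : Type) (l : seq I) (f : I -> A) (L : I -> C) (al : I -> nat) :
  (forall i, bnd (f i)) -> (forall i, tends (psum chi ^~ (f i)) (L i)) ->
  bnd (\big[@dconv R k X/dunit]_(i <- l) dpow (f i) (al i)) /\
  tends (psum chi ^~ (\big[@dconv R k X/dunit]_(i <- l) dpow (f i) (al i)))
    (\prod_(i <- l) L i ^+ al i).
Proof.
move=> fb fL; elim: l => [|i l [IH1 IH2]].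
  by rewrite !big_nil; split; [exact: bnd_unit|exact: tends_unit].
rewrite !big_cons; have [p1 p2] := tends_pow (al i) (fb i) (fL i).
by split; [exact: bnd_conv|exact: tends_conv].
Qed.

Lemma psumD T g h : psum chi T (fun x => g x + h x) = psum chi T g + psum chi T h.
Proof.
by rewrite /psum -big_split; apply: eq_bigr => x _; rewrite /= mulrDl.
Qed.

Lemma psumZ T (k0 : C) g : psum chi T (fun x => k0 * g x) = k0 * psum chi T g.
Proof. by rewrite /psum mulr_sumr; apply: eq_bigr => x _; rewrite mulrA. Qed.

Lemma psum_sum (I : Type) (l : seq I) T (f : I -> A) :
  psum chi T (fun x => \sum_(i <- l) f i x) = \sum_(i <- l) psum chi T (f i).
Proof.
by rewrite /psum exchange_big; apply: eq_bigr => x _; rewrite mulr_suml.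
Qed.

(** Absolute convergence: the real and imaginary parts are differences of
    bounded monotone functions of [T]. *)
Lemma tends_exists g : bnd g -> exists L, tends (psum chi ^~ g) L.
Proof.
move=> [B gB].
have part (p : C -> R) : (forall z : C, `|p z| <= cabs z) ->
    exists L : R, forall e, 0 < e -> exists T0, forall T, T0 <= T ->
      `|\sum_(x <- FB T) p (g x * chi x) - L| <= e.
  move=> pc.
  have le1 x : `|p (g x * chi x)| <= cabs (g x) * w x.
    by apply: le_trans (pc _) _; rewrite cabsM ler_wpM2l ?cabs_ge0.
  pose f1 T := \sum_(x <- FB T) (p (g x * chi x) + cabs (g x) * w x).
  have f1m T T' : T <= T' -> f1 T <= f1 T'.
    apply: FB_sum_le => x; rewrite -lerBlDr sub0r.
    by have := le1 x; rewrite ler_norml => /andP[].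
  have f1B T : f1 T <= 2 * B.
    rewrite /f1 big_split /= mulr_natl mulr2n lerD ?gB//.
    apply: le_trans (gB T); apply: ler_sum => x _.
    by apply: le_trans (ler_norm _) (le1 x).
  have nmm T T' : T <= T' -> nm w T g <= nm w T' g by exact: nm_le.
  have [S1 a1 b1] := mono_gap f1m f1B; have [S2 a2 b2] := mono_gap nmm gB.
  exists (S1 - S2) => e e0; have [T1 h1] := b1 _ e0; have [T2 h2] := b2 _ e0.
  exists (Num.max T1 T2) => T; rewrite ge_max => /andP[/h1 k1 /h2 k2].
  have -> : \sum_(x <- FB T) p (g x * chi x) = f1 T - nm w T g.
    by rewrite /f1 /nm -sumrB; apply: eq_bigr => x _; rewrite addrK.
  exact: diff_close (a1 T) k1 (a2 T) k2.
have [La Ha] := part _ (@Re_le R); have [Lb Hb] := part _ (@Im_le R).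
exists (rc La + im R * rc Lb) => e e0; have e2 : 0 < e / 2 by rewrite divr_gt0.
have [T1 h1] := Ha _ e2; have [T2 h2] := Hb _ e2.
exists (Num.max T1 T2) => T; rewrite ge_max => /andP[/h1 k1 /h2 k2].
apply: le_trans (cabs_le_ReIm _) _.
have sumRe : cRe (psum chi T g) = \sum_(x <- FB T) cRe (g x * chi x).
  by rewrite /psum; elim/big_rec2: _ => [//|x a b _ <-]; rewrite cReD.
have sumIm : cIm (psum chi T g) = \sum_(x <- FB T) cIm (g x * chi x).
  by rewrite /psum; elim/big_rec2: _ => [//|x a b _ <-]; rewrite cImD.
by rewrite cReB cImB Re_mk Im_mk sumRe sumIm (splitr e) lerD.
Qed.

End Limits.

(** * The implicit equation in the algebra *)

Section Solve.
Variables (n m : nat) (delta : R).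
Hypothesis delta_gt0 : 0 < delta.
Hypothesis delta_le : forall x, x != origin -> delta <= wt x.
Local Notation index := {ffun 'I_(n + m) -> nat}.
Variables (c : 'I_m -> index -> C) (a : 'rV[A]_n) (z0 : 'rV[C]_m) (J : 'M[C]_m).
Hypothesis c0 : forall l, c l [ffun=> 0%N] = 0.
Hypothesis JE : forall j l, J j l = c l (e1 (rshift n j)).
Hypothesis J_unit : J \in unitmx.
Implicit Types (g : 'rV[A]_m) (l j : 'I_m).

Definition solves g := (forall j, g 0 j origin = z0 0 j) /\
  forall l x, Phi (c l) (row_mx a g) x = 0.

Definition rowof (h : X -> 'rV[C]_m) : 'rV[A]_m := \row_j (fun x => h x 0 j).
Definition ofrow g : X -> 'rV[C]_m := fun x => \row_j g 0 j x.

Lemma ofrowK g : rowof (ofrow g) = g.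
Proof. by apply/rowP => j; rewrite mxE; apply/funext => x; rewrite mxE. Qed.

Lemma rowofK h : ofrow (rowof h) = h.
Proof. by apply/funext => x; apply/rowP => j; rewrite !mxE. Qed.

(** A Newton step with the derivative frozen at the base point; the constant
    term is prescribed. *)
Definition newton (h : X -> 'rV[C]_m) : X -> 'rV[C]_m := fun x =>
  if x == origin then z0 else
  h x - (\row_l Phi (c l) (row_mx a (rowof h)) x) *m invmx J.

Lemma solves_newton g : solves g <-> newton (ofrow g) = ofrow g.
Proof.
split=> [[g0 gP]|E].
  apply/funext => x; rewrite /newton; case: eqP => [->|_].
    by apply/rowP => j; rewrite mxE g0.
  rewrite ofrowK (_ : \row_l _ = 0) ?mul0mx ?subr0//.
  by apply/rowP => l; rewrite !mxE gP.
split=> [j|l x].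
  have := congr1 (fun h : X -> 'rV[C]_m => h origin 0 j) E.
  by rewrite /newton eqxx mxE => <-.
have [->|xo] := eqVneq x origin; first by rewrite (Phi_origin delta_gt0 delta_le).
have := congr1 (fun h : X -> 'rV[C]_m => h x) E; rewrite /newton (negPf xo) ofrowK.
move=> /eqP; rewrite subr_eq addrC -subr_eq subrr eq_sym => /eqP.
move=> /(congr1 (fun v : 'rV[C]_m => v *m J)); rewrite mulmxKV// mul0mx => /rowP/(_ l).
by rewrite !mxE.
Qed.

(** By locality, a change of [h] at length at least [N delta] changes the left
    side of the equation by [J] times that change up to length [(N + 1) delta],
    and the Newton step cancels exactly this. *)
Lemma newton_local (N : nat) h h' : (forall x, wt x < N%:R * delta -> h x = h' x) ->
  forall x, wt x < N.+1%:R * delta -> newton h x = newton h' x.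
Proof.
move=> hh' x xN; rewrite /newton; case: (boolP (x == origin)) => [_|xo]; first by [].
have N0 : (0 < N)%N.
  case: N xN {hh'} => //; by rewrite mul1r ltNge delta_le.
pose s : R := N%:R * delta - delta.
have sE : s + delta = N%:R * delta by rewrite subrK.
have s2E : s + 2 * delta = N.+1%:R * delta by rewrite /s -natr1; ring.
pose b := row_mx a (rowof h); pose b' := row_mx a (rowof h').
have bE i y : wt y < s + delta -> b 0 i y = b' 0 i y.
  by rewrite sE !mxE => /hh' E; case: (fintype.split i) => [//|j]; rewrite !mxE E.
have b0 i : b 0 i origin = b' 0 i origin.
  by apply: bE; rewrite sE wt_origin mulr_gt0// ltr0n.
have E : (\row_l Phi (c l) b x) - (\row_l Phi (c l) b' x) = (h x - h' x) *m J.
  apply/rowP => l; rewrite !mxE (Phi_local delta_gt0 delta_le _ xo b0 bE) ?s2E//.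
  rewrite big_split_ord /= big1 ?add0r => [|i _]; last by rewrite !row_mxEl subrr mulr0.
  by apply: eq_bigr => j _; rewrite !row_mxEr !mxE JE mulrC.
have -> : (\row_l Phi (c l) b x) *m invmx J =
    h x - h' x + (\row_l Phi (c l) b' x) *m invmx J.
  by rewrite -[h x - h' x](mulmxK J_unit) -E mulmxBl subrK.
by rewrite opprD addrA subKr.
Qed.

Lemma exists_unique_solution : exists! g, solves g.
Proof.
have [[h hE] huniq] := contraction_fixpoint delta_gt0 z0 newton_local.
exists (rowof h); split; first by apply/solves_newton; rewrite rowofK.
move=> g /solves_newton gE; rewrite -[g]ofrowK; congr rowof; exact: huniq.
Qed.

(** * The norm of the solution *)

Section Bootstrap.
Variable w : X -> R.
Hypothesis w_ge0 : forall x, 0 <= w x.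
Hypothesis w_xadd : forall y z, w (xadd y z) = w y * w z.
Hypothesis w_origin : w origin = 1.
Variables (M t : R).
Hypotheses (M_ge0 : 0 <= M) (t_gt0 : 0 < t).
Hypothesis c_le : forall l al, cabs (c l al) <= M * t^-1 ^+ deg al.
Local Notation nmw := (nm w).

Definition cutoff T (N : nat) (b : 'rV[A]_N) : 'rV[A]_N :=
  \row_i (fun x => if (x == origin) || (wt x <= T) then b 0 i x else 0).

Lemma nm_cutoff T T' N (b : 'rV[A]_N) i : T' <= T ->
  nmw T (center (cutoff T' b 0 i)) <= nmw T' (center (b 0 i)).
Proof.
move=> TT'; rewrite /nm -(FB_le _ TT'); apply: ler_sum => x _.
have [->|xo] := eqVneq x origin.
  by rewrite !center_origin cabs0 mul0r; case: ifP.
rewrite !center_neq// mxE (negPf xo) /=; case: ifP => _ //.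
by rewrite cabs0 mul0r.
Qed.

Lemma nm_boxsum D T q l (b : 'rV[A]_(n + m)) (P : pred index) d :
  0 <= q -> q <= t / 4 -> (forall i, nmw T (center (b 0 i)) <= q) ->
  (forall al, P al -> (d <= deg al)%N) ->
  nmw T (fun x => \sum_(al <- box (n + m) D | P al) c l al * dmonomial X0 b al x)
    <= M * ((4 * (q / t)) ^+ d * 2 ^+ (n + m)).
Proof.
move=> q0 qt bq Pd; apply: (le_trans (nm_sum w_ge0 _ _ _ _)).
have u0 : 0 <= q / t by rewrite divr_ge0// ltW.
apply: (@le_trans _ _ (\sum_(al <- box (n + m) D | (d <= deg al)%N) M * (q / t) ^+ deg al)).
  rewrite big_mkcond [leRHS]big_mkcond; apply: ler_sum => al _.
  case: ifP => [/Pd ->|_]; last by case: ifP => // _; rewrite mulr_ge0 ?exprn_ge0.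
  rewrite nmZ.
  have h1 : nmw T (dmonomial X0 b al) <= q ^+ deg al.
    apply: (le_trans (nm_monomial w_ge0 w_xadd w_origin _ _ _ _)).
    rewrite /deg -prodrXr; apply: ler_prod => i _.
    by rewrite exprn_ge0 ?nm_ge0//= lerXn2r ?nnegrE ?nm_ge0.
  apply: (le_trans (ler_pM (cabs_ge0 _) (nm_ge0 w_ge0 _ _) (c_le l al) h1)).
  by rewrite expr_div_n -exprVn -mulrA [t^-1 ^+ _ * _]mulrC.
rewrite -mulr_sumr ler_wpM2l//; apply: box_geo => //.
by rewrite ler_pdivrMr// mulrC mulrA mulr1.
Qed.

(** At lengths up to [T < T' + delta], monomials of degree at least 2 only involve
    the values of [b] at lengths up to [T'], so [b] may be cut off there. *)
Lemma nm_high_degree D T T' q l (b : 'rV[A]_(n + m)) : T' <= T -> T < T' + delta ->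
  0 <= q -> q <= t / 4 -> (forall i, nmw T' (center (b 0 i)) <= q) ->
  nmw T (fun x => \sum_(al <- box (n + m) D | (2 <= deg al)%N)
                   c l al * dmonomial X0 b al x)
    <= M * ((4 * (q / t)) ^+ 2 * 2 ^+ (n + m)).
Proof.
move=> T'T TT' q0 qt bq; pose b' := cutoff T' b; pose s := T' - delta.
have bE i x : wt x < s + delta -> b 0 i x = b' 0 i x.
  by rewrite subrK mxE => /ltW ->; rewrite orbT.
have b0 i : b 0 i origin = b' 0 i origin by rewrite mxE eqxx.
rewrite (@eq_nm w T _ (fun x => \sum_(al <- box (n + m) D | (2 <= deg al)%N)
    c l al * dmonomial X0 b' al x)); last first.
  move=> x xT; apply: eq_bigr => al d2; congr (_ * _).
  have [_] := mon_agree delta_le al b0 bE x; apply.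
  rewrite (le_lt_trans xT)// (lt_le_trans TT')// /s -addrA lerD2l.
  apply: two_step.
  by rewrite ler_wpM2r ?(ltW delta_gt0)// ler_nat.
apply: nm_boxsum => // i.
by apply: (le_trans (nm_cutoff _ _ T'T)).
Qed.

(** At lengths up to [T] the series is a finite sum over some larger box, and the
    multi-indices outside [box D] have degree more than [D]. *)
Lemma nm_tail D T q l (b : 'rV[A]_(n + m)) :
  0 <= q -> q <= t / 4 -> (forall i, nmw T (center (b 0 i)) <= q) ->
  nmw T (fun x => Phi (c l) b x - \sum_(al <- box (n + m) D) c l al * dmonomial X0 b al x)
    <= M * ((4 * (q / t)) ^+ D.+1 * 2 ^+ (n + m)).
Proof.
move=> q0 qt bq; have [D' _ D'T] := exists_box delta_gt0 T.
have D'le x : wt x <= T -> wt x < (maxn D D').+1%:R * delta.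
  move=> /D'T /lt_le_trans; apply.
  by rewrite ler_wpM2r ?(ltW delta_gt0)// ler_nat ltnS leq_maxr.
have := @nm_boxsum (maxn D D') T q l b (fun al => al \notin box (n + m) D) D.+1 q0 qt bq.
move=> H; apply: le_trans (H _) => [|al]; last first.
  by apply: contraNT; rewrite -leqNgt; exact: deg_box.
apply: le_of_eq; apply: eq_nm => x xT.
rewrite (PhiE delta_gt0 delta_le _ _ (D'le x xT)) (box_le _ (leq_maxl D D')).
by rewrite [X in X - _](bigID (mem (box (n + m) D)))/= [X in X - _]addrC addrK.
Qed.

Lemma nm_Phi T q l (b : 'rV[A]_(n + m)) : 0 <= q -> q <= t / 4 ->
  (forall i, nmw T (center (b 0 i)) <= q) ->
  nmw T (Phi (c l) b) <= M * ((4 * (q / t)) ^+ 1 * 2 ^+ (n + m))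
    + M * ((4 * (q / t)) ^+ 0 * 2 ^+ (n + m)).
Proof.
move=> q0 qt bq; have h1 := nm_tail 0 l q0 qt bq.
have h2 := @nm_boxsum 0 T q l b xpredT 0 q0 qt bq (fun _ _ => isT).
apply: le_trans (lerD h1 h2); apply: le_trans (nmD w_ge0 _ _ _).
by apply: le_of_eq; apply: eq_nm => x _; rewrite subrK.
Qed.

(** Evaluation of the functional calculus at a multiplicative function: it is
    known for the finite partial sums, which converge in norm. *)
Lemma eval_Phi (chi : X -> C) l (b : 'rV[A]_(n + m)) q (om : 'I_(n + m) -> C) Fv B :
  (forall y z, chi (xadd y z) = chi y * chi z) ->
  (forall x, cabs (chi x) <= w x) -> chi origin = 1 ->
  0 <= q -> q <= t / 8 -> (forall i T, nmw T (center (b 0 i)) <= q) ->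
  (forall i, tends (psum chi ^~ (center (b 0 i))) (om i)) ->
  (forall D, cabs (Fv - \sum_(al <- box (n + m) D) c l al * \prod_i om i ^+ al i)
     <= B * (1 / 2) ^+ D) ->
  tends (psum chi ^~ (Phi (c l) b)) Fv.
Proof.
move=> chiD chi_le chi0 q0 qt bq bom Fom e e0.
have e3 : 0 < e / 3 by rewrite divr_gt0.
have qt4 : q <= t / 4 by apply: le_trans qt _; exact: eighth_quarter (ltW t_gt0).
have u0 : 0 <= 4 * (q / t) by rewrite mulr_ge0// divr_ge0// ltW.
have u2 : 4 * (q / t) <= 1 / 2.
  by rewrite mulrA ler_pdivrMr//; exact: four_eighth.
have B0 : 0 <= B by apply: le_trans (cabs_ge0 _) (le_trans (Fom 0%N) _); rewrite expr0 mulr1.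
have [D HD] := half_pow_small (B + M * 2 ^+ (n + m)) e3.
pose SD x := \sum_(al <- box (n + m) D) c l al * dmonomial X0 b al x.
pose FD := \sum_(al <- box (n + m) D) c l al * \prod_i om i ^+ al i.
have SL : tends (psum chi ^~ SD) FD.
  apply: tends_ext (tends_sum (u := fun al T => c l al * psum chi T (dmonomial X0 b al))
     (L := fun al => c l al * \prod_i om i ^+ al i) _ _).
    exists 0 => T _; rewrite psum_sum; apply: eq_bigr => al _.
    by rewrite psumZ.
  move=> al; apply: tendsZ.
  have bb i : bnd w (center (b 0 i)) by exists q => T.
  by have [] := tends_monomial w_ge0 w_xadd w_origin chiD chi_le chi0
    (index_enum 'I_(n + m)) al bb bom.
have [T0 H0] := SL _ e3; exists T0 => T /H0 H1.
have -> : psum chi T (Phi (c l) b) - Fv =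
   psum chi T (fun x => Phi (c l) b x - SD x) + (psum chi T SD - FD) - (Fv - FD).
  have -> : psum chi T (fun x => Phi (c l) b x - SD x) = psum chi T (Phi (c l) b) - psum chi T SD.
    by rewrite /psum -sumrB; apply: eq_bigr => x _; rewrite mulrBl.
  ring.
have p0 : 0 <= (1 / 2 : R) ^+ D by rewrite exprn_ge0// divr_ge0.
have h1 : cabs (psum chi T (fun x => Phi (c l) b x - SD x)) <= M * 2 ^+ (n + m) * (1 / 2) ^+ D.
  apply: (le_trans (psum_le chi_le _ _)).
  apply: (le_trans (nm_tail D l q0 qt4 (fun i => bq i T))).
  rewrite -mulrA ler_wpM2l// mulrC ler_wpM2l ?exprn_ge0//.
  apply: (@le_trans _ _ ((1 / 2) ^+ D.+1)); first by rewrite lerXn2r// nnegrE// divr_ge0.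
  by rewrite exprS ler_piMl// ler_pdivrMr// mul1r ler1n.
have h2 := Fom D; rewrite -/FD in h2.
apply: le_trans (cabsB _ _) _.
apply: le_trans (lerD (le_trans (cabsD _ _) (lerD h1 H1)) h2) _.
by rewrite mulrDl in HD; exact: third_sum e0 HD.
Qed.

(** Solving the equation for its linear part in [g] bounds the norm of [g] up to
    length [T] by a multiple of [eps] and a term that is quadratic in the norms of
    [a] and [g] up to length [T - delta / 2] only.  So the claimed bound, once it
    is consistent with this inequality, propagates from each length to the next
    by induction, without any convergence being known beforehand. *)
Lemma bootstrap g (eps K : R) (q := (1 + 2 * K) * eps)
    (K1 := \sum_l \sum_j cabs (invmx J j l)) : solves g ->
  0 <= eps -> 0 <= K -> (forall T, \sum_i nmw T (center (a 0 i)) <= eps) ->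
  q <= t / 4 ->
  K1 * (M * t^-1 * eps + M * ((4 * (q / t)) ^+ 2 * 2 ^+ (n + m))) <= 2 * K * eps ->
  forall T, \sum_l nmw T (center (g 0 l)) <= 2 * K * eps.
Proof.
move=> [g0 gP] eps0 K0 aeps qt HK.
have ke0 : 0 <= 2 * K * eps by rewrite !mulr_ge0.
have q0 : 0 <= q by rewrite mulr_ge0// addr_ge0// mulr_ge0.
have claim N T : T <= N%:R * (delta / 2) -> \sum_l nmw T (center (g 0 l)) <= 2 * K * eps.
  elim: N T => [|N IH] T TN.
    apply: le_trans ke0; rewrite big1// => l _; rewrite /nm big_seq big1// => x.
    rewrite in_FB => xT; have -> : x = origin.
      apply: wt_eq0 => //; apply/eqP; rewrite eq_le wt_ge0// andbT.
      by rewrite (le_trans xT)// (le_trans TN)// mul0r.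
    by rewrite center_origin cabs0 mul0r.
  pose T' := T - delta / 2.
  have d2 : 0 < delta / 2 by rewrite divr_gt0.
  have T'T : T' <= T by rewrite lerBlDr lerDl ltW.
  have TT' : T < T' + delta by rewrite /T' -addrA ltrDl {2}(splitr delta) addrA addNr add0r.
  have {}IH := IH T' (ltac:(by rewrite lerBlDr; apply: le_trans TN _; rewrite -natr1 mulrDl mul1r)).
  pose b := row_mx a g.
  have bq i : nmw T' (center (b 0 i)) <= q.
    rewrite /q mulrDl mul1r /b; case: (splitP i) => j ij.
      have -> : i = lshift m j by exact: val_inj.
      rewrite row_mxEl; apply: (@le_trans _ _ eps); last by rewrite lerDl.
      apply: le_trans (aeps T'); rewrite (bigD1 j)//= lerDl.
      by apply: sumr_ge0 => i' _; exact: nm_ge0.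
    have -> : i = rshift n j by exact: val_inj.
    rewrite row_mxEr; apply: (@le_trans _ _ (2 * K * eps)); last by rewrite lerDr.
    apply: le_trans IH; rewrite (bigD1 j)//= lerDl.
    by apply: sumr_ge0 => i' _; exact: nm_ge0.
  have [D D0 DT] := exists_box delta_gt0 T.
  pose Q l x := \sum_(al <- box (n + m) D | (2 <= deg al)%N) c l al * dmonomial X0 b al x.
  pose L l x := \sum_i c l (e1 (lshift m i)) * center (a 0 i) x.
  have gE l x : wt x <= T -> center (g 0 l) x = \sum_j (- invmx J j l) * (L j x + Q j x).
    move=> xT; have [->|xo] := eqVneq x origin.
      rewrite center_origin big1// => j _.
      rewrite /L /Q !big1 ?addr0 ?mulr0// => [al dal|i _].
        by rewrite (mon_origin delta_gt0 delta_le) ?mulr0//; exact: ltnW.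
      by rewrite center_origin mulr0.
    rewrite center_neq//.
    have EQ : (\row_j g 0 j x) *m J = - (\row_j (L j x + Q j x)).
      apply/rowP => j; rewrite !mxE; have := gP j x.
      rewrite (Phi_split delta_gt0 delta_le _ _ D0 xo (DT x xT)) big_split_ord /=.
      rewrite -/(Q j x).
      have -> : \sum_(i < n) c j (e1 (lshift m i)) * row_mx a g 0 (lshift m i) x = L j x.
        by apply: eq_bigr => i _; rewrite row_mxEl center_neq.
      have -> : \sum_(i < m) c j (e1 (rshift n i)) * row_mx a g 0 (rshift n i) x =
          \sum_i (\row_j g 0 j x) 0 i * J i j.
        by apply: eq_bigr => i _; rewrite row_mxEr mxE JE mulrC.
      move=> /eqP; rewrite addrAC addrC addr_eq0 => /eqP ->.
      by [].
    have := congr1 (fun v : 'rV[C]_m => (v *m invmx J) 0 l) EQ.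
    rewrite mulmxK// mxE => ->; rewrite mxE; apply: eq_bigr => j _.
    by rewrite !mxE mulNr mulrC mulNr.
  apply: le_trans HK; rewrite /K1 mulr_suml; apply: ler_sum => l _.
  rewrite (eq_nm w (gE l)); apply: (le_trans (nm_sum w_ge0 _ _ _ _)).
  rewrite mulr_suml; apply: ler_sum => j _; rewrite nmZ cabsN ler_wpM2l ?cabs_ge0//.
  apply: (le_trans (nmD w_ge0 _ _ _)); apply: lerD; last exact: (@nm_high_degree D T T' q j b T'T TT' q0 qt bq).
  apply: (le_trans (nm_sum w_ge0 _ _ _ _)).
  apply: (@le_trans _ _ (\sum_i M * t^-1 * nmw T (center (a 0 i)))).
    apply: ler_sum => i _; rewrite nmZ ler_wpM2r ?nm_ge0//.
    by apply: le_trans (c_le _ _) _; rewrite deg_e1 expr1.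
  by rewrite -mulr_sumr ler_wpM2l// mulr_ge0// invr_ge0 ltW.
move=> T; apply: (claim (Num.bound (`|T| / (delta / 2)))).
have d2 : 0 < delta / 2 by rewrite divr_gt0.
rewrite (le_trans (ler_norm _))// -ler_pdivrMr// ltW// archi_boundP//.
by rewrite divr_ge0// ltW.
Qed.

End Bootstrap.

End Solve.

End Semigroup.

(** * Exponential weights and Dirichlet series *)

Lemma quarters_lt (R : realType) (e : R) : 0 < e -> e / 4 + e / 4 < e.
Proof. by move=> ?; lra. Qed.

Section Characters.
Variables (R : realType) (k : nat) (X : set 'rV[R]_k).
Hypothesis X_ge0 : forall x, X x -> forall i, 0 <= x 0 i.
Hypothesis X_add : forall x y, X x -> X y -> X (x + y).
Hypothesis X0 : X 0.
Hypothesis X_discrete : limit_point X = set0.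
Local Notation C := (cplx R).
Local Notation A := (X -> C).
Local Notation origin := (@origin R k X X0).
Local Notation center := (center_part X0).
Implicit Types (x y z : X) (T r : R) (g : A) (s : 'rV[C]_k).

Lemma cexp0 : cexp 0 = 1 :> C.
Proof. by apply: cplx_eq; rewrite /cexp /cRe /cIm /= expR0 ?cos0 ?sin0 ?mulr1 ?mulr0. Qed.

Lemma cexpD (u v : C) : cexp (u + v) = cexp u * cexp v.
Proof.
apply: cplx_eq; rewrite ?cReM ?cImM /cexp {1}/cRe {1}/cIm /=;
  rewrite -/(cRe u) -/(cRe v) -/(cIm u) -/(cIm v) -/(cRe (u + v)) -/(cIm (u + v));
  rewrite cReD cImD expRD ?cosD ?sinD /cRe /cIm /=; ring.
Qed.

Lemma cabs_cexp (u : C) : cabs (cexp u) = expR (cRe u).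
Proof.
rewrite cabs_def /cexp {1}/cRe {1}/cIm /= !exprMn -mulrDr cos2Dsin2 mulr1.
by rewrite sqrtr_sqr gtr0_norm ?expR_gt0.
Qed.

Definition wr r x : R := expR (- r * wt x).

Lemma wr_ge0 r x : 0 <= wr r x. Proof. exact: expR_ge0. Qed.

Lemma wr_xadd r y z : wr r (xadd X_add y z) = wr r y * wr r z.
Proof. by rewrite /wr wt_xadd// mulrDr expRD. Qed.

Lemma wr_origin r : wr r origin = 1.
Proof. by rewrite /wr wt_origin// mulr0 expR0. Qed.

Lemma wr_le r r' x : r <= r' -> wr r' x <= wr r x.
Proof. by move=> rr'; rewrite ler_expR !mulNr lerN2 ler_wpM2r// wt_ge0. Qed.

Lemma wr_decay (delta : R) r r' x : r <= r' -> delta <= wt x ->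
  wr r' x <= expR (- (r' - r) * delta) * wr r x.
Proof.
move=> rr' dx; rewrite /wr -expRD ler_expR.
have -> : - r' * wt x = - (r' - r) * wt x + - r * wt x by ring.
by rewrite lerD2r !mulNr lerN2 ler_wpM2l// subr_ge0.
Qed.

Lemma bnd_wr_le r r' g : r <= r' -> bnd (wr r) g -> bnd (wr r') g.
Proof.
move=> rr' [B gB]; exists B => T; apply: le_trans (gB T).
by apply: ler_sum => x _; rewrite ler_wpM2l ?cabs_ge0// wr_le.
Qed.

Lemma nm_center_decay (delta : R) r r' T g :
  (forall x, x != origin -> delta <= wt x) -> r <= r' ->
  nm (wr r') T (center g) <= expR (- (r' - r) * delta) * nm (wr r) T (center g).
Proof.
move=> dle rr'; rewrite /nm mulr_sumr; apply: ler_sum => x _.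
have [->|xo] := eqVneq x origin; first by rewrite center_origin cabs0 !mul0r mulr0.
by rewrite mulrCA ler_wpM2l ?cabs_ge0// wr_decay// dle.
Qed.

Lemma fset_in_FB (F : {fset X}) : exists2 T0, 0 <= T0 &
  forall T, T0 <= T -> {subset F <= FB X T}.
Proof.
exists (\sum_(x <- F) wt x); first by rewrite sumr_ge0// => x _; exact: wt_ge0.
move=> T TT x xF; rewrite in_FB// (le_trans _ TT)// (big_fsetD1 x)//= lerDl.
by rewrite sumr_ge0// => y _; exact: wt_ge0.
Qed.

Lemma sum_in_FB (V : nmodType) (F : {fset X}) T (f : X -> V) :
  {subset F <= FB X T} ->
  \sum_(x <- F) f x = \sum_(x <- FB X T) (if x \in F then f x else 0).
Proof.
move=> FT; rewrite -big_mkcond -big_filter; apply: perm_big.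
apply: uniq_perm; rewrite ?filter_uniq ?fset_uniq// => x.
by rewrite mem_filter; case: (boolP (x \in F)) => // /FT ->.
Qed.

(** Every finite subset of [X] lies in a ball. *)
Lemma esum_bnd (f : X -> R) : (forall x, 0 <= f x) ->
  ((\esum_(x in [set: X]) (f x)%:E < +oo)%E <->
   exists B, forall T, \sum_(x <- FB X T) f x <= B).
Proof.
move=> f0; split=> [fin|[B fB]].
  have ge0 : (0 <= \esum_(x in [set: X]) (f x)%:E)%E by apply: esum_ge0 => x _; rewrite lee_fin.
  exists (fine (\esum_(x in [set: X]) (f x)%:E)) => T.
  rewrite -lee_fin fineK ?ge0_fin_numE//; apply: esum_ge.
  exists [set` FB X T]; first by split=> //; exact: finite_fset.
  by rewrite -fsbig_seq ?fset_uniq// sumEFin.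
apply: (@le_lt_trans _ _ B%:E); last exact: ltry.
apply: ge_ereal_sup => _ [F [Ff _] <-].
rewrite fsbig_finite//= sumEFin lee_fin.
have [T _ /(_ T (lexx _)) FT] := fset_in_FB (fset_set F).
apply: le_trans (fB T); rewrite (sum_in_FB _ FT); apply: ler_sum => x _.
by case: ifP.
Qed.

Lemma in_A_r_bnd r g : in_A_r r g <-> bnd (wr r) g.
Proof.
by apply: esum_bnd => x; rewrite mulr_ge0 ?cabs_ge0 ?expR_ge0.
Qed.

Definition chi s x : C := cexp (- cdot (val x) s).

Lemma chi_xadd s y z : chi s (xadd X_add y z) = chi s y * chi s z.
Proof.
rewrite /chi -cexpD -opprD; congr (cexp (- _)); rewrite /cdot -big_split.
by apply: eq_bigr => i _; rewrite val_xadd mxE -[(_ + _)%:C%C]/(rc (val y 0 i + val z 0 i)) rcD mulrDl.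
Qed.

Lemma chi_origin s : chi s origin = 1.
Proof.
rewrite /chi (_ : cdot _ _ = 0) ?oppr0 ?cexp0// /cdot big1// => i _.
by rewrite mxE (_ : _%:C%C = 0 :> C) ?mul0r.
Qed.

Lemma cRe_cdot x s : cRe (cdot (val x) s) = \sum_(i < k) val x 0 i * cRe (s 0 i).
Proof.
rewrite /cdot; elim/big_rec2: _ => [//|i u v _ <-]; rewrite cReD; congr (_ + _).
by rewrite cReM -/(rc _) {1}/cRe /= {1}/cIm /= mul0r subr0.
Qed.

Lemma chi_le r s x : (forall i, r <= cRe (s 0 i)) -> cabs (chi s x) <= wr r x.
Proof.
move=> rs; rewrite /chi cabs_cexp ler_expR cReN mulNr lerN2 cRe_cdot wtE// mulr_sumr.
by apply: ler_sum => i _; rewrite mulrC ler_wpM2l// val_ge0.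
Qed.

Lemma abs_cvg_bnd r g s : (forall i, r <= cRe (s 0 i)) -> bnd (wr r) g -> abs_cvg_at g s.
Proof.
move=> rs [B gB]; apply/(esum_bnd (fun x => cabs_ge0 _)).
exists B => T; apply: le_trans (gB T); apply: ler_sum => x _.
by rewrite /dterm cabsM ler_wpM2l ?cabs_ge0// chi_le.
Qed.

(** The sum over a finite set that contains a large ball differs from the sum over
    that ball by at most a tail of the norm, so the unordered sum is the limit
    along balls. *)
Lemma dseries_eq r g s L : (forall i, r <= cRe (s 0 i)) -> bnd (wr r) g ->
  tends (psum (chi s) ^~ g) L -> dseries g s = L.
Proof.
move=> rs gb gL; rewrite /dseries /summability.sum.
suff H : summability.partial_sum (dterm g s) @ summability.totally --> L.
  exact: (@cvg_lim _ (@norm_hausdorff _ _) _ _ (@summability.totally_filter X) _ _ H).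
move=> P /nbhs_cabsP[e e0 eP].
have e4 : 0 < e / 4 by rewrite divr_gt0.
have [T1 H1] := gL _ e4.
have [B gB] := gb.
have [S S1 S2] := mono_gap (fun T T' => @nm_le _ _ _ X_ge0 X_discrete _ (wr_ge0 r) T T' g) gB.
have [T2 H2] := S2 _ e4.
pose T := Num.max T1 T2; exists (FB X T) => // F /= FT.
apply: eP; have -> : summability.partial_sum (dterm g s) F = \sum_(x <- F) g x * chi s x.
  by rewrite /summability.partial_sum big_seq_fsetE.
have [T' _ FT'] := fset_in_FB F.
pose T3 := Num.max T T'.
have F3 := FT' T3 (ltac:(by rewrite le_max lexx orbT)).
have TT3 : T <= T3 by rewrite le_max lexx.
have d1 : cabs (\sum_(x <- F) g x * chi s x - psum (chi s) T g) <= nm (wr r) T3 g - nm (wr r) T g.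
  rewrite (sum_in_FB _ F3) /psum /nm -!(FB_le X_ge0 X_discrete _ TT3) -!sumrB.
  apply: le_trans (cabs_sum _ _ _) _; apply: ler_sum => x _.
  have hx : cabs (g x * chi s x) <= cabs (g x) * wr r x.
    by rewrite cabsM ler_wpM2l ?cabs_ge0// chi_le.
  case: ifP => xF; case: ifP => xT.
  - by rewrite !subrr cabs0.
  - by rewrite !subr0.
  - by move: xF; rewrite (fsubsetP FT)// in_FB.
  - by rewrite !subr0 cabs0 (le_trans (cabs_ge0 _) hx).
have d2 : nm (wr r) T3 g - nm (wr r) T g <= e / 4.
  by rewrite lerBlDr (le_trans (S1 T3))// -lerBlDl H2// le_max lexx orbT.
have d3 : cabs (psum (chi s) T g - L) <= e / 4 by apply: H1; rewrite le_max lexx.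
rewrite -[_ - L](subrKA (psum (chi s) T g)) (le_lt_trans (cabsD _ _))//.
apply: le_lt_trans (lerD (le_trans d1 d2) d3) _.
exact: quarters_lt.
Qed.

Lemma closed_halfspacesP r s i : closed_halfspaces r s -> r <= cRe (s 0 i).
Proof.
move=> /(_ i) cl; apply/ler_addgt0Pr => e e0.
have [z [/= zr ze]] := cl _ ((nbhs_cabsP (s 0 i) [set w | cabs (w - s 0 i) < e]).2
  (ex_intro2 _ _ e e0 (fun w h => h))).
have := le_lt_trans (Re_le _) ze; rewrite cReB ltr_norml => /andP[_ h].
by rewrite (le_trans (ltW zr))// -/(cRe z) -lerBlDl ltW.
Qed.

Lemma halfspaces_closed r s : (forall i, r < cRe (s 0 i)) -> closed_halfspaces r s.
Proof. by move=> h i; apply: subset_closure; exact: h. Qed.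

End Characters.

(** * A Dirichlet series determines its coefficients *)

Lemma fset_argmin (R : realType) (I : choiceType) (S : {fset I}) (P : pred I) (h : I -> R) x1 :
  x1 \in S -> P x1 ->
  exists x0, [/\ x0 \in S, P x0 & forall x, x \in S -> P x -> h x0 <= h x].
Proof.
move=> x1S Px1; case: (@Order.TotalTheory.arg_minP _ _ _ [` x1S]%fset
  (fun x : S => P (val x)) (fun x : S => h (val x)) Px1) => x0 Px0 x0min.
exists (val x0); split; [exact: valP|exact: Px0|].
by move=> x xS; exact: (x0min [` xS]%fset).
Qed.

Lemma fset_min_pos (R : realType) (I : choiceType) (S : {fset I}) (P : pred I) (G : I -> R) :
  (forall x, x \in S -> P x -> 0 < G x) ->
  exists2 ga, 0 < ga <= 1 & forall x, x \in S -> P x -> ga <= G x.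
Proof.
move=> G0; have [[x1 x1S Px1]|none] := pselect (exists2 x, x \in S & P x); last first.
  by exists 1; rewrite ?ltr01 ?lexx// => x xS Px; case: none; exists x.
have [x0 [x0S Px0 x0min]] := fset_argmin G x1S Px1.
exists (Num.min 1 (G x0)); first by rewrite lt_min ltr01 G0//= ge_min lexx.
by move=> x xS Px; rewrite ge_min x0min ?orbT.
Qed.

Lemma num_sep (R : realType) (W w1 a e h0 : R) : W = 4 * w1 + 4 -> 0 <= w1 ->
  e * W = 1/4 -> 0 <= a -> a <= W -> 0 <= 1 - 2 * (e * a) - 1/2.
Proof. move=> WE w0 eW a0 aW. have : 0 <= e * (W - a); last by rewrite mulrBr; lra.
have W0 : 0 < W by lra. have e0 : 0 <= e. rewrite -(pmulr_lge0 e W0). lra.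
by rewrite mulr_ge0// subr_ge0. Qed.

Lemma num_far (R : realType) (W w1 w0 wx : R) : W = 4 * w1 + 4 -> 0 <= w1 ->
  w0 - w0/4 <= w1 -> W < wx -> 1 <= wx/2 - w0.
Proof. by move=> *; lra. Qed.

Section Injectivity.
Variables (R : realType) (k : nat) (X : set 'rV[R]_k).
Hypothesis X_ge0 : forall x, X x -> forall i, 0 <= x 0 i.
Hypothesis X_discrete : limit_point X = set0.
Local Notation C := (cplx R).
Local Notation A := (X -> C).
Implicit Types (x y z : X) (T r : R) (g : A) (s : 'rV[C]_k).

(** Some linear functional with coefficients bounded below has a strict and even
    uniform minimum on the given set of points.  The minimizer [x0] of the
    function [|x| - e |x|_2^2], with [|.|_2] the Euclidean norm, is taken over the
    points of length at most [W], and the functional is the differential of this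
    function at [x0]: it exceeds its value at [x0] by a difference of values of
    the function plus [e |x - x0|_2^2].  As [e W = 1/4], the coefficients remain
    at least 1/2, so that points of length more than [W] do not compete. *)
Lemma separating_direction (P : pred X) x1 : P x1 ->
  exists x0 (la : 'I_k -> R) (ga : R), [/\ P x0, forall i, 1/2 <= la i, 0 < ga &
    forall x, P x -> x != x0 ->
      \sum_(i < k) la i * val x0 0 i + ga <= \sum_(i < k) la i * val x 0 i].
Proof.
move=> Px1.
have w10 := wt_ge0 X_ge0 x1.
pose W := 4 * wt x1 + 4; have W0 : 0 < W by rewrite ltr_wpDl// mulr_ge0.
pose e := (1/4) / W; have e0 : 0 < e by rewrite divr_gt0.
have eW : e * W = 1/4 by rewrite /e mulfVK ?gt_eqF.
pose sq x := \sum_(i < k) val x 0 i ^+ 2.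
pose h x := wt x - e * sq x.
have sq0 x : 0 <= sq x by rewrite sumr_ge0// => i _; exact: sqr_ge0.
have sqW x : wt x <= W -> e * sq x <= wt x / 4.
  move=> xW; apply: (@le_trans _ _ (e * (W * wt x))); last by rewrite mulrA eW mulrC mul1r.
  rewrite ler_wpM2l ?(ltW e0)// (wtE X_ge0) mulr_sumr; apply: ler_sum => i _.
  by rewrite expr2 ler_wpM2r ?val_ge0// (le_trans _ xW)// coord_le_wt.
have x1W : x1 \in FB X W.
  by rewrite in_FB// /W -[leLHS]addr0 lerD// ler_peMl// ler1n.
have [x0 [x0W Px0 x0min]] := fset_argmin h x1W Px1.
rewrite in_FB// in x0W.
have hx0 : wt x0 - wt x0 / 4 <= wt x1.
  apply: (@le_trans _ _ (h x0)); first by rewrite lerB// sqW.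
  by apply: (le_trans (x0min _ x1W Px1)); rewrite gerBl mulr_ge0 ?(ltW e0).
pose la i := 1 - 2 * (e * val x0 0 i).
have la_ge i : 1/2 <= la i.
  rewrite -subr_ge0; apply: (num_sep (W := W) 0 erefl) => //; first exact: val_ge0.
  by rewrite (le_trans _ x0W)// coord_le_wt.
have la_le i : la i <= 1.
  by rewrite gerBl mulr_ge0// mulr_ge0 ?(ltW e0)// val_ge0.
pose L x := \sum_(i < k) la i * val x 0 i.
have L0 : L x0 <= wt x0.
  by rewrite (wtE X_ge0); apply: ler_sum => i _; rewrite ler_piMl// val_ge0.
have GE x : L x - L x0 = (h x - h x0) + e * \sum_(i < k) (val x 0 i - val x0 0 i) ^+ 2.
  rewrite /h /sq !(wtE X_ge0) /L !mulr_sumr -!sumrB -big_split/=.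
  by apply: eq_bigr => i _; rewrite /la; ring.
have [|ga /andP[ga0 ga1] Hga] := 
  @fset_min_pos R _ (FB X W) (fun x => P x && (x != x0)) (fun x => L x - L x0).
  move=> x xW /andP[Px xx0]; rewrite GE ltr_wpDl ?subr_ge0 ?x0min//.
  rewrite mulr_gt0// lt_neqAle sumr_ge0 ?andbT; last by move=> i _; exact: sqr_ge0.
  apply: contra xx0; rewrite eq_sym psumr_eq0; last by move=> i _; exact: sqr_ge0.
  move=> /allP H; apply/eqP/val_inj/rowP => i; apply/eqP.
  by have := H i (mem_index_enum i); rewrite /= sqrf_eq0 subr_eq0.
exists x0, la, ga; split=> // x Px xx0.
rewrite -/(L x) -/(L x0) addrC -lerBrDr.
have [xW|Wx] := leP (wt x) W; first by apply: Hga; rewrite ?in_FB// Px.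
apply: le_trans ga1 _; apply: le_trans (num_far erefl w10 hx0 Wx) _.
rewrite lerB// (wtE X_ge0) mulr_suml; apply: ler_sum => i _.
by rewrite mulrC ler_wpM2r ?val_ge0// -div1r.
Qed.

(** If the coefficient at some point did not vanish, the direction [la] of the
    previous lemma would single out a point [x0] of the support.  Along the real
    points [s = (t0 + tau) la] the term at [x0] is at most the sum of the others in
    absolute value, which is smaller by a factor [exp(- tau ga)] up to a constant;
    this is absurd for large [tau].  In one variable, this is the usual argument
    with the smallest exponent; in several variables the order by length alone
    may have ties, which the direction [la] breaks. *)
Lemma psum_injective r0 r1 g : bnd (wr r0) g ->
  (forall s, (forall i, r1 < cRe (s 0 i)) -> tends (psum (chi s) ^~ g) 0) ->
  forall x, g x = 0.
Proof.
move=> [B gB] gL x1; apply/eqP; apply/negP => /negP gx1.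
have [x0 [la [ga [gx0 la2 ga0 sep]]]] := @separating_direction (fun x => g x != 0) x1 gx1.
pose L x := \sum_(i < k) la i * val x 0 i.
pose t0 := 2 * (`|r0| + `|r1| + 1).
have t00 : 0 < t0 by rewrite mulr_gt0// ltr_wpDl// addr_ge0.
pose s tau : 'rV[C]_k := \row_i rc ((t0 + tau) * la i).
have t0la i : `|r0| + `|r1| + 1 <= t0 * la i.
  apply: (@le_trans _ _ (t0 * (1/2))); last by rewrite ler_wpM2l ?(ltW t00).
  by rewrite /t0 mulrAC div1r divff ?pnatr_eq0// mul1r.
have sRe tau i : cRe (s tau 0 i) = (t0 + tau) * la i by rewrite mxE.
have chiE tau x : cabs (chi (s tau) x) = expR (- t0 * L x) * expR (- tau * L x).
  rewrite /chi cabs_cexp cReN cRe_cdot -expRD -mulrDl -opprD mulNr; congr (expR (- _)).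
  by rewrite /L mulr_sumr; apply: eq_bigr => i _; rewrite sRe; ring.
have small tau : 0 <= tau -> cabs (g x0) * expR (- t0 * L x0) * expR (- tau * L x0) <=
    B * expR (- tau * (L x0 + ga)).
  move=> tau0; apply/ler_addgt0Pr => e e0.
  have [|T0 HT0] := gL (s tau) _ _ e0.
    move=> i; rewrite sRe mulrDl (@lt_le_trans _ _ (t0 * la i))//.
      by apply: lt_le_trans (t0la i); rewrite ltr_pwDr// (le_trans (ler_norm r1))// lerDr.
    by rewrite lerDl mulr_ge0// (le_trans _ (la2 i)).
  pose T := Num.max T0 (wt x0).
  have := HT0 T (ltac:(by rewrite le_max lexx)); rewrite subr0 => HT.
  have x0T : x0 \in FB X T by rewrite in_FB// le_max lexx orbT.
  have -> : cabs (g x0) * expR (- t0 * L x0) * expR (- tau * L x0) = cabs (g x0 * chi (s tau) x0).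
    by rewrite cabsM chiE mulrA.
  have -> : g x0 * chi (s tau) x0 = psum (chi (s tau)) T g -
      \sum_(x <- FB X T | x != x0) g x * chi (s tau) x.
    by rewrite /psum (bigD1_seq x0) ?FB_uniq//= addrK.
  apply: le_trans (cabsB _ _) _; rewrite addrC lerD//.
  apply: le_trans (cabs_sum _ _ _) _.
  apply: (@le_trans _ _ (nm (wr r0) T g * expR (- tau * (L x0 + ga)))); last first.
    by rewrite ler_wpM2r ?expR_ge0.
  rewrite /nm mulr_suml [leRHS](bigD1_seq x0) ?FB_uniq//= ler_wpDl//.
    by rewrite !mulr_ge0 ?cabs_ge0 ?expR_ge0.
  apply: ler_sum => x xx0; have [->|gx] := eqVneq (g x) 0.
    by rewrite !mul0r cabs0 !mul0r.
  rewrite cabsM chiE -!mulrA ler_wpM2l ?cabs_ge0//.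
  apply: ler_pM; rewrite ?expR_ge0// ler_expR !mulNr lerN2; last first.
    by rewrite ler_wpM2l// sep.
  rewrite (wtE X_ge0) /L !mulr_sumr; apply: ler_sum => i _.
  rewrite mulrA ler_wpM2r ?val_ge0//; apply: le_trans (t0la i).
  by rewrite -addrA (le_trans (ler_norm r0))// lerDl addr_ge0.
pose Q := cabs (g x0) * expR (- t0 * L x0).
have Q0 : 0 < Q by rewrite mulr_gt0 ?cabs_gt0 ?expR_gt0.
have B0 : 0 <= B by apply: le_trans (gB 0); apply: nm_ge0 => x; exact: wr_ge0.
(* [exp(tau ga) >= 1 + tau ga], and [Q (1 + tau ga) > B] for this [tau]. *)
have := small (B / (Q * ga)) (divr_ge0 B0 (ltW (mulr_gt0 Q0 ga0))).
rewrite -/Q mulrDr expRD [leRHS]mulrCA [leLHS]mulrC ler_pM2l ?expR_gt0//.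
apply/negP; rewrite -ltNge mulNr expRN ltr_pdivrMr ?expR_gt0//.
apply: (@lt_le_trans _ _ (Q * (1 + B / (Q * ga) * ga))).
  have -> : B / (Q * ga) * ga = B / Q by rewrite invfM mulrA mulfVK ?gt_eqF.
  by rewrite mulrDr mulr1 mulrC mulfVK ?gt_eqF// ltrDr.
by rewrite ler_pM2l// expR_ge1Dx.
Qed.

End Injectivity.

(** * Taylor coefficients of a holomorphic map *)

Lemma prod_enum (T : comPzSemiRingType) N (G : 'I_N -> T) :
  \prod_(i <- enum 'I_N) G i = \prod_i G i.
Proof. by rewrite big_enum; exact: eq_bigl. Qed.

Section JointlyHolomorphic.
Variables (R : realType).
Local Notation C := (cplx R).

Lemma nbhs_pclose N (w : 'rV[C]_N) (S : set 'rV[C]_N) : nbhs w S ->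
  exists2 r : R, 0 < r & forall w', pclose r w w' -> S w'.
Proof.
move=> /nbhs_ballP[e /= e0 eS]; have [r r0 er] := posC e0.
have r2 : 0 < r / 2 by rewrite divr_gt0.
exists (r / 2) => // w' ww'; apply: eS; split=> // i j.
rewrite (ord1 i) /ball /= er norm_cabs ltr_rc cabsC (le_lt_trans (ww' j))//.
by rewrite gtr_pMr// invf_lt1// ltr1n.
Qed.

Lemma coord_open_prod n m (V : set 'rV[C]_n) (Z : set 'rV[C]_m) : open V -> open Z ->
  coord_open (prod_dom V Z).
Proof.
move=> Vo Zo w [Vw Zw].
have [r r0 rV] := nbhs_pclose (open_nbhs_nbhs (conj Vo Vw)).
have [r' r'0 rZ] := nbhs_pclose (open_nbhs_nbhs (conj Zo Zw)).
exists (Num.min r r'); first by rewrite lt_min r0.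
move=> w' ww'; split; [apply: rV|apply: rZ] => i; rewrite !mxE;
  by apply: (le_trans (ww' _)); rewrite ge_min lexx ?orbT.
Qed.

Lemma differentiable_entry N p (F : 'rV[C]_N -> 'rV[C]_p) l w : differentiable F w ->
  differentiable (fun w => F w 0 l) w.
Proof.
by move=> dF; apply: (differentiable_comp (g := fun v : 'rV[C]_p => v 0 l)) => //;
  exact: differentiable_coord.
Qed.

(** The passage from complex differentiability of a map to the class of functions
    for which the Taylor expansion was proved. *)
Lemma sholo_entry N p (U : set 'rV[C]_N) (F : 'rV[C]_N -> 'rV[C]_p) l :
  holomorphic_on U F -> sholo U (fun w => F w 0 l).
Proof.
move=> FU w /FU /(differentiable_entry l) dF; split=> [i|]; first exact: diff_derivable.
have := differentiable_continuous dF.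
move=> /(_ _ ((nbhs_cabsP _ [set z | cabs (z - F w 0 l) < 1]).2 _)) H.
have [|r r0 Hr] := nbhs_pclose (H _); first by exists 1.
exists r, (1 + cabs (F w 0 l)); split=> // w' /Hr /= h.
by rewrite -lerBlDr ltW// (le_lt_trans (cabs_dist _ _)).
Qed.

Lemma common_polydisc N m (U : set 'rV[C]_N) (f : 'I_m -> 'rV[C]_N -> C) p :
  coord_open U -> (forall l, sholo U (f l)) -> U p ->
  exists t M, [/\ 0 < t, 0 <= M, forall w, pclose (2 * t) p w -> U w &
    forall l w, pclose (2 * t) p w -> cabs (f l w) <= M].
Proof.
move=> Uo fU Up; have [r0 r00 Hr0] := Uo _ Up.
have /choice[rM H] : forall l, exists rM : R * R, 0 < rM.1 /\
    forall w', pclose rM.1 p w' -> cabs (f l w') <= rM.2.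
  by move=> l; have [_ [r [M [rp rM]]]] := fU l _ Up; exists (r, M).
have M0 l : 0 <= (rM l).2.
  by apply: le_trans (cabs_ge0 _) ((H l).2 p (pclose_refl _ (ltW (H l).1))).
have i0 l : 0 < (rM l).1^-1 by rewrite invr_gt0; exact: (H l).1.
pose S := \sum_l (rM l).1^-1.
have S0 : 0 <= S by rewrite sumr_ge0// => l _; exact: ltW.
have S1 l : (rM l).1^-1 <= S.
  by rewrite /S (bigD1 l)//= lerDl sumr_ge0// => l' _; exact: ltW.
(* A positive lower bound of finitely many radii. *)
pose r := (r0^-1 + S)^-1.
have rp : 0 < r by rewrite invr_gt0 ltr_wpDr// invr_gt0.
have rr0 : r <= r0 by rewrite invf_ple ?posrE// ?ltr_wpDr ?invr_gt0// lerDl.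
have rrl l : r <= (rM l).1.
  rewrite invf_ple ?posrE//; [|by rewrite ltr_wpDr// invr_gt0|exact: (H l).1].
  by rewrite (le_trans (S1 l))// lerDr invr_ge0 ltW.
have rE : 2 * (r / 2) = r by rewrite mulrC divfK// pnatr_eq0.
exists (r / 2), (\sum_l (rM l).2); rewrite rE; split.
- by rewrite divr_gt0.
- by rewrite sumr_ge0.
- by move=> w /(pclose_le rr0); exact: Hr0.
move=> l w /(pclose_le (rrl l)) /(H l).2 /le_trans; apply.
by rewrite (bigD1 l)//= lerDl sumr_ge0.
Qed.

Section Coefficients.
Variables (N : nat).
Local Notation ev := (@ev R N).
Implicit Types (f : 'rV[C]_N -> C) (p w : 'rV[C]_N) (al : {ffun 'I_N -> nat}) (U : set 'rV[C]_N).

Definition tcoef f p al : C := mpartial al f p / (\prod_(i < N) (al i)`!)%:R.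

Lemma mpl0 l f : mpl l [ffun=> 0%N] f = f.
Proof. by elim: l => //= i l ->; rewrite ffunE. Qed.

Lemma mpl_e1 l i f : uniq l -> mpl l (e1 i) f = if i \in l then Dj i f else f.
Proof.
elim: l => [//|j l IH] /andP[jl ul].
rewrite -[LHS]/(iter (e1 i j) (Dj j) (mpl l (e1 i) f)) IH// ffunE in_cons [i == j]eq_sym.
have [<-|_] := eqVneq j i; last exact: erefl.
rewrite (negPf jl); exact: erefl.
Qed.

Lemma tcoef0 f p : tcoef f p [ffun=> 0%N] = f p.
Proof.
rewrite /tcoef (_ : mpartial _ f = f); last exact: mpl0.
by rewrite big1 ?divr1// => i _; rewrite ffunE.
Qed.

Lemma tcoef_e1 f p i : tcoef f p (e1 i) = 'D_(ev i) f p.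
Proof.
rewrite /tcoef (_ : mpartial _ f = Dj i f).
  by rewrite big1 ?divr1// => j _; rewrite ffunE; case: eqP.
by rewrite -[LHS]/(mpl (enum 'I_N) (e1 i) f) mpl_e1 ?enum_uniq// mem_enum.
Qed.

Section Polydisc.
Variables (U : set 'rV[C]_N) (f : 'rV[C]_N -> C) (p : 'rV[C]_N) (t M : R).
Hypotheses (Uo : coord_open U) (fU : sholo U f) (t_gt0 : 0 < t).
Hypothesis pU : forall w, pclose (2 * t) p w -> U w.
Hypothesis fM : forall w, pclose (2 * t) p w -> cabs (f w) <= M.

Lemma tcoef_le al : cabs (tcoef f p al) <= M * 4 ^+ N * t^-1 ^+ deg al.
Proof.
rewrite /tcoef cabsM cabsV cabs_nat ler_pdivrMr; last first.
  by rewrite ltr0n prodn_gt0// => i; exact: fact_gt0.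
have := mpl_bound al Uo fU t_gt0 pU (enum_uniq 'I_N) (fun w h => fM h.1).
move=> /le_trans; apply; rewrite prod_enum -!mulrA ler_wpM2l//.
  by apply: le_trans (cabs_ge0 _) (fM (pclose_refl _ _)); rewrite mulr_ge0// ltW.
rewrite !big_split /= prodr_const card_ord -natr_prod /deg -prodrXr.
under [in leRHS]eq_bigr do rewrite exprVn.
by rewrite -mulrA mulrC -mulrA.
Qed.

Lemma tcoef_taylor w D : pclose (t / 2) p w ->
  cabs (f w - \sum_(al <- box N D) tcoef f p al * \prod_i (w 0 i - p 0 i) ^+ al i)
    <= 16 ^+ N * M * (1 / 2) ^+ D.
Proof.
move=> pw.
have := taylor_bound D Uo fU t_gt0 pU (enum_uniq 'I_N) (fun w h => fM h.1) pw.
rewrite -cardE card_ord => /(_ _); rewrite (_ : taylor _ _ _ _ _ = 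
  \sum_(al <- box N D) tcoef f p al * \prod_i (w 0 i - p 0 i) ^+ al i).
  by apply => i; rewrite mem_enum.
rewrite /taylor big_map big_enum /= big_mkcond; apply: eq_bigr => be _.
rewrite ifT; last by apply/forallP => i; rewrite mem_enum.
rewrite /tcoef prod_enum prodf_div -natr_prod.
rewrite mulrCA mulrC -!mulrA; congr (_ * _).
  apply: (congr1 (fun h : 'rV[C]_N -> C => h p)); apply: eq_mpl => i _; rewrite ffunE; exact: erefl.
congr (_^-1 * _); [congr (_%:R)|]; apply: eq_bigr => i _; rewrite ffunE; exact: erefl.
Qed.

End Polydisc.
End Coefficients.

Lemma derive_entry N p (F : 'rV[C]_N -> 'rV[C]_p) (l : 'I_p) (a v : 'rV[C]_N) :
  derivable F a v -> 'D_v (fun w => F w 0 l) a = ('D_v F a) 0 l.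
Proof.
move=> dF; apply: (cvg_lim (@norm_hausdorff _ _)).
have H : h^-1 *: ((F \o shift a) (h *: v) - F a) @[h --> 0^'] --> 'D_v F a by exact: dF.
have := cvg_comp _ _ H (@coord_continuous C 1 p 0 l ('D_v F a)).
by apply: cvg_trans; apply: near_eq_cvg; near=> h; rewrite /= !mxE.
Unshelve. all: by end_near.
Qed.

Lemma tcoef_jacobian n m (F : 'rV[C]_(n + m) -> 'rV[C]_m) v0 z0 j l :
  differentiable F (row_mx v0 z0) ->
  jacobian (fun z : 'rV[C]_m => F (row_mx v0 z)) z0 j l =
  tcoef (fun w => F w 0 l) (row_mx v0 z0) (e1 (rshift n j)).
Proof.
move=> dF; rewrite tcoef_e1.
pose G z := row_mx v0 z : 'rV[C]_(n + m).
have GE : G = (fun z => row_mx v0 0 + \sum_i z 0 i *: ev R (rshift n i)).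
  apply/funext => z; apply/rowP => i; rewrite !mxE summxE.
  case: (splitP i) => i' ii'.
    rewrite big1 ?addr0// => i'' _; rewrite !mxE eqxx /=.
    have /negPf-> : i != rshift n i'' by rewrite -val_eqE /= ii' ltn_eqF// ltn_addr.
    by rewrite mulr0.
  have -> : i = rshift n i' by exact: val_inj.
  rewrite mxE add0r (bigD1 i')//= big1 => [|i'' ii]; rewrite !mxE eqxx /=.
    by rewrite eqxx mulr1 addr0.
  by rewrite (inj_eq (@rshift_inj _ _)) eq_sym (negPf ii) mulr0.
have dG : differentiable G z0.
  rewrite GE; apply: differentiableD => //.
  rewrite (_ : (fun z : 'rV[C]_m => _) = \sum_i (fun z : 'rV[C]_m => z 0 i *: ev R (rshift n i)));
    last by apply/funext => z; rewrite fct_sumE.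
  apply: differentiable_sum => i; apply: (differentiable_comp (f := fun z : 'rV[C]_m => z 0 i)
    (g := fun c : C => c *: ev R (rshift n i))); first exact: differentiable_coord.
  by have [] := is_diff_scalel (z0 0 i) (ev R (rshift n i)).
have dFG : differentiable (F \o G) z0 by exact: differentiable_comp.
have := deriveEjacobian (delta_mx 0 j) dFG; rewrite -rowE => /rowP/(_ l).
rewrite [RHS]mxE => <-.
rewrite -derive_entry; last exact: diff_derivable.
rewrite /derive; apply: (congr1 (fun q : C -> C => lim (q @ 0^'))).
apply/funext => h; rewrite /= /G.
suff -> : row_mx v0 (h *: delta_mx 0 j + z0) = h *: ev R (rshift n j) + row_mx v0 z0 by [].
apply/rowP => i; rewrite !mxE; case: (splitP i) => i' ii'; rewrite ?mxE ?eqxx /=.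
  have /negPf-> : i != rshift n j by rewrite -val_eqE /= ii' ltn_eqF// ltn_addr.
  by rewrite mulr0 add0r.
have -> : i = rshift n i' by exact: val_inj.
by rewrite (inj_eq (@rshift_inj _ _)).
Qed.

End JointlyHolomorphic.

(** * The implicit function theorem *)

Lemma le_sum4 (F : realFieldType) (a b c d : F) : 0 <= a -> 0 <= b -> 0 <= c -> 0 <= d ->
  [/\ a <= a + b + c + d, b <= a + b + c + d, c <= a + b + c + d & d <= a + b + c + d].
Proof. by move=> *; split; lra. Qed.

(** [K] is chosen such that the linear term uses up half of [2 K eps], and then
    [eps] so small that the quadratic term fits into the other half. *)
Lemma bootstrap_constants (F : realFieldType) (K1 M t P q0 : F) :
  0 <= K1 -> 0 <= M -> 0 < t -> 0 <= P -> 0 < q0 ->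
  exists K eps, [/\ 0 <= K, 0 < eps, eps <= q0 /\ 2 * K * eps <= q0,
    (1 + 2 * K) * eps <= t / 4 &
    K1 * (M * t^-1 * eps + M * ((4 * ((1 + 2 * K) * eps / t)) ^+ 2 * P)) <= 2 * K * eps].
Proof.
move=> K10 M0 t0 P0 q00.
have ti : 0 < t^-1 by rewrite invr_gt0.
pose K := K1 * M * t^-1 + 1; pose D := K1 * M * (4 * (1 + 2 * K) * t^-1) ^+ 2 * P.
have K0 : 0 < K by rewrite ltr_wpDl// !mulr_ge0// ltW.
have D0 : 0 <= D by rewrite mulr_ge0// mulr_ge0 ?sqr_ge0// mulr_ge0.
have K2 : 0 < 1 + 2 * K by rewrite ltr_pwDl// mulr_ge0// ltW.
have H1 : 0 < q0^-1 by rewrite invr_gt0.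
pose S := q0^-1 + 2 * K * q0^-1 + (1 + 2 * K) * 4 * t^-1 + D.
have p1 : 0 <= 2 * K * q0^-1 by rewrite !mulr_ge0// ltW.
have p2 : 0 <= (1 + 2 * K) * 4 * t^-1 by rewrite !mulr_ge0// ltW.
have SE : S = q0^-1 + (2 * K * q0^-1 + ((1 + 2 * K) * 4 * t^-1 + D)) by rewrite /S !addrA.
have S0 : 0 < S by rewrite SE ltr_pwDl// !addr_ge0.
have [S1 S2 S3 S4] : [/\ q0^-1 <= S, 2 * K * q0^-1 <= S, (1 + 2 * K) * 4 * t^-1 <= S & D <= S].
  exact: le_sum4 (ltW H1) p1 p2 D0.
pose e := S^-1; have e0 : 0 < e by rewrite invr_gt0.
have eS : S * e = 1 by rewrite divff ?gt_eqF.
have small x : 0 <= x -> x <= S -> x * e <= 1 by move=> x0 xS; rewrite -eS ler_wpM2r// ltW.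
exists K, e; split.
- exact: ltW.
- exact: e0.
- split.
  have := small _ (ltW H1) S1.
    by rewrite mulrC ler_pdivrMr// mul1r.
  have := small _ p1 S2.
  by rewrite mulrAC ler_pdivrMr// mul1r.
- have := small _ p2 S3.
  by rewrite mulrAC ler_pdivrMr// mul1r mulrAC ler_pdivlMr.
have De : D * e <= 1 by exact: small.
have -> : K1 * (M * t^-1 * e + M * ((4 * ((1 + 2 * K) * e / t)) ^+ 2 * P)) =
  (K1 * M * t^-1) * e + (D * e) * e by rewrite /D; ring.
rewrite -mulrDl ler_wpM2r ?(ltW e0)// mulr_natl mulr2n lerD// /K.
  by rewrite lerDl.
by rewrite (le_trans De)// lerDr !mulr_ge0// ltW.
Qed.

Lemma tends_le (R : realType) (u : R -> cplx R) L (q : R) : tends u L ->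
  (forall T, cabs (u T) <= q) -> cabs L <= q.
Proof.
move=> uL uq; apply/ler_addgt0Pr => e /uL[T /(_ T (lexx _))]; rewrite cabsC => h.
by rewrite [q + e]addrC (le_trans _ (lerD h (uq T)))// -lerBlDr cabs_dist.
Qed.

Section ImplicitFunction.
Variables (R : realType) (k n m : nat) (X : set 'rV[R]_k).
Hypothesis X_ge0 : forall x, X x -> forall i, 0 <= x 0 i.
Hypothesis X_add : forall x y, X x -> X y -> X (x + y).
Hypothesis X0 : X 0.
Hypothesis X_discrete : limit_point X = set0.
Local Notation C := (cplx R).
Local Notation A := (X -> C).
Local Notation origin := (@origin R k X X0).
Local Notation center := (center_part X0).
Implicit Types (x y z : X) (T r : R) (g : 'rV[A]_m) (s : 'rV[C]_k).

(** Without constant terms, passing from [r0] to [r] gains a factor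
    [exp(- (r - r0) delta)]. *)
Lemma decay_small N (b : 'rV[A]_N) r0 (eps : R) : (forall i, bnd (wr r0) (b 0 i)) ->
  0 < eps -> exists r1, forall r, r1 <= r ->
    forall T, \sum_i nm (wr r) T (center (b 0 i)) <= eps.
Proof.
move=> bb e0; have [delta d0 dle] := min_weight X_ge0 X0 X_discrete.
have /choice[B HB] : forall i, exists B, forall T, nm (wr r0) T (center (b 0 i)) <= B.
  move=> i; apply: bnd_center; by [exact: wr_ge0|exact: wr_origin|exact: bb|].
have B0 : 0 <= \sum_i B i.
  by apply: sumr_ge0 => i _; apply: le_trans (HB i 0); apply: nm_ge0 => x; exact: wr_ge0.
pose v := (\sum_i B i) / eps; have v0 : 0 <= v by rewrite divr_ge0// ltW.
exists (r0 + v / delta) => r rr T.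
have rr0 : r0 <= r by apply: le_trans rr; rewrite lerDl divr_ge0// ltW.
apply: (@le_trans _ _ (expR (- (r - r0) * delta) * \sum_i B i)).
  rewrite mulr_sumr; apply: ler_sum => i _.
  by apply: le_trans (nm_center_decay _ _ dle rr0) _; rewrite ler_wpM2l ?expR_ge0.
rewrite mulNr expRN mulrC ler_pdivrMr ?expR_gt0// mulrC -ler_pdivrMr// -/v.
apply: (@le_trans _ _ (1 + (r - r0) * delta)); last exact: expR_ge1Dx.
by rewrite ler_wpDl// -ler_pdivrMr// lerBrDl.
Qed.

Lemma common_bnd N (b : 'rV[A]_N) : (forall i, in_A_oo (b 0 i)) ->
  exists r0, forall r, r0 <= r -> forall i, bnd (wr r) (b 0 i).
Proof.
move=> /choice[ri H]; exists (\sum_i `|ri i|) => r rr i.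
apply: (@bnd_wr_le _ _ _ X_ge0 (ri i)); last by apply/in_A_r_bnd => //; exact: H.
apply: le_trans rr; rewrite (bigD1 i)//= (le_trans (ler_norm _))// lerDl sumr_ge0//.
Qed.

Variables (V : set 'rV[C]_n) (Z : set 'rV[C]_m) (F : 'rV[C]_(n + m) -> 'rV[C]_m).
Variables (v0 : 'rV[C]_n) (z0 : 'rV[C]_m) (a : 'rV[A]_n).
Hypotheses (V_open : open V) (Z_open : open Z).
Hypothesis F_holo : holomorphic_on (prod_dom V Z) F.
Hypothesis a0 : at_origin X0 a = v0.
Local Notation U := (prod_dom V Z).
Local Notation p := (row_mx v0 z0).
Local Notation c := (fun l => tcoef (fun w => F w 0 l) p).

Lemma bnd_of_center N (b : 'rV[A]_N) r q :
  (forall i T, nm (wr r) T (center (b 0 i)) <= q) -> forall i, bnd (wr r) (b 0 i).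
Proof.
move=> H i.
have -> : b 0 i = fun x => center (b 0 i) x + b 0 i origin * dunit x.
  by apply/funext => x; rewrite /center_part subrK.
apply: bndD; first exact: wr_ge0.
  by exists q.
apply: bndZ; apply: bnd_unit; by [exact: wr_ge0|exact: wr_origin|].
Qed.

Lemma at_originE N (b : 'rV[A]_N) i : at_origin X0 b 0 i = b 0 i origin.
Proof. by rewrite mxE. Qed.

Lemma holo_calc_Phi (b : 'rV[A]_(n + m)) l : at_origin X0 b = p ->
  holo_calc X0 (fun w => F w 0 l) b = Phi X0 (c l) b.
Proof. by move=> bp; apply/funext => x; rewrite /holo_calc bp. Qed.

Lemma at_origin_row g : at_origin X0 g = z0 -> at_origin X0 (row_mx a g) = p.
Proof. by rewrite /at_origin map_row_mx => ->; rewrite -/(at_origin X0 a) a0. Qed.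

Lemma solution_solves g :
  at_origin X0 g = z0 /\ holo_calc_tuple X0 F (row_mx a g) = 0 <-> solves X0 c a z0 g.
Proof.
split=> [[g0 gF]|[g0 gF]].
  split=> [j|l x]; first by rewrite -g0 at_originE.
  rewrite -holo_calc_Phi; last exact: at_origin_row.
  by have /rowP/(_ l) := gF; rewrite !mxE => /(congr1 (fun h : A => h x)).
have gz : at_origin X0 g = z0 by apply/rowP => j; rewrite at_originE.
split=> //; apply/rowP => l; rewrite !mxE holo_calc_Phi; last exact: at_origin_row.
by apply/funext => x; rewrite gF.
Qed.

Section Domain.
Variables (t M : R).
Hypotheses (t_gt0 : 0 < t) (M_ge0 : 0 <= M).
Hypothesis pU : forall w, pclose (2 * t) p w -> U w.
Hypothesis pM : forall l w, pclose (2 * t) p w -> cabs (F w 0 l) <= M.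

Let Uo : coord_open U. Proof. exact: coord_open_prod. Qed.
Let fU l : sholo U (fun w => F w 0 l). Proof. exact: sholo_entry. Qed.
Let c_le l al : cabs (c l al) <= M * 4 ^+ (n + m) * t^-1 ^+ deg al.
Proof. by apply: (tcoef_le Uo (fU l) t_gt0 pU (pM l)). Qed.

(** At [s] with real parts at least [r], the values of the elements differ from
    their constant terms by at most [t / 8]; so the point lies in the polydisc
    where the Taylor series of [F] converges, and functional calculus commutes
    with evaluation. *)
Lemma eval_at (b : 'rV[A]_(n + m)) r s : at_origin X0 b = p ->
  (forall i, bnd (wr r) (b 0 i)) ->
  (forall i T, nm (wr r) T (center (b 0 i)) <= t / 8) ->
  (forall i, r <= cRe (s 0 i)) ->
  U (dseries_tuple b s) /\
  forall l, tends (psum (chi s) ^~ (Phi X0 (c l) b)) (F (dseries_tuple b s) 0 l).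
Proof.
move=> bp bb bt rs; have [delta d0 dle] := min_weight X_ge0 X0 X_discrete.
have chile x := chi_le X_ge0 x rs.
pose om i := dseries (b 0 i) s - p 0 i.
have omL i : tends (psum (chi s) ^~ (center (b 0 i))) (om i).
  have [L HL] := tends_exists X_ge0 X_discrete (wr_ge0 r) chile (bb i).
  have E : om i = L + (- p 0 i) * 1.
    by rewrite mulr1 /om (dseries_eq X_ge0 X_discrete rs (bb i) HL).
  rewrite E; apply: tends_ext (tendsD HL (tendsZ (- p 0 i) (tends_unit X_ge0 X_discrete (chi_origin X0 s)))).
  exists 0 => T _; rewrite -psumZ -psumD; congr psum; apply/funext => x.
  by rewrite /center_part -bp at_originE mulNr.
have omt i : cabs (om i) <= t / 8.
  apply: tends_le (omL i) _ => T; exact: (le_trans (psum_le chile _ _) (bt i T)).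
have dE i : dseries_tuple b s 0 i = dseries (b 0 i) s by rewrite mxE.
have pd r' : t / 8 <= r' -> pclose r' p (dseries_tuple b s).
  by move=> tr i; rewrite dE (le_trans (omt i)).
have t0 := ltW t_gt0.
have h2 : t / 8 <= 2 * t by rewrite ler_pdivrMr// mulrAC ler_peMl// -natrM ler1n.
have h3 : t / 8 <= t / 2 by rewrite ler_pM2l// lef_pV2 ?posrE// ler_nat.
split; first by apply: pU; exact: pd.
move=> l; have t8 : 0 <= t / 8 by rewrite divr_ge0.
have M4 : 0 <= M * 4 ^+ (n + m) by rewrite mulr_ge0// exprn_ge0.
apply: (eval_Phi X_ge0 X_discrete d0 dle (wr_ge0 r) (wr_xadd X_ge0 X_add r) (wr_origin X_ge0 X0 r)
  M4 t_gt0 c_le (chi_xadd X_add s) chile (chi_origin X0 s) t8 (lexx _) bt omL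
  (B := 16 ^+ (n + m) * M)) => D.
have := tcoef_taylor Uo (fU l) t_gt0 pU (pM l) D (pd _ h3).
by under eq_bigr do under eq_bigr do rewrite dE.
Qed.

Hypothesis F_p : F p = 0.
Hypothesis Vv0 : U p.
Local Notation J := (jacobian (fun z : 'rV[C]_m => F (row_mx v0 z)) z0).
Hypothesis J_unit : J \in unitmx.

Let JE j l : J j l = c l (e1 (rshift n j)).
Proof. by apply: tcoef_jacobian; exact: F_holo. Qed.

Lemma exists_unique_solves : exists! g, solves X0 c a z0 g.
Proof.
have [delta d0 dle] := min_weight X_ge0 X0 X_discrete.
apply: (exists_unique_solution X_ge0 X_add X_discrete d0 dle a z0 _ JE J_unit) => l.
by rewrite tcoef0 F_p mxE.
Qed.

(** The a priori bound: for large [r] the solution lies in the algebra of index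
    [r], with norms as small as the evaluation at points requires. *)
Lemma solves_decay g r0 : solves X0 c a z0 g -> (forall i, bnd (wr r0) (a 0 i)) ->
  exists r1, forall r, r1 <= r -> forall i T, nm (wr r) T (center (row_mx a g 0 i)) <= t / 8.
Proof.
move=> gs ab; have [delta d0 dle] := min_weight X_ge0 X0 X_discrete.
have M4 : 0 <= M * 4 ^+ (n + m) by rewrite mulr_ge0// exprn_ge0.
pose K1 := \sum_l \sum_j cabs (invmx J j l).
have K10 : 0 <= K1 by do 2 (apply: sumr_ge0 => ? _); exact: cabs_ge0.
have t8 : 0 < t / 8 by rewrite divr_gt0.
have [K [eps [K0 e0 [e1 e2] e3 e4]]] :=
  bootstrap_constants K10 M4 t_gt0 (exprn_ge0 (n + m) (ler0n R 2)) t8.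
have [r1 Hr1] := decay_small ab e0; exists r1 => r rr i T.
have gb := bootstrap X_ge0 X_discrete d0 dle JE J_unit (wr_ge0 r) (wr_xadd X_ge0 X_add r)
  (wr_origin X_ge0 X0 r) M4 t_gt0 c_le gs (ltW e0) K0 (Hr1 r rr) e3 e4 T.
have one (N : nat) (b : 'rV[A]_N) (B : R) j : \sum_i nm (wr r) T (center (b 0 i)) <= B ->
    nm (wr r) T (center (b 0 j)) <= B.
  apply: le_trans; rewrite (bigD1 j)//= lerDl sumr_ge0// => j' _.
  by apply: nm_ge0 => x; exact: wr_ge0.
rewrite mxE; case: (fintype.split i) => j.
  exact: le_trans (one _ _ _ j (Hr1 r rr T)) e1.
exact: le_trans (one _ _ _ j gb) e2.
Qed.

End Domain.

End ImplicitFunction.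

Theorem theorem3 (R : realType) (k n m : nat)
    (k_gt0 : (0 < k)%N) (n_gt0 : (0 < n)%N) (m_gt0 : (0 < m)%N)
    (X : set 'rV[R]_k)
    (X_ge0 : forall x, X x -> forall i, 0 <= x 0 i)
    (X_add : forall x y, X x -> X y -> X (x + y))
    (X0 : X 0)
    (X_infinite : infinite_set X)
    (X_discrete : limit_point X = set0)
    (V : set 'rV[cplx R]_n) (Z : set 'rV[cplx R]_m)
    (V_open : open V) (Z_open : open Z)
    (F : 'rV[cplx R]_(n + m) -> 'rV[cplx R]_m)
    (F_holo : holomorphic_on (prod_dom V Z) F)
    (v0 : 'rV[cplx R]_n) (z0 : 'rV[cplx R]_m)
    (Vv0 : V v0) (Zz0 : Z z0)
    (F0 : F (row_mx v0 z0) = 0)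
    (a : 'rV[X -> cplx R]_n)
    (a0 : at_origin X0 a = v0)
    (dzF : jacobian (fun z : 'rV[cplx R]_m => F (row_mx v0 z)) z0 \in unitmx) :
  let solution (g : 'rV[X -> cplx R]_m) : Prop :=
    at_origin X0 g = z0 /\ holo_calc_tuple X0 F (row_mx a g) = 0 in
  let solution_on (r : R) (g : 'rV[X -> cplx R]_m) : Prop :=
    forall s, closed_halfspaces r s ->
      [/\ forall i, abs_cvg_at (a 0 i) s,
          forall j, abs_cvg_at (g 0 j) s,
          prod_dom V Z (row_mx (dseries_tuple a s) (dseries_tuple g s))
        & F (row_mx (dseries_tuple a s) (dseries_tuple g s)) = 0] in
  (exists! g : 'rV[X -> cplx R]_m, solution g) /\
  (forall g : 'rV[X -> cplx R]_m, solution g ->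
    (forall i, in_A_oo (a 0 i)) ->
    [/\ forall j, in_A_oo (g 0 j),
        \forall r \near +oo, solution_on r g
      & forall h : 'rV[X -> cplx R]_m,
          (forall j, in_A_oo (h 0 j)) ->
          at_origin X0 h = z0 ->
          (exists r : R, solution_on r h) ->
          h = g]).
Proof.
move=> solution solution_on.
have Up : prod_dom V Z (row_mx v0 z0) by split; rewrite ?row_mxKl ?row_mxKr.
have Uo := coord_open_prod V_open Z_open.
have [t [M [t0 M0 pU pM]]] := common_polydisc Uo (fun l => sholo_entry l F_holo) Up.
have solP g := solution_solves F z0 a0 g.
have [g0 [g0s g0_unique]] := exists_unique_solves X_ge0 X_add X0 X_discrete a F_holo F0 Up dzF.
have [delta d0 dle] := min_weight X_ge0 X0 X_discrete.
have t8 : 0 < t / 8 by rewrite divr_gt0.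
have psum0 (s : 'rV[cplx R]_k) (g : X -> cplx R) : (forall x, g x = 0) ->
    tends (psum (chi s) ^~ g) 0.
  move=> g00; apply: tends_ext (tends_cst 0); exists 0 => T _.
  by rewrite /psum big1// => x _; rewrite g00 mul0r.
have rowE (g : 'rV[X -> cplx R]_m) s :
    row_mx (dseries_tuple a s) (dseries_tuple g s) = dseries_tuple (row_mx a g) s.
  by rewrite /dseries_tuple map_row_mx.
split.
  exists g0; split; first exact/solP.
  by move=> h /solP; exact: g0_unique.
move=> g gsol aoo; have gs := (solP g).1 gsol.
have [ra Ha] := common_bnd X_ge0 X_discrete aoo.
have [r1 Hr1] := solves_decay X_ge0 X_add X_discrete V_open Z_open F_holo t0 M0 pU pM Up dzF gs
  (Ha ra (lexx _)).
have gb r (rr : r1 <= r) := bnd_of_center X_ge0 X_discrete (Hr1 r rr).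
split.
- move=> j; exists r1; apply/in_A_r_bnd => //.
  by have := gb r1 (lexx _) (rshift n j); rewrite row_mxEr.
- exists r1; split; first exact: num_real.
  move=> r /ltW rr s sr; have rs i := closed_halfspacesP i sr.
  have bp := at_origin_row a0 gsol.1.
  have [DU DF] := eval_at X_ge0 X_add X_discrete V_open Z_open F_holo t0 M0 pU pM bp
    (gb r rr) (Hr1 r rr) rs.
  rewrite rowE; split=> //.
  + move=> i; apply: (abs_cvg_bnd X_ge0 X_discrete rs).
    by have := gb r rr (lshift m i); rewrite row_mxEl.
  + move=> j; apply: (abs_cvg_bnd X_ge0 X_discrete rs).
    by have := gb r rr (rshift n j); rewrite row_mxEr.
  apply/rowP => l; rewrite [RHS]mxE; apply: tends_unique (DF l) _.
  by apply: psum0 => x; rewrite gs.2.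
move=> h hoo h0 [r Hr].
have boo i : in_A_oo (row_mx a h 0 i).
  by rewrite mxE; case: (fintype.split i).
have [rb Hb] := common_bnd X_ge0 X_discrete boo.
have [r2 Hr2] := decay_small X_ge0 X0 X_discrete (Hb rb (lexx _)) t8.
pose r3 := Num.max r r2.
have bt i T : nm (wr r3) T (center_part X0 (row_mx a h 0 i)) <= t / 8.
  apply: le_trans (Hr2 r3 _ T); last by rewrite le_max lexx orbT.
  rewrite (bigD1 i)//= lerDl sumr_ge0// => j _; apply: nm_ge0 => x; exact: wr_ge0.
(* The Dirichlet series of [F[a, h]] is the value of [F] at the series of [a] and
   [h], hence zero in the region where these are close to [(v0, z0)]. *)
have hs : solves X0 (fun l => tcoef (fun w => F w 0 l) (row_mx v0 z0)) a z0 h.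
  split=> [j|l]; first by rewrite -h0 mxE.
  apply: (psum_injective X_ge0 X_discrete (r0 := r3) (r1 := r3)).
    have M4 : 0 <= M * 4 ^+ (n + m) by rewrite mulr_ge0// exprn_ge0.
    have t84 : t / 8 <= t / 4 by rewrite ler_pM2l// lef_pV2 ?posrE// ler_nat.
    have H T := nm_Phi X_ge0 X_discrete d0 dle (wr_ge0 r3) (wr_xadd X_ge0 X_add r3)
      (wr_origin X_ge0 X0 r3) M4 t0
      (fun l al => tcoef_le Uo (sholo_entry l F_holo) t0 pU (pM l) al)
      l (ltW t8) t84 (fun i => bt i T).
    eexists => T; exact: (H T).
  move=> s sr3; have rs i := ltW (sr3 i).
  have sr : closed_halfspaces r s.
    by apply: halfspaces_closed => i; apply: le_lt_trans (sr3 i); rewrite le_max lexx.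
  have [_ _ _] := Hr s sr; rewrite rowE => Fs0.
  have bp := at_origin_row a0 h0.
  have [_ DF] := eval_at X_ge0 X_add X_discrete V_open Z_open F_holo t0 M0 pU pM bp
    (bnd_of_center X_ge0 X_discrete bt) bt rs.
  by have := DF l; rewrite Fs0 mxE.
by rewrite -(g0_unique _ hs) (g0_unique _ gs).
Qed.
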